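(* Let $\Omega\subset\mathbb{R}^N$, $N\ge2$, be a bounded Lipschitz domain. Then $\lambda_{1,1}=h_{\mathcal N}(\Omega)$. Moreover: (i) if $u$ is a minimizer of $\lambda_{1,1}$, then $\omega_t^\pm:=\{x\in\Omega: u^\pm(x)>t\}$ is a minimizer for $h_{\mathcal N}(\Omega)$ for almost every $t\in(0,\|u^\pm\|_\infty)$, whenever $\|u^\pm\|_\infty\ne0$; (ii) if $A$ achieves $h_{\mathcal N}(\Omega)$, then $u:=\chi_A$ is a minimizer for $\lambda_{1,1}$. Furthermore, if $B$ also achieves $h_{\mathcal N}(\Omega)$ and $A\cap B=\emptyset$, then $u:=\alpha\chi_A-\beta\chi_B$ is a minimizer for $\lambda_{1,1}$ for any $\alpha,\beta\in\mathbb{R}$ such that $\alpha,\beta\ne0$ and $\alpha\beta\ge0$.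
   Context: $|A|=\mathcal{H}^N(A)$ is Lebesgue measure; $\chi_A$ is the characteristic function of $A$; $u^+=\max\{0,u\}$, $u^-=\max\{-u,0\}$. Total variation: $|Du|(\Omega)=\sup\{\int_\Omega u\operatorname{div}\varphi\,d\mathcal{H}^N:\varphi\in C_c^\infty(\Omega,\mathbb{R}^N),\|\varphi\|_\infty\le1\}$, and $BV(\Omega)=\{u\in L^1(\Omega):|Du|(\Omega)<\infty\}$. For $\omega\subset\Omega$, the relative perimeter is $P(\omega;\Omega):=|D\chi_\omega|(\Omega)$. $$h_{\mathcal N}(\Omega):=\inf\Big\{\frac{P(\omega;\Omega)}{|\omega|}:\ \omega\subset\Omega,\ 0<|\omega|\le\frac{|\Omega|}{2}\Big\}.$$ Let $\mathfrak{N}(\Omega):=\{u\in BV(\Omega):\ \big||\{u>0\}|-|\{u<0\}|\big|\le|\{u=0\}|\}$ and $$\lambda_{1,1}:=\inf\Big\{\frac{|Du|(\Omega)}{\|u\|_1}:\ u\in\mathfrak{N}(\Omega)\setminus\{0\}\Big\}=\inf\{|Du|(\Omega):u\in\mathfrak{N}(\Omega),\ \|u\|_1=1\}.$$ A minimizer of $\lambda_{1,1}$ is a function $u\in\mathfrak{N}(\Omega)\setminus\{0\}$ attaining the quotient infimum. A set achieves (is a minimizer for) $h_{\mathcal N}(\Omega)$ if it is admissible and attains the infimum. *)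

(* Defs.v *)
From HB Require Import structures.
From mathcomp Require Import all_boot all_order all_algebra.
From mathcomp Require Import all_classical all_reals all_analysis.

Set Implicit Arguments.
Unset Strict Implicit.
Unset Printing Implicit Defensive.
Import Order.TTheory GRing.Theory Num.Theory.
Import numFieldNormedType.Exports.

Local Open Scope classical_set_scope.
Local Open Scope ring_scope.

Section LebesgueMeasure.
Context {R : realType} {N : nat}.
Implicit Types (a b : 'rV[R]_N) (A : set 'rV[R]_N).

Definition box a b : set 'rV[R]_N :=
  [set x | forall i, a 0 i < x 0 i <= b 0 i].

Definition box_volume a b : R := \prod_(i < N) Num.max 0 (b 0 i - a 0 i).

(* Covers are indexed by an arbitrary D : set nat, so that finite and empty
   covers are allowed; for N = 0 no box is empty or has volume 0. *)
Definition lebesgue_outer A : \bar R :=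
  ereal_inf [set s | exists (D : set nat) (a b : nat -> 'rV[R]_N),
    A `<=` \bigcup_(k in D) box (a k) (b k) /\
    s = \esum_(k in D) (box_volume (a k) (b k))%:E].

Lemma box_volume_ge0 a b : 0 <= box_volume a b.
Proof. by apply: prodr_ge0 => i _; rewrite le_max lexx. Qed.

Local Open Scope ereal_scope.

Lemma lebesgue_outer_ge0 A : 0 <= lebesgue_outer A.
Proof.
apply: le_ereal_inf_tmp => _ [D [a [b [_ ->]]]].
by apply: esum_ge0 => k _; rewrite lee_fin box_volume_ge0.
Qed.

Lemma lebesgue_outer0 : lebesgue_outer set0 = 0.
Proof.
apply/eqP; rewrite eq_le lebesgue_outer_ge0 andbT.
apply: ereal_inf_lbound; exists set0, (fun=> 0%R), (fun=> 0%R).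
by split; [exact: sub0set | rewrite esum_set0].
Qed.

Lemma le_lebesgue_outer : {homo lebesgue_outer : A B / A `<=` B >-> A <= B}.
Proof.
move=> A B AB; apply: ereal_inf_le_tmp => _ [D [a [b [BD ->]]]].
by exists D, a, b; split=> //; exact: subset_trans BD.
Qed.

Lemma lebesgue_outer_sigma_subadditive : sigma_subadditive lebesgue_outer.
Proof.
move=> A; have [[i ioo]|] := pselect (exists i, lebesgue_outer (A i) = +oo).
  rewrite (eseries_pinfty _ _ ioo) ?leey// => n _.
  by rewrite -ltNye (lt_le_trans _ (lebesgue_outer_ge0 _)).
rewrite -forallNE => Aoo.
apply/lee_addgt0Pr => e e0.
apply: (le_trans _ (epsilon_trick xpredT (fun n => lebesgue_outer_ge0 (A n))
  (ltW e0))).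
have /choice[G PG] n : exists G : set nat * (nat -> 'rV[R]_N) * (nat -> 'rV[R]_N),
    A n `<=` \bigcup_(k in G.1.1) box (G.1.2 k) (G.2 k) /\
    \esum_(k in G.1.1) (box_volume (G.1.2 k) (G.2 k))%:E
      <= lebesgue_outer (A n) + (e / (2 ^ n.+1)%:R)%:E.
  have en1 : (0 < e / (2 ^ n.+1)%:R)%R by rewrite divr_gt0// ltr0n expn_gt0.
  have : lebesgue_outer (A n) \is a fin_num.
    by rewrite ge0_fin_numE ?lebesgue_outer_ge0// ltey; apply/eqP/Aoo.
  move=> /(lb_ereal_inf_adherent en1)[_ [D [a [b [AD ->]]]] /ltW le].
  by exists (D, a, b).
have /card_esym/ppcard_eqP[f] := card_nat2.
pose v (p : nat * nat) := (box_volume ((G p.1).1.2 p.2) ((G p.1).2 p.2))%:E.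
pose K : set (nat * nat) := [set p | (G p.1).1.1 p.2].
have v0 p : 0 <= v p by rewrite lee_fin box_volume_ge0.
apply: (@le_trans _ _ (\esum_(p in K) v p)).
  apply: ereal_inf_lbound.
  exists (f @^-1` K), (fun k => (G (f k).1).1.2 (f k).2),
    (fun k => (G (f k).1).2 (f k).2); split.
    move=> x [n _ /(PG n).1[k Gk xk]].
    have ff : f (f^-1%FUN (n, k)) = (n, k) by rewrite invK ?inE.
    by exists (f^-1%FUN (n, k)); rewrite /K/= ff.
  rewrite (@reindex_esum _ _ _ (f @^-1` K) K f v) //.
  split=> [k//|k l _ _|p Kp]; first by apply: inj; rewrite inE.
  by exists (f^-1%FUN p); rewrite /= invK ?inE.
have -> : K = setT `*`` (fun n => (G n).1.1).
  by apply/seteqP; split=> -[n k] //= [].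
rewrite -(@esum_esum _ _ _ setT (fun n => (G n).1.1)
  (fun n k => (box_volume ((G n).1.2 k) ((G n).2 k))%:E)); last first.
  by move=> n k; rewrite lee_fin box_volume_ge0.
rewrite nneseries_esumT; last first.
  by move=> n; rewrite adde_ge0 ?lebesgue_outer_ge0// lee_fin divr_ge0// ltW.
by apply: le_esum => n _; exact: (PG n).2.
Qed.

HB.instance Definition _ := isOuterMeasure.Build R 'rV[R]_N lebesgue_outer
  lebesgue_outer0 lebesgue_outer_ge0 le_lebesgue_outer
  lebesgue_outer_sigma_subadditive.

End LebesgueMeasure.

(* 'rV[R]_N with the sigma-algebra of the Lebesgue (Caratheodory) measurable
   sets, which is larger than the Borel sigma-algebra. *)
Definition lebesgue_rV (R : realType) (N : nat) : Type :=
  caratheodory_type (@lebesgue_outer R N).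
HB.instance Definition _ (R : realType) (N : nat) :=
  Measurable.on (lebesgue_rV R N).

Definition leb {R : realType} {N : nat} (A : set (lebesgue_rV R N)) : \bar R :=
  lebesgue_outer A.
HB.instance Definition _ (R : realType) (N : nat) :=
  isMeasure.Build _ (lebesgue_rV R N) R (@leb R N)
    (@caratheodory_measure0 _ _ (@lebesgue_outer R N))
    (@caratheodory_measure_ge0 _ _ (@lebesgue_outer R N))
    (@caratheodory_measure_sigma_additive _ _ (@lebesgue_outer R N)).

Section Geometry.
Context {R : realType} {N : nat}.
Implicit Type Omega : set 'rV[R]_N.

(* After a rotation Q, Omega coincides near each of its boundary points with the
   strict epigraph, in the direction of the i-th axis, of a Lipschitz function
   of the other coordinates; [col' i y] is y without its i-th coordinate.  The
   translation bringing x to the origin is absorbed in g. *)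
Definition lipschitz_boundary Omega : Prop :=
  forall x, (closure Omega `\` interior Omega) x ->
  exists (Q : 'M[R]_N) (i : 'I_N) (g : 'rV[R]_N.-1 -> R),
    [/\ Q *m Q^T = 1%:M, lipschitz g &
        \forall y \near x, Omega y <-> g (col' i (y *m Q)) < (y *m Q) 0 i].

Definition bounded_lipschitz_domain Omega : Prop :=
  [/\ open Omega, connected Omega, Omega !=set0, bounded_set Omega &
      lipschitz_boundary Omega].

End Geometry.

Section TotalVariation.
Context {R : realType} {N : nat}.
Implicit Types (Omega omega : set 'rV[R]_N) (u : 'rV[R]_N -> R)
  (phi : 'rV[R]_N -> 'rV[R]_N).

Fixpoint Ck (k : nat) phi : Prop :=
  continuous phi /\
  match k with
  | 0 => True
  | k'.+1 => forall i : 'I_N,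
      (forall x, derivable phi x (delta_mx 0 i)) /\
      Ck k' (fun x => 'D_(delta_mx 0 i) phi x)
  end.

Definition smooth phi : Prop := forall k, Ck k phi.

(* The library norm on 'rV[R]_N is the maximum norm. *)
Definition euclidean_norm (x : 'rV[R]_N) : R :=
  Num.sqrt (\sum_(i < N) x 0 i ^+ 2).

Definition divergence phi (x : 'rV[R]_N) : R :=
  \sum_(i < N) ('D_(delta_mx 0 i) phi x) 0 i.

(* C_c^infty(Omega, R^N), each function being extended by 0 outside Omega. *)
Definition test_functions Omega : set ('rV[R]_N -> 'rV[R]_N) :=
  [set phi | [/\ smooth phi,
                 compact (closure [set x | phi x != 0]) &
                 closure [set x | phi x != 0] `<=` Omega]].

Local Open Scope ereal_scope.

Definition total_variation_in Omega u : \bar R :=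
  ereal_sup [set \int[leb]_(x in (Omega : set (lebesgue_rV R N)))
                    (u x * divergence phi x)%:E |
    phi in [set phi | test_functions Omega phi /\
                      forall x, (euclidean_norm (phi x) <= 1)%R]].

Definition BV_space Omega : set ('rV[R]_N -> R) :=
  [set u | leb.-integrable (Omega : set (lebesgue_rV R N)) (EFin \o u) /\
           total_variation_in Omega u < +oo].

Definition perimeter omega Omega : \bar R := total_variation_in Omega \1_omega.

(* ||u||_p over Omega; for p = +oo this is the essential supremum of |u|. *)
Definition Lnorm_in (p : \bar R) Omega u : \bar R :=
  'N[leb]_p[((EFin \o u) \_ Omega : lebesgue_rV R N -> \bar R)].

End TotalVariation.

Section Cheeger.
Context {R : realType} {N : nat}.
Implicit Types (Omega omega : set 'rV[R]_N) (u : 'rV[R]_N -> R).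

Local Open Scope ereal_scope.

Definition cheeger_admissible Omega omega : Prop :=
  [/\ measurable (omega : set (lebesgue_rV R N)), omega `<=` Omega,
      0 < leb omega & leb omega <= leb Omega / 2%:E].

Definition cheeger_neumann Omega : \bar R :=
  ereal_inf [set perimeter omega Omega / leb omega |
             omega in cheeger_admissible Omega].

Definition achieves_cheeger Omega omega : Prop :=
  cheeger_admissible Omega omega /\
  perimeter omega Omega / leb omega = cheeger_neumann Omega.

Definition balanced Omega : set ('rV[R]_N -> R) :=
  [set u | BV_space Omega u /\
    `|leb (Omega `&` [set x | (u x > 0)%R]) -
      leb (Omega `&` [set x | (u x < 0)%R])|
      <= leb (Omega `&` [set x | u x = 0%R])].

(* Elements of L^1(Omega) are represented by functions, so that u != 0 means
   that u does not vanish almost everywhere in Omega. *)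
Definition lambda11_admissible Omega u : Prop :=
  balanced Omega u /\ ~ {ae @leb R N, forall x, Omega x -> u x = 0%R}.

Definition lambda11 Omega : \bar R :=
  ereal_inf [set total_variation_in Omega u / Lnorm_in 1 Omega u |
             u in lambda11_admissible Omega].

Definition lambda11_minimizer Omega u : Prop :=
  lambda11_admissible Omega u /\
  total_variation_in Omega u / Lnorm_in 1 Omega u = lambda11 Omega.

End Cheeger.

(* Main.v *)
(** The heart of the matter is one half of the coarea formula.  Let eta_k be finitely many
    C^1 functions of one variable with sum_k |eta_k'| <= 1.  Then sum_k TV(eta_k o u) <= TV(u):
    given fields phi_k admissible for the left-hand side, mollify u into v; the mollification
    of the field sum_k eta_k'(v) phi_k is admissible for TV(u), and since mollification is
    self-adjoint its pairing with u is the pairing of sum_k eta_k'(v) phi_k with v, which is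
    the sum of the pairings of the eta_k o v with the phi_k.  Take for the eta_k smoothed unit
    steps of height 1/n cutting out the slabs [k/n, (k+1)/n] of the values of u and of -u.
    Letting n tend to infinity, by Fatou's lemma and the lower semicontinuity of the total
    variation there is a function G >= 0 on [0, oo[ with integral at most TV(u) and
    P({u > t}) + P({u < -t}) <= G(t) for every t >= 0.

    If u is balanced, {u > t} and {u < -t} fill at most half of Omega, so that
    h (|{u > t}| + |{u < -t}|) <= G(t), and integrating in t gives h ||u||_1 <= TV(u).
    Indicators of the sets admissible for h are balanced, whence lambda_{1,1} = h.  For a
    minimizer u all these inequalities are equalities for almost every t, which is (i).  For
    (ii), h is finite because a smooth bump with small support is balanced, and
    TV(alpha 1_A - beta 1_B) <= |alpha| P(A) + |beta| P(B) = h ||alpha 1_A - beta 1_B||_1. *)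

Require Import Defs.
From HB Require Import structures.
From mathcomp Require Import all_boot all_order all_algebra.
From mathcomp Require Import all_classical all_reals all_analysis.
From mathcomp Require Import measurable_realfun ess_sup_inf lra.
Set Implicit Arguments.
Unset Strict Implicit.
Unset Printing Implicit Defensive.
Import Order.TTheory GRing.Theory Num.Theory.
Import numFieldNormedType.Exports.
Local Open Scope classical_set_scope.
Local Open Scope ring_scope.

(** * Lebesgue measure on row vectors *)

(** The field sum_k eta_k'(v) phi_k is only continuous, hence not a test field; mollifying it makes
    it smooth. This keeps the Euclidean norm at most 1, as it averages vectors of the unit ball
    against a kernel of mass one, and the support stays in Omega if the radius is small compared
    with the distance from the supports of the phi_k to the complement of Omega. The compositions
    must be treated jointly: the bound sum_k |eta_k'| <= 1 at each point is what gives the constant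
    1. Putting the slabs of u and of -u in one family yields both superlevel sets at once, without
    splitting TV(u) into the variations of u^+ and u^-.

    G is a liminf of step functions. It stands in for t |-> P({u > t}) + P({u < -t}) under the
    integral sign, so that only the measurability of G is used. For a minimizer, h (|{u > t}| + |{u
    < -t}|) and G(t) have the same finite integral, hence agree almost everywhere, and the
    perimeters are squeezed between them. *)

Section LebesgueBasics.
Context {R : realType} {N : nat}.
Local Notation T := (lebesgue_rV R N).
Implicit Types (a b x : 'rV[R]_N) (A : set 'rV[R]_N).

Lemma mx_norm_le (x : 'rV[R]_N) (r : R) : 0 <= r ->
  (`|x| <= r) = [forall i, `|x 0 i| <= r].
Proof.
move=> r0; rewrite [`|x|]mx_normrE; apply/idP/forallP => [xr i|h].
  by apply: le_trans xr; exact: (le_bigmax _ (fun ij => `|x ij.1 ij.2|) (0, i)).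
by apply: bigmax_le => // -[i j] _ /=; rewrite ord1.
Qed.

Lemma mx_norm_lt (x : 'rV[R]_N) (r : R) : 0 < r ->
  (`|x| < r) = [forall i, `|x 0 i| < r].
Proof.
move=> r0; rewrite [`|x|]mx_normrE; apply/idP/forallP => [xr i|h].
  by apply: le_lt_trans xr; exact: (le_bigmax _ (fun ij => `|x ij.1 ij.2|) (0, i)).
by apply: bigmax_lt => // -[i j] _ /=; rewrite ord1.
Qed.

Lemma coord_le_norm (x : 'rV[R]_N) i : `|x 0 i| <= `|x|.
Proof. by move: (lexx `|x|); rewrite mx_norm_le// => /forallP. Qed.

Lemma lebesgue_outer_translate_le a A :
  (lebesgue_outer [set x | A (x + a)%R] <= lebesgue_outer A)%E.
Proof.
apply: le_ereal_inf_tmp => _ [D [u [v [AD ->]]]].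
apply: ereal_inf_lbound; exists D, (fun k => u k - a), (fun k => v k - a).
split.
  move=> x /AD[k Dk /= h]; exists k => // i.
  by have := h i; rewrite !mxE lerBrDr ltrBlDr.
apply: eq_esum => k _; congr EFin; apply: eq_bigr => i _; congr Num.max.
by rewrite !mxE; lra.
Qed.

Lemma lebesgue_outer_translate a A :
  lebesgue_outer [set x | A (x + a)] = lebesgue_outer A.
Proof.
apply/eqP; rewrite eq_le lebesgue_outer_translate_le/=.
have := lebesgue_outer_translate_le (- a) [set x | A (x + a)].
by under eq_set do rewrite /= subrK.
Qed.

Lemma lebesgue_outer_box a b : (lebesgue_outer (box a b) <= (box_volume a b)%:E)%E.
Proof.
apply: ereal_inf_lbound; exists [set 0%N], (fun=> a), (fun=> b).
by split; rewrite ?bigcup_set1 ?esum_set1 // lee_fin box_volume_ge0.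
Qed.

(** The hyperplane x_i = c cuts every box of a cover into two half-open boxes whose volumes add up
    to that of the box, so a cover of X splits into covers of its two parts at no extra cost. *)
Lemma measurable_coord_le (i : 'I_N) (c : R) :
  measurable ([set x | x 0 i <= c] : set T).
Proof.
apply: le_caratheodory_measurable => X; apply: le_ereal_inf_tmp.
move=> _ [D [a [b [XD ->]]]].
(* If c lies outside the i-th interval, the ends of one piece cross or meet, and its volume is 0
   thanks to the maximum with 0 in [box_volume]. *)
pose b' k := \row_j (if j == i then Num.min (b k 0 j) c else b k 0 j).
pose a' k := \row_j (if j == i then Num.max (a k 0 j) c else a k 0 j).
have abE k : (box_volume (a k) (b k) =
    box_volume (a k) (b' k) + box_volume (a' k) (b k))%R.
  rewrite /box_volume (bigD1 i)//= [in X in _ = X + _](bigD1 i)//=.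
  rewrite [in X in _ = _ + X](bigD1 i)//= !mxE eqxx.
  rewrite [X in _ * X + _](eq_bigr (fun j => Num.max 0 (b k 0 j - a k 0 j))); last first.
    by move=> j ji; rewrite !mxE (negbTE ji).
  rewrite [X in _ + _ * X](eq_bigr (fun j => Num.max 0 (b k 0 j - a k 0 j))); last first.
    by move=> j ji; rewrite !mxE (negbTE ji).
  rewrite -mulrDl; congr *%R.
  case: (leP (a k 0 i) c) => ?; case: (leP (b k 0 i) c) => ?;
    by rewrite /Num.max; do 3?(case: ltP => ?); lra.
under eq_esum do rewrite abE EFinD.
rewrite esumD; last 2 first.
- by move=> k _; rewrite lee_fin box_volume_ge0.
- by move=> k _; rewrite lee_fin box_volume_ge0.
apply: leeD; apply: ereal_inf_lbound.
- exists D, a, b'; split=> // x [/XD[k Dk h] /= xc]; exists k => // j.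
  have /andP[h1 h2] := h j; rewrite h1/= !mxE; case: eqP => [->|//].
  by rewrite le_min xc (andP (h i)).2.
- exists D, a', b; split=> // x [/XD[k Dk h] /= xc]; exists k => // j.
  have /andP[h1 h2] := h j; rewrite h2/= !mxE andbT; case: eqP => [->|//].
  by rewrite gt_max (andP (h i)).1/= ltNge; apply/negP.
Qed.

Lemma measurable_coord (i : 'I_N) :
  measurable_fun [set: T] (fun x : T => (x : 'rV[R]_N) 0 i).
Proof.
apply: (measurability _ (RGenOInfty.measurableE R)).
move=> _ [_ [c ->] <-]; rewrite setTI.
rewrite (_ : _ @^-1` _ = ~` [set x : T | (x : 'rV[R]_N) 0 i <= c]).
  exact/measurableC/measurable_coord_le.
by apply/seteqP; split=> x /=; rewrite in_itv/= andbT ltNge => /negP.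
Qed.

Lemma measurable_box a b : measurable (box a b : set T).
Proof.
rewrite (_ : box a b = \bigcap_(i in [set: 'I_N])
    ((fun x : T => (x : 'rV[R]_N) 0 i) @^-1` `]a 0 i, b 0 i])).
  apply: fin_bigcap_measurable => // i _; rewrite -[X in measurable X]setTI.
  exact: measurable_coord.
apply/seteqP; split=> [x h i _|x h i]; first by rewrite /= in_itv/=; exact: h.
by have := h i I; rewrite /= in_itv.
Qed.

Definition grid_cell (n : nat) (k : 'rV[int]_N) : set 'rV[R]_N :=
  box (\row_i ((k 0 i)%:~R / n.+1%:R)) (\row_i ((k 0 i + 1)%:~R / n.+1%:R)).

(** An open set is the union of the cells it contains, over all mesh sizes 1/(n+1); the cells form a
    countable family. *)
Lemma measurable_open A : open A -> measurable (A : set T).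
Proof.
move=> oA.
rewrite (_ : A = \bigcup_(nk : nat * 'rV[int]_N)
    (if `[< grid_cell nk.1 nk.2 `<=` A >] then grid_cell nk.1 nk.2 else set0)).
  apply: countable_bigcupT_measurable => // -[n k] /=.
  by case: ifP => // _; exact: measurable_box.
apply/seteqP; split=> [x Ax|x [[n k] _]]; last by case: asboolP => // + /=; apply.
have /nbhs_ballP[e /= e0 eA] : nbhs x A by exact: open_nbhs_nbhs.
have [n ne] : exists n, n.+1%:R^-1 < e.
  exists (Num.truncn e^-1); rewrite -[ltRHS]invrK ltf_pV2 ?posrE ?invr_gt0//.
  exact: truncnS_gt.
(* Cells are open on the left and closed on the right, so the index of the cell of x is a ceiling
   minus 1 and not a floor. *)
pose k : 'rV[int]_N := \row_i (Num.ceil (n.+1%:R * x 0 i) - 1).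
have n0 : 0 < n.+1%:R :> R by [].
have kx i : (k 0 i)%:~R / n.+1%:R < x 0 i <= (k 0 i + 1)%:~R / n.+1%:R.
  rewrite ltr_pdivrMr// ler_pdivlMr// mxE subrK [x 0 i * _]mulrC.
  by have /andP[-> ->] := ceil_itv (n.+1%:R * x 0 i).
exists (n, k) => //=; rewrite asboolT.
  by move=> i; rewrite !mxE; have := kx i; rewrite mxE.
move=> y hy; apply: eA; rewrite -ball_normE /=.
rewrite mx_norm_lt//; apply/forallP => i; rewrite !mxE.
have := hy i; have := kx i; rewrite !mxE subrK.
set c := Num.ceil _ => /andP[h1 h2] /andP[h3 h4].
have hc : c%:~R / n.+1%:R = (c - 1)%:~R / n.+1%:R + n.+1%:R^-1 :> R.
  by rewrite intrB mulrBl mul1r subrK.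
apply: le_lt_trans ne; move: h1 h2 h3 h4; rewrite hc.
move: (_^-1) (_ * _ : R) => v u *; rewrite ler_norml; apply/andP; split; lra.
Qed.

Lemma measurable_continuous (f : 'rV[R]_N -> R) : continuous f ->
  measurable_fun [set: T] (f : T -> R).
Proof.
move=> cf; apply: (measurability _ (RGenOpens.measurableE R)).
move=> _ [_ [a [b ->]] <-]; rewrite setTI; apply: measurable_open.
by apply: open_comp => // x _; exact: cf.
Qed.

Lemma leb_bounded A : bounded_set A -> (leb (A : set T) < +oo)%E.
Proof.
move=> /ex_strict_bound_gt0[M M0 AM].
apply: (@le_lt_trans _ _ (box_volume (const_mx (- M) : 'rV[R]_N) (const_mx M))%:E); last exact: ltry.
apply: le_trans (lebesgue_outer_box _ _); apply: le_lebesgue_outer => x Ax i.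
have := AM x Ax; rewrite /= mx_norm_lt// => /forallP/(_ i).
by rewrite !mxE ltr_norml => /andP[-> /ltW].
Qed.

Lemma leb_sigma_finite : sigma_finite [set: T] (@leb R N).
Proof.
exists (fun n => box (const_mx (- n%:R)) (const_mx n%:R)).
  apply/seteqP; split=> // x _.
  have /ex_strict_bound_gt0 : bounded_set [set (x : 'rV[R]_N)].
    by exists `|x|; split; [exact: num_real|move=> M /ltW xM y ->].
  move=> [M M0 xM]; exists (Num.truncn M).+1 => // i; rewrite !mxE.
  have := xM x erefl; rewrite /= mx_norm_lt// => /forallP/(_ i).
  have Mt := truncnS_gt M.
  by rewrite ltr_norml => /andP[h1 h2]; apply/andP; split; lra.
move=> n; split; first exact: measurable_box.
by apply: le_lt_trans (lebesgue_outer_box _ _) _; exact: ltry.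
Qed.

End LebesgueBasics.

HB.instance Definition _ (R : realType) (N : nat) :=
  Measure_isSigmaFinite.Build _ _ _ (@leb R N) (@leb_sigma_finite R N).

(** * Invariance under translations *)

Section Translation.
Context {R : realType} {N : nat}.
Local Notation T := (lebesgue_rV R N).
Implicit Types (a x : 'rV[R]_N) (A : set 'rV[R]_N).

Definition translate a : T -> T := fun x => (x : 'rV[R]_N) + a.

(** As the outer measure is translation invariant, the Caratheodory condition for the preimage,
    tested on X, is the condition for A tested on X shifted by a. *)
Lemma measurable_translate a : measurable_fun [set: T] (translate a).
Proof.
move=> _ A mA; rewrite setTI.
have cA : lebesgue_outer.-caratheodory (A : set 'rV[R]_N) := mA.
suff : lebesgue_outer.-caratheodory (translate a @^-1` A : set 'rV[R]_N) by [].
have tr Y : lebesgue_outer [set x | Y (x - a)%R] = lebesgue_outer Y.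
  by rewrite lebesgue_outer_translate.
have trI Y B : [set x | (Y `&` (translate a @^-1` B)) (x - a)%R] =
    [set x | Y (x - a)%R] `&` B.
  by apply/seteqP; split=> x /=; rewrite /translate /= subrK.
move=> X; rewrite -(tr X) cA.
congr (_ + _)%E; first by rewrite -trI tr.
by rewrite -[~` A]/(~` A : set 'rV[R]_N) -trI tr.
Qed.

Lemma leb_translate a (A : set T) : leb (translate a @^-1` A) = leb A.
Proof. exact: lebesgue_outer_translate. Qed.

Local Open Scope ereal_scope.

Lemma ge0_integral_translate a (f : T -> \bar R) :
  measurable_fun [set: T] f -> (forall x, 0 <= f x) ->
  \int[leb]_x f (translate a x) = \int[leb]_x f x.
Proof.
move=> mf f0.
have := @ge0_integral_pushforward _ _ _ _ _ _ (measurable_translate a) leb setT f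
  measurableT mf (fun x _ => f0 x).
rewrite preimage_setT => <-.
apply: eq_measure_integral; first exact: measurable_translate.
by move=> mt A mA _; exact: leb_translate.
Qed.

Lemma integral_translate a (f : T -> \bar R) :
  measurable_fun [set: T] f ->
  \int[leb]_x f (translate a x) = \int[leb]_x f x.
Proof.
move=> mf; rewrite -[LHS]/(\int[leb]_x (f \o translate a) x).
rewrite [LHS]integralE [RHS]integralE funepos_comp funeneg_comp.
congr (_ - _).
- by apply: (ge0_integral_translate a (measurable_funepos mf)) => x; rewrite funepos_ge0.
- by apply: (ge0_integral_translate a (measurable_funeneg mf)) => x; rewrite funeneg_ge0.
Qed.

End Translation.

(** * Functions of bounded support *)

Section CompactlySupported.
Context {R : realType} {N : nat}.
Local Notation T := (lebesgue_rV R N).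
Implicit Types (g : 'rV[R]_N -> R).

Definition bounded_support (V : zmodType) (g : 'rV[R]_N -> V) :=
  exists M : R, forall x, M < `|x| -> g x = 0.

Lemma bounded_closed_ball (M : R) : bounded_set [set x : 'rV[R]_N | `|x| <= M].
Proof. by exists M; split; [exact: num_real|move=> y /ltW My x /= /le_trans; apply]. Qed.

Lemma compact_closed_ball (M : R) : compact [set x : 'rV[R]_N | `|x| <= M].
Proof.
apply: bounded_closed_compact; first exact: bounded_closed_ball.
apply: (@preimage_closed _ _ (fun x : 'rV[R]_N => `|x|) [set y | y <= M]).
  by move=> x _; exact: norm_continuous.
exact: closed_le.
Qed.

Lemma continuous_bounded_on_ball g (M : R) : continuous g ->
  exists2 C, 0 < C & forall x, `|x| <= M -> `|g x| <= C.
Proof.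
move=> cg.
have : compact (g @` [set x : 'rV[R]_N | `|x| <= M]).
  apply: continuous_compact; last exact: compact_closed_ball.
  by apply: continuous_subspaceT.
move=> /compact_bounded/ex_strict_bound_gt0[C C0 gC].
by exists C => // x xM; apply/ltW/gC; exists x.
Qed.

Lemma continuous_bounded g : continuous g -> bounded_support g ->
  exists2 C, 0 < C & forall x, `|g x| <= C.
Proof.
move=> cg [M gM]; have [C C0 gC] := continuous_bounded_on_ball M cg.
exists C => // x; have [/gC//|/gM->] := leP `|x| M.
by rewrite normr0 ltW.
Qed.

Lemma measurable_norm_le (M : R) : measurable ([set x : 'rV[R]_N | `|x| <= M] : set T).
Proof.
rewrite -[X in measurable X]setCK; apply/measurableC/measurable_open.
rewrite openC; apply: (@preimage_closed _ _ (fun x : 'rV[R]_N => `|x|) [set y | y <= M]).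
  by move=> x _; exact: norm_continuous.
exact: closed_le.
Qed.

Lemma bounded_support_integrable g (C M : R) : measurable_fun [set: T] (g : T -> R) ->
  (forall x, `|g x| <= C) -> (forall x, M < `|x| -> g x = 0) ->
  leb.-integrable [set: T] (EFin \o g).
Proof.
move=> mg gC gM.
pose B : set T := [set x | `|(x : 'rV[R]_N)| <= M].
have mB : measurable B by exact: measurable_norm_le.
rewrite (_ : EFin \o g = (EFin \o g) \_ B).
  apply/(integrable_mkcond _ mB)/measurable_bounded_integrable => //.
  - exact/leb_bounded/bounded_closed_ball.
  - exact: measurable_funTS.
  - exists C; split; first exact: num_real.
    by move=> y Cy x _; exact: le_trans (gC x) (ltW Cy).
apply/funext => x; rewrite patchE; case: ifPn => //.
by rewrite notin_setE/= => /negP; rewrite -ltNge => /gM->.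
Qed.

Lemma integrable_cst_ball (C M : R) : leb.-integrable [set: T]
  (EFin \o (fun x => C * \1_[set x : 'rV[R]_N | `|x| <= M] x)).
Proof.
apply: (@bounded_support_integrable _ `|C| M) => [|x|x Mx].
- by apply: measurable_funM => //; apply: measurable_indic; exact: measurable_norm_le.
- by rewrite normrM ler_piMr// indicE; case: (_ \in _); rewrite ?normr1 ?normr0.
- by rewrite indicE memNset/= ?mulr0//; apply/negP; rewrite -ltNge.
Qed.

Lemma continuous_integrable g : continuous g -> bounded_support g ->
  leb.-integrable [set: T] (EFin \o g).
Proof.
move=> cg sg; have [C _ gC] := continuous_bounded cg sg; have [M gM] := sg.
exact: bounded_support_integrable (measurable_continuous cg) gC gM.
Qed.

Lemma is_derive_line (V : normedModType R) (f : V -> R) (x v : V) (s : R) :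
  derivable f (x + s *: v) v ->
  is_derive s 1 (fun s => f (x + s *: v)) ('D_v f (x + s *: v)).
Proof.
move=> df.
have E : (fun h : R => h^-1 *: (((fun s => f (x + s *: v)) \o shift s) (h *: 1) - f (x + s *: v))) =
    (fun h => h^-1 *: ((f \o shift (x + s *: v)) (h *: v) - f (x + s *: v))).
  apply/funext => h /=; congr (_ *: (f _ - _)).
  by rewrite [h *: 1]mulr1 scalerDl addrCA.
by apply: DeriveDef; rewrite /derivable /derive E.
Qed.

Lemma partial_mean_value g (x v : 'rV[R]_N) (s : R) :
  (forall x, derivable g x v) -> 0 <= s ->
  exists t, g (x + s *: v) - g x = 'D_v g (x + t *: v) * s.
Proof.
move=> dg s0.
have d (t : R) : is_derive t 1 (fun s => g (x + s *: v)) ('D_v g (x + t *: v)).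
  exact: is_derive_line.
have [|t _] := @MVT_segment _ (fun s => g (x + s *: v)) (fun t => 'D_v g (x + t *: v)) 0 s s0 (fun t _ => d t).
  apply: derivable_within_continuous => t _; exact: ex_derive.
by rewrite scale0r addr0 subr0 => ?; exists t.
Qed.

Lemma derive_bounded_support (V : normedModType R) (g : 'rV[R]_N -> V) (M : R) v :
  (forall x, M < `|x| -> g x = 0) -> forall x, M < `|x| -> 'D_v g x = 0.
Proof.
move=> gM x Mx; rewrite /derive; apply: cvg_lim => //.
have oM : open [set y : 'rV[R]_N | M < `|y|].
  apply: (@open_comp _ _ (fun y : 'rV[R]_N => `|y|) [set z | M < z]); last exact: open_gt.
  by move=> y _; exact: norm_continuous.
apply: cvg_near_cst; near=> h; rewrite /= (gM x)// gM ?subrr ?scaler0//.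
near: h.
have : (h *: v + x) @[h --> 0^'] --> x.
  rewrite -[X in _ --> X]add0r; apply: cvgD; last exact: cvg_cst.
  rewrite -[X in _ --> X](scale0r v); apply: cvgZr_tmp.
  exact: nbhs_dnbhs.
have H : nbhs x [set y : 'rV[R]_N | M < `|y|] by exact: open_nbhs_nbhs.
by move=> /(_ _ H).
Unshelve. all: by end_near. Qed.

(* The difference quotients of g have integral 0, the measure being invariant under
   translations. *)
Lemma integral_partial_eq0 g (i : 'I_N) : continuous g -> bounded_support g ->
  (forall x, derivable g x (delta_mx 0 i)) ->
  continuous (fun x => 'D_(delta_mx 0 i) g x) ->
  (\int[leb]_(x in [set: T]) ('D_(delta_mx 0 i) g x)%:E = 0)%E.
Proof.
move=> cg [M gM] dg cdg; set v := delta_mx 0 i.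
have [C C0 gC] : exists2 C, 0 < C & forall x, `|'D_v g x| <= C.
  by apply: continuous_bounded => //; exists M; exact: derive_bounded_support.
have v1 : `|v : 'rV[R]_N| <= 1.
  rewrite mx_norm_le//; apply/forallP => j; rewrite mxE/=.
  by case: (_ == _); rewrite ?normr1 ?normr0.
pose s n : R := n.+1%:R^-1.
have s0 n : 0 < s n by rewrite invr_gt0.
have s1 n : s n <= 1 by rewrite invf_le1// ler1n.
pose f n : T -> R := fun x => (s n)^-1 * (g (translate (s n *: v) x) - g x).
have mg : measurable_fun [set: T] (g : T -> R) by exact: measurable_continuous.
have ig : leb.-integrable [set: T] (EFin \o g) by apply: continuous_integrable => //; exists M.
have mgt n : measurable_fun [set: T] (g \o translate (s n *: v)).
  exact: (measurableT_comp mg (measurable_translate _)).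
have igt n : leb.-integrable [set: T] (EFin \o (g \o translate (s n *: v))).
  have [K _ gK] := continuous_bounded cg (ex_intro _ M gM).
  apply: (@bounded_support_integrable _ K (M + 1)) => [//|x|x Mx].
    exact: gK.
  apply: gM.
  rewrite ltNge; apply/negP => h; move: Mx; apply/negP; rewrite -leNgt.
  rewrite -[x](addrK (s n *: v)) (le_trans (ler_normB _ _))// lerD//.
  by rewrite normrZ mulr_ile1// ger0_norm// ltW.
have f0 n : (\int[leb]_(x in [set: T]) (f n x)%:E = 0)%E.
  under eq_integral do rewrite EFinM EFinB.
  rewrite integralZl//; last exact: (integrableB measurableT (igt n) ig).
  rewrite (integralB measurableT (igt n) ig) (@integral_translate _ _ _ (EFin \o g)); last exact/measurable_EFinP.
  by rewrite subee ?mule0//; exact: integrable_fin_num.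
(* The step sizes s n and the norm of v are at most 1, so all difference quotients live on the ball
   of radius M + 1, where the mean value theorem bounds them by the bound C of the derivative. *)
have [|||||_ _] := @dominated_convergence _ _ _ (@leb R N) setT measurableT
    (fun n => EFin \o f n) (EFin \o (fun x => 'D_v g x))
    (EFin \o (fun x => C * \1_[set x : T | `|(x : 'rV[R]_N)| <= M + 1] x)).
- move=> n; apply/measurable_EFinP; apply: measurable_funM; first exact: measurable_cst.
  exact: (measurable_funB (mgt n) mg).
- exact/measurable_EFinP/measurable_continuous.
- apply: aeW => x _; apply/fine_cvgP; split; first exact: nearW.
  have /cvgr_dnbhsP/(_ s) := dg x.
  have h : s n @[n --> \oo] --> 0 by exact: cvg_harmonic.
  have sn0 n : s n != 0 by rewrite gt_eqF.
  move=> /(_ (conj sn0 h)); apply: cvg_trans; apply: near_eq_cvg; apply: nearW => n.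
  by rewrite /f /translate /= [(x : 'rV[R]_N) + _]addrC.
- exact: integrable_cst_ball.
- apply: aeW => x n _ /=; rewrite lee_fin indicE.
  have [xM|xM] := leP `|x : 'rV[R]_N| (M + 1).
    rewrite mem_set// mulr1 /f /translate.
    have [t ->] := partial_mean_value x dg (ltW (s0 n)).
    by rewrite mulrCA mulVf ?mulr1// gt_eqF.
  have gx : g x = 0 by apply: gM; rewrite (le_lt_trans _ xM)// lerDl.
  rewrite memNset/= ?mulr0; last by apply/negP; rewrite -ltNge.
  rewrite /f gx gM ?subrr ?mulr0 ?normr0// /translate.
  rewrite ltNge; apply/negP => h; move: xM; apply/negP; rewrite -leNgt.
  rewrite -[x](addrK (s n *: v)) (le_trans (ler_normB _ _))// lerD//.
  by rewrite normrZ mulr_ile1// ger0_norm// ltW.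
under [X in X @ _ --> _]eq_fun do rewrite f0.
by move=> h; apply/esym/(cvg_unique _ (cvg_cst _) h).
Qed.
End CompactlySupported.

(** * A smooth bump function *)

(** The identity behind the recursion of [bump_num]: d stands for 1 - x^2, y for its inverse, q for
    y^(2k), e for the exponential, p and p' for the numerator and its derivative. The second
    hypothesis relates q to r = y^(2k-1) in a form that also holds for k = 0, where the truncated
    exponent makes r = 1. *)
Lemma bump_algebra (R : realFieldType) (q r p p' y d e x K : R) :
  d * y = 1 -> 2 * K * r * y = 2 * K * q ->
  p * (q * (- (2 * x * y ^+ 2) * e) + e * (2 * K * r * (2 * x * y ^+ 2))) + q * e * p' =
  (p' * d ^+ 2 + p * x * d * (4 * K) - p * x * 2) * (q * y ^+ 2 * e).
Proof.
move=> dy qy.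
have -> : (p' * d ^+ 2 + p * x * d * (4 * K) - p * x * 2) * (q * y ^+ 2 * e) =
    (p' * (d * y) ^+ 2 + p * x * (d * y) * y * (4 * K) - p * x * y ^+ 2 * 2) * q * e.
  by lra.
rewrite dy.
have -> : (2 * K * r * (2 * x * y ^+ 2)) = (2 * K * r * y) * (2 * x * y) by lra.
rewrite qy; lra.
Qed.

Section Bump.
Context {R : realType}.
Implicit Types (x y : R) (k : nat).

Definition bump_den : {poly R} := 1 - 'X^2.

Lemma bump_denE x : bump_den.[x] = 1 - x ^+ 2.
Proof. by rewrite !hornerE. Qed.

Lemma bump_den_gt0 x : (0 < bump_den.[x]) = (`|x| < 1).
Proof. by rewrite bump_denE subr_gt0 -real_normK ?num_real// expr_lt1. Qed.

(* The k-th derivative of exp(-1/(1-x^2)) is p(x) (1-x^2)^(-2k) exp(-1/(1-x^2)), where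
   the polynomials p satisfy this recursion. *)
Fixpoint bump_num k : {poly R} :=
  if k is k'.+1 then
    (bump_num k')^`() * bump_den ^+ 2 + bump_num k' * 'X * bump_den *+ (4 * k')
    - bump_num k' * 'X *+ 2
  else 1.

Definition smooth_bump k x : R :=
  if `|x| < 1 then
    (bump_num k).[x] * (bump_den.[x]^-1 ^+ (2 * k) * expR (- bump_den.[x]^-1))
  else 0.

Lemma bump_out k x : 1 <= `|x| -> smooth_bump k x = 0.
Proof. by rewrite /smooth_bump ltNge => ->. Qed.

Lemma bump0E x : smooth_bump 0 x = if `|x| < 1 then expR (- bump_den.[x]^-1) else 0.
Proof. by rewrite /smooth_bump -[bump_num 0]/1 -polyC1 hornerC muln0 expr0 !mul1r. Qed.

Lemma bump0_ge0 x : 0 <= smooth_bump 0 x.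
Proof. by rewrite bump0E; case: ifP => // _; rewrite expR_ge0. Qed.

Lemma bump0_gt0 x : `|x| < 1 -> 0 < smooth_bump 0 x.
Proof. by move=> x1; rewrite bump0E x1 expR_gt0. Qed.

Lemma bump0_even x : smooth_bump 0 (- x) = smooth_bump 0 x.
Proof. by rewrite !bump0E normrN !bump_denE sqrrN. Qed.

(** The exponential beats the pole (1 - x^2)^(-2k); two powers of 1 - x^2 are left over, which is
    enough for a zero derivative at the points 1 and -1. *)
Lemma bump_decay k : exists2 C, 0 < C &
  forall x, `|x| < 1 -> `|smooth_bump k x| <= C * bump_den.[x] ^+ 2.
Proof.
have [C C0 numC] : exists2 C, 0 < C & forall x, `|x| < 1 -> `|(bump_num k).[x]| <= C.
  have : compact (horner (bump_num k) @` `[-1, 1]).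
    apply: continuous_compact; last exact: segment_compact.
    by apply: continuous_subspaceT; exact: continuous_horner.
  move=> /compact_bounded/ex_strict_bound_gt0[C C0 gC].
  exists C => // x; rewrite ltr_norml => /andP[? ?]; apply/ltW/gC; exists x => //.
  by rewrite /= in_itv/= !ltW.
(* The term of index n + 1 = 2k + 2 of the exponential series cancels the pole of order 2k and
   leaves the square. *)
pose n := (2 * k).+1.
exists (C * n.+1`!%:R) => [|x x1]; first by rewrite mulr_gt0// ltr0n fact_gt0.
have d0 : 0 < bump_den.[x] by rewrite bump_den_gt0.
rewrite /smooth_bump x1 normrM -mulrA ler_pM// ?numC//.
set s := bump_den.[x] in d0 *.
rewrite ger0_norm; last by rewrite mulr_ge0 ?expR_ge0// exprn_ge0// invr_ge0 ltW.
have := @expR_ge1Dxn R s^-1 n; rewrite invr_ge0 ltW// => /(_ isT) h.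
have {}h : s^-1 ^+ n.+1 / n.+1`!%:R <= expR s^-1 by apply: le_trans h; rewrite lerDr.
have e0 := expR_gt0 s^-1.
rewrite expRN ler_pdivrMr//.
have -> : s^-1 ^+ (2 * k) = s ^+ 2 * s^-1 ^+ n.+1.
  by rewrite -[n.+1]/(2 + 2 * k)%N exprD mulrA -exprMn mulfV ?expr1n ?mul1r// gt_eqF.
rewrite [_%:R * _]mulrC -[leRHS]mulrA ler_pM2l ?exprn_gt0//.
by rewrite mulrC -ler_pdivrMr// ltr0n fact_gt0.
Qed.

Lemma is_derive_bump k x : is_derive x 1 (smooth_bump k) (smooth_bump k.+1 x).
Proof.
have [x1|x1] := ltP `|x| 1.
  have d0 : bump_den.[x] != 0 by rewrite gt_eqF// bump_den_gt0.
  pose Y := fun y : R => bump_den.[y]^-1.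
  have dY : is_derive x 1 Y (2 * x * Y x ^+ 2).
    apply: (is_derive_eq (is_deriveV d0 (is_derive_poly bump_den x))).
    rewrite -exprVn /Y; move: (_^-1) => z.
    rewrite /bump_den derivB -polyC1 derivC derivXn sub0r hornerN hornerMn hornerX.
    by rewrite -[_ *: _]/(_ * _); lra.
  have dE : is_derive x 1 (fun y => expR (- Y y)) (- (2 * x * Y x ^+ 2) * expR (- Y x)).
    rewrite mulrC; apply: (@is_derive1_comp _ expR (fun y => - Y y) x).
  apply: (@near_eq_is_derive _ _ _ (fun y => (bump_num k).[y] * (Y y ^+ (2 * k) * expR (- Y y)))).
    have : open [set y : R | `|y| < 1].
      by apply: (@open_comp _ _ (fun y : R => `|y|) [set z | z < 1]); [move=> y _; exact: norm_continuous|exact: open_lt].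
    move=> o1; have := open_nbhs_nbhs (conj o1 x1); apply: filterS => y /= y1.
    by rewrite /smooth_bump y1.
  have dP := is_derive_poly (bump_num k) x.
  have dX : is_derive x 1 (fun y => Y y ^+ (2 * k))
      ((2 * k)%:R * Y x ^+ (2 * k).-1 * (2 * x * Y x ^+ 2)).
    rewrite (_ : (fun y => _) = Y ^+ (2 * k)); first exact: is_deriveX.
    by apply/funext => y; rewrite exprfctE.
  apply: (is_derive_eq (is_deriveM dP (is_deriveM dX dE))).
  rewrite /smooth_bump x1 -/(Y x).
  have dy : bump_den.[x] * Y x = 1 by rewrite mulfV.
  have qy : (2 * k)%:R * Y x ^+ (2 * k).-1 * Y x = (2 * k)%:R * Y x ^+ (2 * k).
    by rewrite -mulrA -exprSr; case: (k) => [|k']; rewrite ?muln0 ?mul0r.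
  rewrite -[((fun y => Y y ^+ (2 * k)) * _) x]/(Y x ^+ (2 * k) * expR (- Y x)).
  rewrite (_ : 2 * k.+1 = 2 * k + 2)%N; last by rewrite mulnS addnC.
  have numE : (bump_num k.+1).[x] = (bump_num k)^`().[x] * bump_den.[x] ^+ 2 +
      (bump_num k).[x] * x * bump_den.[x] * (4 * k%:R) - (bump_num k).[x] * x * 2.
    rewrite /= hornerD hornerN !hornerMn hornerD hornerMn !hornerM hornerX.
    by rewrite -[_ *+ (4 * k)]mulr_natr -[_ *+ 2]mulr_natr natrM expr2.
  rewrite numE exprD natrM; rewrite natrM in qy.
  exact: (bump_algebra (bump_num k).[x] (bump_num k)^`().[x] (expR (- Y x)) x dy qy).
(* From here on |x| >= 1 and the derivative sought is 0; what has to be excluded is a linear growth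
   at a neighbour h + x lying inside the interval. *)
have bx : smooth_bump k x = 0 by exact: bump_out.
have [C C0 decay] := bump_decay k.
suff h : h^-1 *: ((smooth_bump k \o shift x) (h *: 1) - smooth_bump k x) @[h --> 0^'] --> (0 : R).
  by apply: DeriveDef; [exact/cvgP/h|rewrite bump_out//; exact/cvg_lim].
apply/cvgr0Pnorm_le => e e0; near=> h => /=.
have h0 : h != 0 by near: h; exact: nbhs_dnbhs_neq.
rewrite bx subr0 [h *: 1]mulr1 normrM normfV ler_pdivrMl ?normr_gt0//.
have [xh|xh] := ltP `|h + x| 1; last by rewrite bump_out// normr0 mulr_ge0// ltW.
have h1 : `|h| <= 1 by near: h; apply: dnbhs0_le.
(* The 9 is the square of the 3 in the bound 1 - (h + x)^2 <= 3 |h| proved below. *)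
have he : C * 9 * `|h| <= e.
  rewrite -ler_pdivlMl ?mulr_gt0//.
  by near: h; apply: dnbhs0_le; rewrite mulr_gt0// invr_gt0 mulr_gt0.
apply: le_trans (decay _ xh) _.
have dh : bump_den.[h + x] <= 3 * `|h|.
  apply: (@le_trans _ _ (`|x| ^+ 2 - (h + x) ^+ 2)).
    by rewrite bump_denE lerB// -[leLHS](expr1n _ 2) lerXn2r ?nnegrE.
  rewrite real_normK ?num_real// subr_sqr (le_trans (ler_norm _))// normrM mulrC.
  rewrite (_ : x - (h + x) = - h); last by lra.
  rewrite normrN ler_wpM2r//.
  have : `|x + (h + x)| <= `|h + x| + (`|h + x| + `|h|).
    rewrite (le_trans (ler_normD _ _))// addrC lerD2l.
    by rewrite -{1}(addKr h x) addrC (le_trans (ler_normB _ _)).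
  by move: xh h1; lra.
have d0 : 0 < bump_den.[h + x] by rewrite bump_den_gt0.
apply: (@le_trans _ _ (C * (3 * `|h|) ^+ 2)).
  by rewrite ler_pM2l// lerXn2r// nnegrE ?mulr_ge0// ltW.
rewrite (_ : C * (3 * `|h|) ^+ 2 = (C * 9 * `|h|) * `|h|); last by lra.
by rewrite mulrC ler_wpM2l.
Unshelve. all: by end_near. Qed.

End Bump.

(** * Product kernels and convolution *)

Section BoundedMultiplier.
Context d (T : measurableType d) (R : realType) (mu : {measure set T -> \bar R}).
Implicit Types f g : T -> R.

Lemma integrable_mul_bounded f g (C : R) :
  mu.-integrable [set: T] (EFin \o f) -> measurable_fun [set: T] g ->
  (forall x, `|g x| <= C) -> mu.-integrable [set: T] (EFin \o (fun x => f x * g x)).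
Proof.
move=> intf mg gC; rewrite (_ : _ \o _ = (EFin \o f) \* (EFin \o g))%E //.
apply: integrableMl => //; exists C; split; first exact: num_real.
by move=> y Cy x _; exact: le_trans (gC x) (ltW Cy).
Qed.

Lemma Rintegral_mul_bounded f g (C : R) :
  mu.-integrable [set: T] (EFin \o f) -> measurable_fun [set: T] g ->
  (forall x, `|g x| <= C) ->
  `|\int[mu]_x (f x * g x)| <= C * \int[mu]_x `|f x|.
Proof.
move=> intf mg gC; have ifg := integrable_mul_bounded intf mg gC.
have iaf : mu.-integrable [set: T] (EFin \o (fun x => `|f x|)).
  exact: (integrable_norm intf).
apply: (le_trans (le_normr_Rintegral measurableT ifg)).
rewrite -RintegralZl//; apply: le_Rintegral => //.
- exact: (integrable_norm ifg).
- exact: (integrableZl measurableT C iaf).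
- by move=> x _; rewrite normrM mulrC ler_wpM2r.
Qed.

End BoundedMultiplier.

(** Factors are exchanged one at a time; C >= 1 lets a power of C bound every partial product. *)
Lemma ler_norm_prodB (R : realDomainType) (I : Type) (s : seq I) (a c : I -> R) (C e : R) :
  1 <= C -> (forall i, `|a i| <= C) -> (forall i, `|c i| <= C) ->
  (forall i, `|a i - c i| <= e) ->
  `|\prod_(i <- s) a i| <= C ^+ size s /\
  `|\prod_(i <- s) a i - \prod_(i <- s) c i| <= (size s)%:R * C ^+ size s * e.
Proof.
move=> C1 aC cC ace; have C0 : 0 <= C by exact: le_trans C1.
have e0 (i : I) : 0 <= e by exact: le_trans (ace i).
elim: s => [|i s [IH1 IH2]] /=; first by rewrite !big_nil normr1 subrr normr0 !mul0r.
rewrite !big_cons; split; first by rewrite normrM exprS ler_pM.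
rewrite (_ : a i * _ - _ = (a i - c i) * \prod_(j <- s) a j +
    c i * (\prod_(j <- s) a j - \prod_(j <- s) c j)); last by rewrite mulrBl mulrBr addrA subrK.
apply: le_trans (ler_normD _ _) _; rewrite !normrM.
apply: (@le_trans _ _ (e * C ^+ size s + C * ((size s)%:R * C ^+ size s * e))).
  by rewrite lerD// ler_pM.
rewrite -natr1 exprS mulrDl mulrDl mul1r [leRHS]addrC.
rewrite lerD//; last by rewrite mulrA [_ * (C * _)]mulrCA !mulrA.
by rewrite mulrC ler_wpM2r ?(e0 i)// ler_peMl// exprn_ge0.
Qed.

Lemma lipschitz_bound_continuous (R : realType) (V W : normedModType R) (f : V -> W) (C : R) :
  0 < C -> (forall x y, `|f x - f y| <= C * `|x - y|) -> continuous f.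
Proof.
move=> C0 fC x; apply/cvgrPdist_le => e e0.
near=> y; apply: le_trans (fC _ _) _; rewrite -ler_pdivlMl//.
near: y; apply: cvgr_dist_le; first exact: cvg_id.
by rewrite mulr_gt0// invr_gt0.
Unshelve. all: by end_near. Qed.

Lemma size_index_enum_ord n : size (index_enum 'I_n) = n.
Proof. by rewrite [index_enum _]unlock -enumT size_enum_ord. Qed.

Section Kernel.
Context {R : realType} {N : nat}.
Local Notation T := (lebesgue_rV R N).
Implicit Types (b : nat -> R -> R) (r : R) (al : 'I_N -> nat).

Definition bump_sequence b r :=
  [/\ 0 < r, forall k (x : R), is_derive x 1 (b k) (b k.+1 x) &
      forall k x, r <= `|x| -> b k x = 0].

(* al is a multi-index: b k stands for the k-th derivative of b 0. *)
Definition kern b al (x : 'rV[R]_N) : R := \prod_(j < N) b (al j) (x 0 j).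

Definition incr (i : 'I_N) al : 'I_N -> nat := fun j => if j == i then (al j).+1 else al j.

Context (b : nat -> R -> R) (r : R) (bb : bump_sequence b r).

Lemma bump_sequence_continuous k : continuous (b k).
Proof.
have [_ db _] := bb; move=> x; apply/differentiable_continuous/derivable1_diffP.
by have [] := db k x.
Qed.

Lemma bump_sequence_bounded k : exists2 C, 0 < C & forall x, `|b k x| <= C.
Proof.
have [r0 db sb] := bb.
have : compact (b k @` `[- r, r]).
  apply: continuous_compact; last exact: segment_compact.
  by apply: continuous_subspaceT; exact: bump_sequence_continuous.
move=> /compact_bounded/ex_strict_bound_gt0[C C0 gC].
exists C => // x; have [rx|xr] := leP r `|x|; first by rewrite sb// normr0 ltW.
by apply/ltW/gC; exists x => //; rewrite /= in_itv/= -ler_norml ltW.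
Qed.

Lemma bump_sequence_lipschitz k :
  exists2 C, 0 < C & forall x y, `|b k x - b k y| <= C * `|x - y|.
Proof.
have [_ db _] := bb; have [C C0 bC] := bump_sequence_bounded k.+1.
exists C => // x y; wlog xy : x y / y <= x.
  by move=> W; case: (leP y x) => [/W//|/ltW/W]; rewrite distrC [`|y - x|]distrC.
have [|c _ ->] := MVT_segment xy (fun z _ => db k z).
  by apply: continuous_subspaceT; exact: bump_sequence_continuous.
by rewrite normrM ler_wpM2r.
Qed.

(** The mean value theorem for y |-> b k y - y b_{k+1}(x), whose derivative is small near x because
    b_{k+1} is Lipschitz. The remainder is uniform in x, so it survives integration in
    [conv_kern_taylor]. *)
Lemma bump_sequence_taylor k : exists2 C, 0 < C &
  forall x h, `|b k (x + h) - b k x - h * b k.+1 x| <= C * h ^+ 2.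
Proof.
have [_ db _] := bb; have [C C0 bC] := bump_sequence_lipschitz k.+1.
exists C => // x h.
pose g y := b k y - y * b k.+1 x.
have dg (y : R) : is_derive y 1 g (b k.+1 y - b k.+1 x).
  have dy : is_derive y 1 (fun y => y * b k.+1 x) (b k.+1 x).
    rewrite (_ : (fun y => _) = b k.+1 x *: id); last by apply/funext => z; rewrite /= mulrC.
    by apply: is_derive_eq; rewrite -[_ *: _]/(_ * _) mulr1.
  exact: is_deriveB.
have gE : b k (x + h) - b k x - h * b k.+1 x = g (x + h) - g x by rewrite /g; lra.
have cg : continuous g.
  by move=> y; apply/differentiable_continuous/derivable1_diffP; have [] := dg y.
rewrite gE; have [h0|/ltW h0] := leP 0 h.
  have xh : x <= x + h by rewrite lerDl.
  have [|c /[!in_itv]/= /andP[c1 c2] ->] := MVT_segment xh (fun z _ => dg z).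
    exact: continuous_subspaceT.
  rewrite (_ : x + h - x = h) ?normrM ?expr2 ?mulrA; last by lra.
  rewrite [`|h|]ger0_norm// ler_wpM2r//.
  apply: le_trans (bC _ _) _; rewrite ler_wpM2l ?(ltW C0)// ger0_norm ?subr_ge0//.
  by rewrite lerBlDl.
have xh : x + h <= x by rewrite gerDl.
have [|c /[!in_itv]/= /andP[c1 c2]] := MVT_segment xh (fun z _ => dg z).
  exact: continuous_subspaceT.
rewrite (_ : x - (x + h) = - h); last by lra.
move=> gx; rewrite distrC gx.
rewrite normrM normrN -[h ^+ 2]real_normK ?num_real// expr2 mulrA ler_wpM2r//.
apply: le_trans (bC _ _) _; rewrite ler_wpM2l ?(ltW C0)//.
by rewrite ![`|_|]ler0_norm ?subr_le0//; move: c1; lra.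
Qed.

(** One constant serves all factors of the product: 1 plus the sum of the constants of the
    coordinates. *)
Lemma kern_bounds al : exists C, [/\ 1 <= C, (forall j x, `|b (al j) x| <= C),
  (forall j x y, `|b (al j) x - b (al j) y| <= C * `|x - y|) &
  (forall j x h, `|b (al j) (x + h) - b (al j) x - h * b (al j).+1 x| <= C * h ^+ 2)].
Proof.
have /choice[C1 C1P] k : exists C, 0 < C /\ forall x, `|b k x| <= C.
  by have [C ? ?] := bump_sequence_bounded k; exists C.
have /choice[C2 C2P] k : exists C, 0 < C /\ forall x y, `|b k x - b k y| <= C * `|x - y|.
  by have [C ? ?] := bump_sequence_lipschitz k; exists C.
have /choice[C3 C3P] k : exists C, 0 < C /\
    forall x h, `|b k (x + h) - b k x - h * b k.+1 x| <= C * h ^+ 2.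
  by have [C ? ?] := bump_sequence_taylor k; exists C.
pose S k := C1 k + C2 k + C3 k.
have S0 k : 0 <= S k.
  by rewrite /S !addr_ge0// ltW//; [have [] := C1P k|have [] := C2P k|have [] := C3P k].
exists (1 + \sum_(j < N) S (al j)).
have SD j : S (al j) <= 1 + \sum_(j < N) S (al j).
  rewrite (bigD1 j)//= addrCA lerDl addr_ge0// sumr_ge0//.
split; first by rewrite lerDl sumr_ge0.
- move=> j x; apply: le_trans (SD j); have [_ /(_ x) /le_trans] := C1P (al j); apply.
  by rewrite /S -addrA lerDl addr_ge0 ?ltW//; [have [] := C2P (al j)|have [] := C3P (al j)].
- move=> j x y; have [_ /(_ x y) /le_trans] := C2P (al j); apply.
  rewrite ler_wpM2r//; apply: le_trans (SD j).
  by rewrite /S addrAC lerDr addr_ge0 ?ltW//; [have [] := C1P (al j)|have [] := C3P (al j)].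
- move=> j x h; have [_ /(_ x h) /le_trans] := C3P (al j); apply.
  rewrite ler_wpM2r ?sqr_ge0//; apply: le_trans (SD j).
  by rewrite /S lerDr addr_ge0 ?ltW//; [have [] := C1P (al j)|have [] := C2P (al j)].
Qed.

Lemma kern_bounded al : exists2 C, 0 < C & forall x, `|kern b al x| <= C.
Proof.
have [C [C1 bC _ _]] := kern_bounds al; have C0 := lt_le_trans ltr01 C1.
exists (C ^+ N) => [|x]; first exact: exprn_gt0.
have [+ _] := @ler_norm_prodB _ _ (index_enum 'I_N) (fun j => b (al j) (x 0 j))
  (fun j => b (al j) (x 0 j)) C 0 C1 (fun j => bC j _) (fun j => bC j _)
  (fun j => ltac:(by rewrite subrr normr0)).
by rewrite size_index_enum_ord.
Qed.

Lemma kern_lipschitz al : exists2 C, 0 < C &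
  forall x y, `|kern b al x - kern b al y| <= C * `|x - y|.
Proof.
have [C [C1 bC lC _]] := kern_bounds al; have C0 := lt_le_trans ltr01 C1.
exists (N%:R * C ^+ N * C + 1) => [|x y].
  by rewrite ltr_pwDr// !mulr_ge0// ?exprn_ge0// ltW.
have xy j : `|b (al j) (x 0 j) - b (al j) (y 0 j)| <= C * `|x - y|.
  apply: le_trans (lC j _ _) _; rewrite ler_wpM2l ?(ltW C0)//.
  by have := coord_le_norm (x - y) j; rewrite !mxE.
have [_] := @ler_norm_prodB _ _ (index_enum 'I_N) (fun j => b (al j) (x 0 j))
  (fun j => b (al j) (y 0 j)) C (C * `|x - y|) C1 (fun j => bC j _) (fun j => bC j _) xy.
rewrite size_index_enum_ord mulrA => /le_trans; apply.
by rewrite ler_wpM2r// lerDl.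
Qed.

Lemma kern_continuous al : continuous (kern b al).
Proof.
by have [C C0 kC] := kern_lipschitz al; exact: (lipschitz_bound_continuous C0 kC).
Qed.

(** Moving along the i-th axis changes only the i-th factor; the others form a common factor bounded
    by C^N. *)
Lemma kern_taylor al i : exists2 C, 0 < C & forall x h,
  `|kern b al (x + h *: delta_mx 0 i) - kern b al x - h * kern b (incr i al) x| <= C * h ^+ 2.
Proof.
have [C [C1 bC _ tC]] := kern_bounds al; have C0 := lt_le_trans ltr01 C1.
exists (C ^+ N * C) => [|x h]; first by rewrite mulr_gt0// exprn_gt0.
rewrite /kern (bigD1 i)//= [in X in _ - X - _](bigD1 i)//= [in X in _ - _ * X](bigD1 i)//=.
set P := \prod_(j < N | j != i) b (al j) (x 0 j).
rewrite (eq_bigr (fun j => b (al j) (x 0 j))) => [|j ji]; last first.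
  by rewrite !mxE (negbTE ji) andbF mulr0 addr0.
rewrite [in X in _ - _ * X](eq_bigr (fun j => b (al j) (x 0 j))) => [|j ji]; last first.
  by rewrite /incr (negbTE ji).
rewrite -/P !mxE !eqxx/= mulr1 /incr eqxx mulrA -!mulrBl normrM mulrC -[leRHS]mulrA ler_pM//.
rewrite /P -big_filter; set s := seq.filter _ _.
have [+ _] := @ler_norm_prodB _ _ s (fun j => b (al j) (x 0 j))
  (fun j => b (al j) (x 0 j)) C 0 C1 (fun j => bC j _) (fun j => bC j _)
  (fun j => ltac:(by rewrite subrr normr0)).
move=> /le_trans; apply; apply: ler_weXn2l => //.
by rewrite /s size_filter (leq_trans (count_size _ _))// size_index_enum_ord.
Qed.

Lemma kern_out al x : r <= `|x| -> kern b al x = 0.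
Proof.
have [r0 _ sb] := bb; rewrite leNgt mx_norm_lt// negb_forall => /existsP[i].
by rewrite -leNgt => ri; rewrite /kern (bigD1 i)//= sb// mul0r.
Qed.

End Kernel.

Lemma is_derive_quadratic (R : realType) (V : normedModType R) (g : V -> R) (x v : V)
    (dg C : R) : 0 < C ->
  (forall h : R, `|g (x + h *: v) - g x - h * dg| <= C * h ^+ 2) -> is_derive x v g dg.
Proof.
move=> C0 tC.
suff h : h^-1 *: ((g \o shift x) (h *: v) - g x) @[h --> 0^'] --> dg.
  by apply: DeriveDef; [exact/cvgP/h|exact/cvg_lim].
apply/cvgrPdist_le => e e0; near=> h.
have h0 : h != 0 by near: h; exact: nbhs_dnbhs_neq.
have hC : C * `|h| <= e.
  by rewrite -ler_pdivlMl//; near: h; apply: dnbhs0_le; rewrite mulr_gt0// invr_gt0.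
rewrite /= -[_ *: _]/(_ * _) distrC [h *: _ + x]addrC.
rewrite -[X in _ - X](mulKf h0) -mulrBr normrM normfV ler_pdivrMl ?normr_gt0//.
apply: le_trans (tC _) _; rewrite -real_normK ?num_real// expr2 mulrA mulrC.
by rewrite ler_wpM2l.
Unshelve. all: by end_near. Qed.

Section Convolution.
Context {R : realType} {N : nat}.
Local Notation T := (lebesgue_rV R N).
Implicit Types (f : T -> R) (k : 'rV[R]_N -> R) (al : 'I_N -> nat).

Definition convolution f k (x : 'rV[R]_N) : R :=
  \int[leb]_(y in [set: T]) (f y * k (x - (y : 'rV[R]_N))).

Lemma measurable_reflect_translate k x : continuous k ->
  measurable_fun [set: T] (fun y : T => k (x - (y : 'rV[R]_N))).
Proof.
move=> ck; apply: (@measurable_continuous _ _ (fun y => k (x - y))) => y.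
apply: continuous_comp; last exact: ck.
by apply: (@continuousB _ _ _ (fun=> x) id); [exact: cst_continuous|by move=> z; exact: cvg_id].
Qed.

Context (b : nat -> R -> R) (r : R) (bb : bump_sequence b r).
Context (f : T -> R) (intf : leb.-integrable [set: T] (EFin \o f)).

Let L1 := \int[leb]_(y in [set: T]) `|f y|.

Let L1_ge0 : 0 <= L1. Proof. by apply: Rintegral_ge0 => x _. Qed.

Lemma integrable_conv_kern al x :
  leb.-integrable [set: T] (EFin \o (fun y : T => f y * kern b al (x - (y : 'rV[R]_N)))).
Proof.
have [C _ kC] := kern_bounded bb al.
apply: (integrable_mul_bounded intf _ (fun y => kC _)).
exact: (measurable_reflect_translate x (kern_continuous bb (al := al))).
Qed.

Lemma conv_kern_bounded al : exists2 C, 0 < C & forall x, `|convolution f (kern b al) x| <= C.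
Proof.
have [C C0 kC] := kern_bounded bb al; exists (C * L1 + 1) => [|x].
  by rewrite ltr_wpDl// mulr_ge0// ltW.
apply: (@le_trans _ _ (C * L1)); last by rewrite lerDl.
apply: (Rintegral_mul_bounded intf _ (fun y => kC _)).
exact: (measurable_reflect_translate x (kern_continuous bb (al := al))).
Qed.

Lemma conv_kern_continuous al : continuous (convolution f (kern b al)).
Proof.
have [C C0 kC] := kern_lipschitz bb al.
apply: (@lipschitz_bound_continuous _ _ _ _ (C * L1 + 1)).
  by rewrite ltr_wpDl// mulr_ge0// ltW.
move=> x y; rewrite /convolution -RintegralB//; [|exact: integrable_conv_kern..].
under eq_Rintegral do rewrite -mulrBr.
apply: (@le_trans _ _ (C * `|x - y| * L1)); last first.
  by rewrite mulrAC ler_wpM2r// lerDl.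
have mk z := measurable_reflect_translate z (kern_continuous bb (al := al)).
apply: (Rintegral_mul_bounded intf (measurable_funB (mk x) (mk y))) => z /=.
by apply: le_trans (kC _ _) _; rewrite opprB addrA subrK.
Qed.

(** Integrating the uniform Taylor remainder of the kernel against |f| differentiates under the
    integral sign with no limit theorem, f being merely integrable. *)
Lemma conv_kern_taylor al i : exists2 C, 0 < C & forall x h,
  `|convolution f (kern b al) (x + h *: delta_mx 0 i) - convolution f (kern b al) x
    - h * convolution f (kern b (incr i al)) x| <= C * h ^+ 2.
Proof.
have [C C0 kC] := kern_taylor bb al i.
exists (C * L1 + 1); first by rewrite ltr_wpDl// mulr_ge0// ltW.
move=> x h; rewrite /convolution -RintegralZl//; last exact: integrable_conv_kern.
have ih : leb.-integrable [set: T] (EFin \o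
    (fun y : T => h * (f y * kern b (incr i al) (x - (y : 'rV[R]_N))))).
  exact: (integrableZl measurableT h (integrable_conv_kern (incr i al) x)).
rewrite -RintegralB//; [|exact: integrable_conv_kern..].
rewrite -RintegralB//; last first.
  exact: (integrableB measurableT (integrable_conv_kern al _) (integrable_conv_kern al x)).
under eq_Rintegral do rewrite [h * _]mulrCA -!mulrBr.
apply: (@le_trans _ _ (C * h ^+ 2 * L1)); last first.
  by rewrite mulrAC ler_wpM2r ?sqr_ge0// lerDl.
have mk be z := measurable_reflect_translate z (kern_continuous bb (al := be)).
apply: (Rintegral_mul_bounded intf (measurable_funB (measurable_funB (mk al _) (mk al x))
  (measurable_funM (measurable_cst h) (mk (incr i al) x)))) => z /=.
have <- : x - z + h *: delta_mx 0 i = x + h *: delta_mx 0 i - z by rewrite addrAC.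
exact: kC.
Qed.

Lemma is_derive_conv_kern al i x : is_derive x (delta_mx 0 i)
  (convolution f (kern b al)) (convolution f (kern b (incr i al)) x).
Proof. by have [C C0 tC] := conv_kern_taylor al i; exact: (is_derive_quadratic C0 (tC x)). Qed.

End Convolution.

Section ConvolutionField.
Context {R : realType} {N : nat}.
Local Notation T := (lebesgue_rV R N).
Context (b : nat -> R -> R) (r : R) (bb : bump_sequence b r).
Context (f : 'I_N -> T -> R).
Hypothesis intf : forall i, leb.-integrable [set: T] (EFin \o f i).
Implicit Types (al : 'I_N -> nat).

Definition conv_field al (x : 'rV[R]_N) : 'rV[R]_N := \row_i convolution (f i) (kern b al) x.

Lemma mx_continuous (V : topologicalType) (m n : nat) (F : V -> 'M[R]_(m, n)) :
  (forall i j, continuous (fun x => F x i j)) -> continuous F.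
Proof.
move=> cF x; apply/cvgrPdist_le => e e0.
have h : \forall y \near x, forall ij : 'I_m * 'I_n,
    `|F x ij.1 ij.2 - F y ij.1 ij.2| <= e.
  apply: filter_forall => -[i j] /=.
  by have /cvgrPdist_le := cF i j x; apply.
apply: filterS h => y hy.
rewrite [leLHS]mx_normrE; apply: bigmax_le; first exact: ltW.
by move=> ij _; rewrite !mxE.
Qed.

Lemma derive_conv_field al i x :
  derivable (conv_field al) x (delta_mx 0 i) /\
  'D_(delta_mx 0 i) (conv_field al) x = conv_field (incr i al) x.
Proof.
have d j := is_derive_conv_kern bb (intf j) al i x.
have dF : derivable (conv_field al) x (delta_mx 0 i).
  apply/derivable_mxP => k j; rewrite ord1 /conv_field.
  under eq_fun do rewrite mxE; exact: ex_derive.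
split=> //; rewrite derive_mx//; apply/matrixP => k j; rewrite !mxE ord1 /conv_field.
by under eq_fun do rewrite mxE; exact: derive_val.
Qed.

(** A partial derivative of such a field is again such a field, with one index of al raised; hence
    the induction on k runs for all al at once. *)
Lemma smooth_conv_field al : smooth (conv_field al).
Proof.
have cF be : continuous (conv_field be).
  apply: mx_continuous => k j; rewrite ord1 /conv_field.
  by under eq_fun do rewrite mxE; exact: (conv_kern_continuous bb (intf j)).
move=> k; elim: k al => [|k IH] al; split=> // i; split.
  by move=> x; exact: (derive_conv_field al i x).1.
rewrite (_ : (fun x => _) = conv_field (incr i al)); first exact: IH.
by apply/funext => x; exact: (derive_conv_field al i x).2.
Qed.

Lemma divergence_conv_field al x :
  divergence (conv_field al) x = \sum_(i < N) convolution (f i) (kern b (incr i al)) x.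
Proof.
by apply: eq_bigr => i _; rewrite (derive_conv_field al i x).2 mxE.
Qed.

End ConvolutionField.

(** * Density of Lipschitz functions in L1 *)

Section AbsoluteIntegrals.
Context d (X : measurableType d) (R : realType) (mu : {measure set X -> \bar R}).
Implicit Types f g h : X -> R.

Lemma measurable_normr_EFin f : measurable_fun [set: X] f ->
  measurable_fun [set: X] (fun x => `|f x|%:E).
Proof. by move=> mf; apply/measurable_EFinP; exact: measurableT_comp. Qed.

Lemma integral_abs_triangle f g h : measurable_fun [set: X] f ->
  measurable_fun [set: X] g -> measurable_fun [set: X] h ->
  (forall x, `|f x| <= `|g x| + `|h x|) ->
  (\int[mu]_x `|f x|%:E <= \int[mu]_x `|g x|%:E + \int[mu]_x `|h x|%:E)%E.
Proof.
move=> mf mg mh fgh; have mg' := measurable_normr_EFin mg; have mh' := measurable_normr_EFin mh.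
rewrite -ge0_integralD//; apply: ge0_le_integral => //.
- exact: measurable_normr_EFin.
- exact: emeasurable_funD.
- by move=> x _; rewrite -EFinD lee_fin.
Qed.

Lemma integral_abs_scale f g (c : R) : 0 <= c -> measurable_fun [set: X] f ->
  measurable_fun [set: X] g -> (forall x, `|f x| <= c * `|g x|) ->
  (\int[mu]_x `|f x|%:E <= c%:E * \int[mu]_x `|g x|%:E)%E.
Proof.
move=> c0 mf mg fg; have mg' := measurable_normr_EFin mg.
rewrite -ge0_integralZl//; apply: ge0_le_integral => //.
- exact: measurable_normr_EFin.
- exact: measurable_funeM.
- by move=> x _; rewrite -EFinM lee_fin.
Qed.

End AbsoluteIntegrals.

Section L1Approximation.
Context {R : realType} {N : nat}.
Local Notation T := (lebesgue_rV R N).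
Implicit Types (f g h w : T -> R) (A B : set T).

Definition L1norm f : \bar R := (\int[leb]_x `|f x|%:E)%E.

Lemma L1norm_indic A : measurable A -> L1norm \1_A = leb A.
Proof.
move=> mA; transitivity (leb (A `&` setT)); last by rewrite setIT.
rewrite -integral_indic//.
by apply: eq_integral => x _; rewrite ger0_norm.
Qed.

Lemma L1norm_triangle h h1 h2 : measurable_fun [set: T] h ->
  measurable_fun [set: T] h1 -> measurable_fun [set: T] h2 ->
  (forall x, `|h x| <= `|h1 x| + `|h2 x|) ->
  (L1norm h <= L1norm h1 + L1norm h2)%E.
Proof. exact: integral_abs_triangle. Qed.

Definition lipschitz_bounded_support w :=
  bounded_support w /\ exists2 L, 0 < L &
    forall x y : 'rV[R]_N, `|w x - w y| <= L * `|x - y|.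

Lemma lipschitz_bounded_support_measurable w :
  lipschitz_bounded_support w -> measurable_fun [set: T] w.
Proof.
move=> [_ [L L0 Lw]]; apply: measurable_continuous.
exact: (lipschitz_bound_continuous L0 Lw).
Qed.

Definition L1_approximable f := measurable_fun [set: T] f /\
  forall e, 0 < e -> exists w, lipschitz_bounded_support w /\
    (L1norm (f \- w)%R <= e%:E)%E.

Lemma L1_approximable_limit f : measurable_fun [set: T] f ->
  (forall e, 0 < e -> exists g, L1_approximable g /\ (L1norm (f \- g)%R <= e%:E)%E) ->
  L1_approximable f.
Proof.
move=> mf fg; split=> // e e0; have e2 : 0 < e / 2 by rewrite divr_gt0.
have [g [[mg gw] gf]] := fg _ e2; have [w [lw we]] := gw _ e2.
have mw := lipschitz_bounded_support_measurable lw.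
exists w; split=> //; apply: (@le_trans _ _ (L1norm (f \- g)%R + L1norm (g \- w)%R)%E).
  apply: L1norm_triangle; try exact: measurable_funB.
  move=> x /=; rewrite -[X in `|X|](_ : (f x - g x) + (g x - w x) = _); last by lra.
  exact: ler_normD.
by rewrite [e in leRHS]splitr EFinD leeD.
Qed.

(** Covers sums and maxima: op 0 0 = 0 preserves bounded supports, and the Lipschitz bound on op
    preserves both Lipschitz functions and closeness in L1. *)
Lemma L1_approximable_binop (op : R -> R -> R) f g :
  op 0 0 = 0 -> (forall a b c d, `|op a b - op c d| <= `|a - c| + `|b - d|) ->
  measurable_fun [set: T] (fun x => op (f x) (g x)) ->
  L1_approximable f -> L1_approximable g -> L1_approximable (fun x => op (f x) (g x)).
Proof.
move=> op0 opL mop [mf fw] [mg gw]; split=> // e e0.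
have e2 : 0 < e / 2 by rewrite divr_gt0.
have [w [[[M wM] [L L0 wL]] we]] := fw _ e2.
have [w' [[[M' wM'] [L' L0' wL']] we']] := gw _ e2.
have lw : lipschitz_bounded_support (fun x => op (w x) (w' x)).
  split.
    exists (Num.max M M') => x; rewrite gt_max => /andP[Mx Mx'].
    by rewrite wM// wM'.
  exists (L + L') => [|x y]; first exact: addr_gt0.
  by apply: le_trans (opL _ _ _ _) _; rewrite mulrDl lerD.
exists (fun x => op (w x) (w' x)); split=> //.
have mw : measurable_fun [set: T] w.
  by apply: lipschitz_bounded_support_measurable; split; [exists M|exists L].
have mw' : measurable_fun [set: T] w'.
  by apply: lipschitz_bounded_support_measurable; split; [exists M'|exists L'].
apply: (@le_trans _ _ (L1norm (f \- w)%R + L1norm (g \- w')%R)%E).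
  apply: L1norm_triangle; [|exact: measurable_funB..|by move=> x; exact: opL].
  exact: (measurable_funB mop (lipschitz_bounded_support_measurable lw)).
by rewrite [e in leRHS]splitr EFinD leeD.
Qed.

Lemma L1_approximableD f g :
  L1_approximable f -> L1_approximable g -> L1_approximable (f \+ g).
Proof.
move=> af ag; apply: (@L1_approximable_binop +%R _ _ (addr0 _) _ _ af ag).
  move=> a b c d; rewrite (_ : a + b - (c + d) = (a - c) + (b - d)); last by lra.
  exact: ler_normD.
exact: (measurable_funD af.1 ag.1).
Qed.

Lemma L1_approximable_max f g :
  L1_approximable f -> L1_approximable g -> L1_approximable (f \max g).
Proof.
move=> af ag; apply: (@L1_approximable_binop Num.max _ _ (maxxx _) _ _ af ag).
  move=> a b c d; case: (leP a b) => ?; case: (leP c d) => ?;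
  by rewrite ler_norml; apply/andP; split;
    have := ler_norm (a - c); have := ler_norm (b - d);
    have := ler_norm (- (a - c)); have := ler_norm (- (b - d)); rewrite !normrN; lra.
exact: (measurable_maxr af.1 ag.1).
Qed.

Lemma L1_approximableZ (c : R) f : L1_approximable f -> L1_approximable (fun x => c * f x).
Proof.
move=> [mf fw]; have mcf : measurable_fun [set: T] (fun x => c * f x) by exact: measurable_funM.
split=> // e e0.
have c1 : 0 < `|c| + 1 by rewrite ltr_wpDl.
have ec : 0 < e / (`|c| + 1) by rewrite divr_gt0.
have [w [lw we]] := fw _ ec; have mw := lipschitz_bounded_support_measurable lw.
have [[M wM] [L L0 wL]] := lw.
exists (fun x => c * w x); split.
  split; first by exists M => x Mx; rewrite wM ?mulr0.
  exists ((`|c| + 1) * L) => [|x y]; first exact: mulr_gt0.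
  rewrite -mulrBr normrM -mulrA ler_pM//.
  by rewrite lerDl.
apply: (@le_trans _ _ ((`|c| + 1)%:E * L1norm (f \- w)%R)%E).
  apply: (integral_abs_scale leb (ltW c1) _ (measurable_funB mf mw)).
    exact: (measurable_funB mcf (measurable_funM (measurable_cst c) mw)).
  by move=> x; rewrite /= -mulrBr normrM ler_wpM2r// lerDl.
rewrite -lee_pdivlMl// (le_trans we)// lee_fin mulrC//.
Qed.

Lemma L1_approximable0 : L1_approximable (fun=> 0).
Proof.
split; first exact: measurable_cst.
move=> e e0; exists (fun=> 0); split.
  by split; [exists 0|exists 1 => // x y; rewrite subrr normr0 mul1r].
rewrite /L1norm; under eq_integral do rewrite /= subrr normr0.
by rewrite integral0 lee_fin ltW.
Qed.

Definition clamp (z : R) : R := Num.min 1 (Num.max 0 z).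

Lemma clamp_lipschitz z z' : `|clamp z - clamp z'| <= `|z - z'|.
Proof.
wlog zz : z z' / z' <= z.
  by move=> W; case: (leP z' z) => [/W//|/ltW/W]; rewrite distrC [`|z' - z|]distrC.
rewrite [leRHS]ger0_norm ?subr_ge0// ler_norml /clamp.
case: (leP 0 z) => ?; case: (leP 0 z') => ?; case: (leP 1 z) => ?;
  case: (leP 1 z') => ?; case: (leP (1 : R) 0) => ?; apply/andP; split; lra.
Qed.

Lemma clamp_itv z : 0 <= clamp z <= 1.
Proof. by rewrite /clamp le_min ler01/= le_max lexx/= ge_min lexx. Qed.

Lemma clamp_le0 z : z <= 0 -> clamp z = 0.
Proof. by move=> z0; rewrite /clamp (max_l z0) min_r. Qed.

Lemma clamp_ge1 z : 1 <= z -> clamp z = 1.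
Proof. by move=> z1; rewrite /clamp max_r ?(le_trans _ z1)// min_l. Qed.

(** A product of trapezoids. The ramps lie just to the right of a_j and of b_j, with width 1/(n+1),
    so that the limit is the indicator of the half-open box at every point. *)
Definition box_approx (a b : 'rV[R]_N) (n : nat) (x : 'rV[R]_N) : R :=
  \prod_(j < N) (clamp (n.+1%:R * (x 0 j - a 0 j)) * clamp (1 - n.+1%:R * (x 0 j - b 0 j))).

Lemma box_approx_factor_norm z z' : `|clamp z * clamp z'| <= 1.
Proof.
have /andP[? ?] := clamp_itv z; have /andP[? ?] := clamp_itv z'.
by rewrite normrM !ger0_norm// mulr_ile1.
Qed.

Lemma box_approx_out a b n x : `|a| + `|b| + 1 < `|x| -> box_approx a b n x = 0.
Proof.
have M0 : 0 <= `|a| + `|b| + 1 by rewrite !addr_ge0.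
rewrite ltNge mx_norm_le// negb_forall => /existsP[j]; rewrite -ltNge => xj.
rewrite /box_approx (bigD1 j)//=.
have := coord_le_norm a j; have := coord_le_norm b j.
rewrite !ler_norml => /andP[b1 b2] /andP[a1 a2].
have a0 : 0 <= `|a| by []. have b0 : 0 <= `|b| by [].
have [x0|x0] := leP 0 (x 0 j).
  rewrite ger0_norm// in xj; rewrite [clamp (1 - _)]clamp_le0 ?mulr0 ?mul0r//.
  rewrite subr_le0 -[leLHS]mul1r ler_pM// ?ler1n//; lra.
rewrite ltr0_norm// in xj; rewrite [clamp (n.+1%:R * (_ - a 0 j))]clamp_le0 ?mul0r//.
by rewrite mulr_ge0_le0//; lra.
Qed.

Lemma box_approx_lipschitz a b n : lipschitz_bounded_support (box_approx a b n).
Proof.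
split; first by exists (`|a| + `|b| + 1) => x; exact: box_approx_out.
have cl (x y c : 'rV[R]_N) (k : R) j : `|clamp (k + n.+1%:R * (x 0 j - c 0 j)) - 0| <= 1.
  by rewrite subr0; have /andP[? ?] := clamp_itv (k + n.+1%:R * (x 0 j - c 0 j)); rewrite ger0_norm.
exists (N%:R * (2 * n.+1%:R) + 1) => [|x y]; first by rewrite ltr_wpDl// mulr_ge0// mulr_ge0.
have xy j : `|clamp (n.+1%:R * (x 0 j - a 0 j)) * clamp (1 - n.+1%:R * (x 0 j - b 0 j)) -
   clamp (n.+1%:R * (y 0 j - a 0 j)) * clamp (1 - n.+1%:R * (y 0 j - b 0 j))|
   <= 2 * n.+1%:R * `|x - y|.
  set p := clamp (_ * (x 0 j - a 0 j)); set p' := clamp (_ * (y 0 j - a 0 j)).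
  set q := clamp (1 - _ * (x 0 j - b 0 j)); set q' := clamp (1 - _ * (y 0 j - b 0 j)).
  rewrite (_ : p * q - p' * q' = (p - p') * q + p' * (q - q')); last by lra.
  have xyj : `|x 0 j - y 0 j| <= `|x - y| by have := coord_le_norm (x - y) j; rewrite !mxE.
  have hp : `|p - p'| <= n.+1%:R * `|x - y|.
    apply: le_trans (clamp_lipschitz _ _) _; rewrite -mulrBr normrM ger0_norm//.
    by rewrite ler_wpM2l// opprB addrA subrK.
  have hq : `|q - q'| <= n.+1%:R * `|x - y|.
    apply: le_trans (clamp_lipschitz _ _) _; rewrite (_ : forall u v : R, 1 - u - (1 - v) = v - u); last by move=> u v; lra.
    rewrite distrC -mulrBr.
    by rewrite normrM ger0_norm// ler_wpM2l// opprB addrA subrK.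
  have [/andP[q0 q1] /andP[p0 p1]] := (clamp_itv _ : 0 <= q <= 1, clamp_itv _ : 0 <= p' <= 1).
  apply: le_trans (ler_normD _ _) _; rewrite !normrM (ger0_norm q0) (ger0_norm p0).
  have h1 : `|p - p'| * q <= n.+1%:R * `|x - y| by rewrite -[leRHS]mulr1 ler_pM.
  have h2 : p' * `|q - q'| <= n.+1%:R * `|x - y| by rewrite -[leRHS]mul1r ler_pM.
  by rewrite -mulrA mulr_natl mulr2n lerD.
have [_] := @ler_norm_prodB _ _ (index_enum 'I_N) _ _ 1 _ (lexx 1)
  (fun j => box_approx_factor_norm _ _) (fun j => box_approx_factor_norm _ _) xy.
rewrite size_index_enum_ord expr1n mulr1 => /le_trans; apply.
by rewrite [leRHS]mulrDl -!mulrA lerDl mul1r.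
Qed.

Lemma box_approx_cvg a b x :
  box_approx a b n x @[n --> \oo] --> (\1_(box a b) x : R).
Proof.
have h (j : 'I_N) : \forall n \near \oo,
    clamp (n.+1%:R * (x 0 j - a 0 j)) * clamp (1 - n.+1%:R * (x 0 j - b 0 j)) =
    (a 0 j < x 0 j <= b 0 j)%R%:R.
  have [xa|xa] := leP (x 0 j) (a 0 j).
    by apply: nearW => n; rewrite clamp_le0 ?mul0r// mulr_ge0_le0// subr_le0.
  have [xb|xb] := leP (x 0 j) (b 0 j).
    near=> n; rewrite [clamp (1 - _)]clamp_ge1 ?mulr1 ?clamp_ge1//.
      rewrite -ler_pdivrMr ?subr_gt0// mul1r; apply: (@le_trans _ _ n%:R); last by rewrite ler_nat.
    by near: n; exact: nbhs_infty_ger.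
    by rewrite lerBrDr gerDl mulr_ge0_le0// subr_le0.
  near=> n; rewrite [clamp (1 - _)]clamp_le0 ?mulr0// subr_le0.
  rewrite -ler_pdivrMr ?subr_gt0// mul1r; apply: (@le_trans _ _ n%:R); last by rewrite ler_nat.
    by near: n; exact: nbhs_infty_ger.
apply: cvg_near_cst.
have H : \forall n \near \oo, forall j : 'I_N,
    clamp (n.+1%:R * (x 0 j - a 0 j)) * clamp (1 - n.+1%:R * (x 0 j - b 0 j)) =
    (a 0 j < x 0 j <= b 0 j)%R%:R by exact: filter_forall.
apply: filterS H => n hn.
rewrite /box_approx (eq_bigr _ (fun j _ => hn j)) indicE.
have [xB|xB] := boolP (x \in box a b).
  by apply: big1 => j _; move: xB; rewrite inE => ->.
move: xB; rewrite notin_setE => /existsNP[j /negP xj].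
by rewrite (bigD1 j)//= (negbTE xj) mul0r.
Unshelve. all: by end_near. Qed.

Lemma L1_approximable_box a b : L1_approximable \1_(box a b).
Proof.
have mB := measurable_box a b.
split; first exact: measurable_indic.
move=> e e0.
have mw n := lipschitz_bounded_support_measurable (box_approx_lipschitz a b n).
have [|||||_ + _] := @dominated_convergence _ _ _ (@leb R N) setT measurableT
    (fun n => EFin \o box_approx a b n) (EFin \o \1_(box a b))
    (EFin \o (fun x => 1 * \1_[set x : 'rV[R]_N | `|x| <= `|a| + `|b| + 1] x)).
- by move=> n; exact/measurable_EFinP.
- exact/measurable_EFinP/measurable_indic.
- apply: aeW => x _; apply/fine_cvgP; split; first exact: nearW.
  exact: box_approx_cvg.
- exact: integrable_cst_ball.
- apply: aeW => x n _ /=; rewrite lee_fin mul1r indicE.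
  have [xM|xM] := leP `|x : 'rV[R]_N| (`|a| + `|b| + 1); last by rewrite box_approx_out// normr0.
  rewrite mem_set//= -[leRHS](expr1n _ (size (index_enum 'I_N))).
  by have [] := @ler_norm_prodB _ _ (index_enum 'I_N) _ _ 1 0 (lexx 1)
    (fun j => box_approx_factor_norm (n.+1%:R * (x 0 j - a 0 j)) (1 - n.+1%:R * (x 0 j - b 0 j)))
    (fun j => box_approx_factor_norm (n.+1%:R * (x 0 j - a 0 j)) (1 - n.+1%:R * (x 0 j - b 0 j)))
    (fun j => ltac:(by rewrite subrr normr0)).
move=> /fine_cvgP[fin] /cvgr0Pnorm_le/(_ _ e0) le_e.
near \oo => n; exists (box_approx a b n); split; first exact: box_approx_lipschitz.
have fin' : (\int[leb]_x `|(box_approx a b n x)%:E - (\1_(box a b) x)%:E|)%E \is a fin_num.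
  by near: n; exact: fin.
rewrite /L1norm (_ : (\int[_]_x _ = \int[leb]_x `|(box_approx a b n x)%:E - (\1_(box a b) x)%:E|)%E).
  rewrite -(fineK fin') lee_fin (le_trans (ler_norm _))//.
  by near: n; exact: le_e.
by apply: eq_integral => x _; rewrite -EFinB/= distrC.
Unshelve. all: by end_near. Qed.

(** The outer measure provides a countable union U of boxes containing A with little excess;
    finitely many of them, forming F n, nearly exhaust U, and the indicator of F n is a maximum of
    box indicators. *)
Lemma L1_approximable_indic A : measurable A -> (leb A < +oo)%E -> L1_approximable \1_A.
Proof.
move=> mA Afin; apply: L1_approximable_limit; first exact: measurable_indic.
move=> e e0; have e2 : 0 < e / 2 by rewrite divr_gt0.
have fA : leb A \is a fin_num by rewrite ge0_fin_numE.
have [_ [D [a [b [AD ->]]]] De] := lb_ereal_inf_adherent e2 fA.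
pose B k : set T := if k \in D then box (a k) (b k) else set0.
have mB k : measurable (B k) by rewrite /B; case: ifP => // _; exact: measurable_box.
pose U := \bigcup_k B k.
have mU : measurable U by exact: bigcupT_measurable.
have AU : A `<=` U.
  by move=> x /AD[k Dk xk]; exists k => //; rewrite /B mem_set.
have U_le : (leb U <= leb A + (e / 2)%:E)%E.
  apply: le_trans (ltW De); apply: le_trans (@measure_sigma_subadditive _ _ _ leb U B mB mU _) _ => //.
  rewrite nneseries_esumT// [leRHS]esum_mkcond; apply: le_esum => k _.
  rewrite /B; case: ifP => _; last by rewrite measure0.
  exact: lebesgue_outer_box.
have Ufin : (leb U < +oo)%E.
  by rewrite (le_lt_trans U_le)// lte_add_pinfty// ltry.
pose F n : set T := \bigcup_(k in `I_n) B k.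
have mF n : measurable (F n) by exact: bigcup_measurable.
have FU n : F n `<=` U by move=> x [k _ xk]; exists k.
have F_cvg : leb (F n) @[n --> \oo] --> leb U.
  have UF : U = \bigcup_n F n.
    apply/seteqP; split=> [x [k _ xk]|x [n _ /FU//]].
    by exists k.+1 => //; exists k => //=.
  rewrite UF; apply: nondecreasing_cvg_mu => //; first by rewrite -UF.
  move=> m n mn; apply/subsetPset => x [k /= km xk].
  by exists k => //=; exact: leq_trans mn.
have aF n : L1_approximable \1_(F n).
  elim: n => [|n IH].
    rewrite (_ : F 0%N = set0); last by apply/seteqP; split=> // x [].
    by rewrite indic0; exact: L1_approximable0.
  have FS : F n.+1 = F n `|` B n.
    apply/seteqP; split=> [x [k /= + xk]|x [[k /= kn xk]|xn]].
    - by rewrite ltnS leq_eqVlt => /predU1P[<-|kn]; [right|left; exists k].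
    - by exists k => //=; exact: ltnW.
    - by exists n => //=.
  rewrite FS (_ : \1_(_ `|` _) = \1_(F n) \max \1_(B n)).
    apply: L1_approximable_max => //; rewrite /B; case: ifP => _.
      exact: L1_approximable_box.
    by rewrite indic0; exact: L1_approximable0.
  apply/funext => x /=; rewrite !indicE in_setU.
  by do 2 (case: (_ \in _)); rewrite /= ?maxxx ?(max_l ler01) ?(max_r ler01).
have [n UFn] : exists n, (leb U - (e / 2)%:E < leb (F n))%E.
  apply: contrapT => /forallNP h.
  have : (limn (fun n => leb (F n)) <= leb U - (e / 2)%:E)%E.
    apply: lime_le; first by apply/cvg_ex; exists (leb U).
    by apply: nearW => n; rewrite leNgt; apply/negP.
  rewrite (cvg_lim _ F_cvg)// leNgt => /negP; apply.
  by rewrite gte_subl ?lte_fin// ge0_fin_numE.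
have fU : leb U \is a fin_num by rewrite ge0_fin_numE.
have fF : leb (F n) \is a fin_num.
  by rewrite ge0_fin_numE// (le_lt_trans _ Ufin)// le_measure ?inE.
exists (\1_(F n)); split=> //.
(* A and F n both lie in U, so they differ only on U minus F n and U minus A. *)
apply: (@le_trans _ _ (leb (U `\` F n) + leb (U `\` A))%E).
  rewrite -!L1norm_indic//; [|exact: measurableD..].
  apply: L1norm_triangle.
  - by apply: measurable_funB; exact: measurable_indic.
  - by apply: measurable_indic; exact: measurableD.
  - by apply: measurable_indic; exact: measurableD.
  move=> x /=; rewrite !indicE !in_setD.
  have [xA|xA] := boolP (x \in A); have [xF|xF] := boolP (x \in F n).
  - by rewrite subrr normr0.
  - have -> : x \in U by rewrite inE; apply: AU; exact/set_mem.
    by rewrite subr0 !normr1 lerDl.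
  - have -> : x \in U by rewrite inE; apply: (FU n); exact/set_mem.
    by rewrite sub0r normrN !normr1 lerDr.
  - by rewrite subrr normr0.
rewrite [e in leRHS]splitr EFinD; apply: leeD.
- rewrite measureD// (setIidr (FU n)).
  by rewrite leeBlDr// addeC -leeBlDr// ltW.
- rewrite measureD// (setIidr AU).
  by rewrite leeBlDr// addeC.
Qed.

Lemma L1_approximable_sum (I : Type) (s : seq I) (F : I -> T -> R) :
  (forall i, L1_approximable (F i)) -> L1_approximable (fun x => \sum_(i <- s) F i x).
Proof.
move=> aF; elim: s => [|i s IH].
  by under eq_fun do rewrite big_nil; exact: L1_approximable0.
by under eq_fun do rewrite big_cons; exact: (L1_approximableD (aF i) IH).
Qed.

Import HBSimple.

Lemma L1_approximable_sfun (g : {sfun T >-> R}) :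
  leb.-integrable [set: T] (EFin \o g) -> L1_approximable g.
Proof.
move=> /integrableP[_ gfin].
rewrite (_ : g = (fun x => \sum_(y <- finmap.enum_fset (fset_set (range g))) y * \1_(g @^-1` [set y]) x) :> (T -> R)).
  apply: L1_approximable_sum => y.
  have [->|y0] := eqVneq y 0.
    by under eq_fun do rewrite mul0r; exact: L1_approximable0.
  have my : measurable (g @^-1` [set y] : set T) by exact: measurable_funPTI.
  apply/L1_approximableZ/L1_approximable_indic => //.
  have mg : measurable_fun [set: T] g by [].
  (* Chebyshev: the indicator of the level set of y is at most |y|^-1 |g|, so this level set has
     finite measure. *)
  have y1 : (0 <= `|y|^-1) by rewrite invr_ge0.
  rewrite -L1norm_indic//; apply: le_lt_trans (integral_abs_scale leb y1 _ mg _) _.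
  - exact: measurable_indic.
  - move=> x; rewrite indicE; have [|_] := boolP (x \in _); last first.
      by rewrite normr0 mulr_ge0.
    by rewrite inE => /= ->; rewrite normr1 mulVf// normr_eq0.
  - by rewrite lte_mul_pinfty// ?lee_fin.
apply/funext => x; rewrite (fimfunE g) fsbig_finite//.
Qed.

Lemma L1_approximable_integrable f : leb.-integrable [set: T] (EFin \o f) -> L1_approximable f.
Proof.
move=> intf; have mf : measurable_fun [set: T] f.
  exact/measurable_EFinP/(measurable_int leb).
have [g [intg _ gf]] := approximation_sfun_integrable measurableT intf.
apply: L1_approximable_limit => // e e0.
move: gf => /fine_cvgP[fin] /cvgr0Pnorm_le/(_ _ e0) le_e.
near \oo => n; exists (g n); split; first exact: L1_approximable_sfun.
have fin' : (\int[leb]_x `|(EFin \o f) x - (g n x)%:E|)%E \is a fin_num.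
  by near: n; exact: fin.
rewrite /L1norm (_ : (\int[_]_x _ = \int[leb]_x `|(EFin \o f) x - (g n x)%:E|)%E).
  rewrite -(fineK fin') lee_fin (le_trans (ler_norm _))//.
  by near: n; exact: le_e.
by apply: eq_integral.
Unshelve. all: by end_near. Qed.

End L1Approximation.

(** * Mollification *)

Section Mollifier.
Context {R : realType} {N : nat}.
Local Notation T := (lebesgue_rV R N).
Implicit Types (f g h w : T -> R) (A B : set T) (e : R).

(** The k-th derivative of x |-> [smooth_bump 0] (x / e), whence the factor e^(-k). Nothing is
    normalized here: the mass is divided out in [mollify]. *)
Definition scaled_bump e (k : nat) (x : R) : R := e^-1 ^+ k * smooth_bump k (e^-1 * x).

Lemma scaled_bump_sequence e : 0 < e -> bump_sequence (scaled_bump e) e.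
Proof.
move=> e0; split=> // [k x|k x ex].
  have dl : is_derive x 1 (fun x : R => e^-1 * x) e^-1.
    rewrite (_ : (fun x : R => _) = e^-1 *: id); last by apply/funext.
    by apply: is_derive_eq; rewrite -[_ *: _]/(_ * _) mulr1.
  have db := @is_derive1_comp _ (smooth_bump k) (fun x => e^-1 * x) x _ _ (is_derive_bump k _) dl.
  rewrite (_ : scaled_bump e k = e^-1 ^+ k *: (smooth_bump k \o (fun x => e^-1 * x))); last by apply/funext.
  apply: is_derive_eq; rewrite -[_ *: _]/(_ * _) /scaled_bump exprSr.
  by rewrite -!mulrA [smooth_bump _ _ * _]mulrC.
rewrite /scaled_bump bump_out ?mulr0// normrM gtr0_norm ?invr_gt0//.
by rewrite ler_pdivlMl// mulr1.
Qed.

Definition rho e : 'rV[R]_N -> R := kern (scaled_bump e) (fun=> 0%N).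

Lemma scaled_bump0_ge0 e x : 0 <= scaled_bump e 0 x.
Proof. by rewrite /scaled_bump expr0 mul1r bump0_ge0. Qed.

Lemma rho_ge0 e x : 0 <= rho e x.
Proof. by apply: prodr_ge0 => j _; exact: scaled_bump0_ge0. Qed.

Lemma rho_gt0 e x : 0 < e -> `|x| < e -> 0 < rho e x.
Proof.
move=> e0; rewrite mx_norm_lt// => /forallP xe.
apply: prodr_gt0 => j _; rewrite /scaled_bump expr0 mul1r; apply: bump0_gt0.
by rewrite normrM gtr0_norm ?invr_gt0// ltr_pdivrMl// mulr1.
Qed.

Lemma scaled_bump0_even e x : scaled_bump e 0 (- x) = scaled_bump e 0 x.
Proof. by rewrite /scaled_bump mulrN bump0_even. Qed.

Lemma scaled_bump1_odd e x : scaled_bump e 1 (- x) = - scaled_bump e 1 x.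
Proof.
rewrite /scaled_bump mulrN -[RHS]mulrN; congr (_ * _).
rewrite /smooth_bump normrN !bump_denE sqrrN; case: ifP => _; last by rewrite oppr0.
rewrite -[RHS]mulNr; congr (_ * _).
have d1 : (1 : {poly R})^`() = 0 by rewrite -polyC1 derivC.
have numE : @bump_num R 1 = - ('X *+ 2).
  by rewrite [LHS]/= muln0 mulr0n addr0 d1 mul0r add0r mul1r.
by rewrite numE !hornerN !hornerMn !hornerX mulNrn.
Qed.

Lemma rho_even e x : rho e (- x) = rho e x.
Proof. by apply: eq_bigr => j _; rewrite mxE scaled_bump0_even. Qed.

(** This oddness is the origin of the minus sign when a differentiated kernel is moved from one
    factor of a pairing to the other. *)
Lemma kern_incr_odd e (i : 'I_N) (x : 'rV[R]_N) : kern (scaled_bump e) (incr i (fun=> 0%N)) (- x) =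
  - kern (scaled_bump e) (incr i (fun=> 0%N)) x.
Proof.
rewrite /kern (bigD1 i)//= [in RHS](bigD1 i)//= /incr eqxx mxE scaled_bump1_odd mulNr.
congr (- (_ * _)); apply: eq_bigr => j ji.
by rewrite (negbTE ji) mxE scaled_bump0_even.
Qed.

Lemma rho_continuous e : 0 < e -> continuous (rho e).
Proof. by move=> e0; exact: (kern_continuous (scaled_bump_sequence e0)). Qed.

Lemma rho_out e x : 0 < e -> e <= `|x| -> rho e x = 0.
Proof. by move=> e0; exact: (kern_out (scaled_bump_sequence e0)). Qed.

Lemma rho_integrable e : 0 < e -> leb.-integrable [set: T] (EFin \o rho e).
Proof.
move=> e0; apply: continuous_integrable; first exact: rho_continuous.
by exists e => x /ltW; exact: rho_out.
Qed.

(** Covers bound the outer measure from above only, so positivity is obtained indirectly, from the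
    existence of some set A of positive measure. *)
Lemma leb_ball_gt0 A e : (0 < leb A)%E -> 0 < e ->
  (0 < leb ([set x : 'rV[R]_N | (`|x| <= e)%R] : set T))%E.
Proof.
move=> A0 e0; rewrite lt_neqAle measure_ge0 andbT; apply/eqP => B0.
(* Countably many translates of the cube cover the space. *)
pose B : set T := [set x : 'rV[R]_N | (`|x| <= e)%R].
pose F n : set 'rV[R]_N := if unpickle n is Some k then
  [set x | B (x + \row_i (- (((k : 'rV[int]_N) 0 i)%:~R * e)))] else set0.
have F0 n : lebesgue_outer (F n) = 0%E.
  rewrite /F; case: unpickle => [k|]; last exact: lebesgue_outer0.
  by rewrite lebesgue_outer_translate; exact/esym/B0.
have : (leb A <= 0)%E.
  apply: (@le_trans _ _ (lebesgue_outer (\bigcup_n F n))).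
    apply: le_lebesgue_outer => x _.
    pose k : 'rV[int]_N := \row_i Num.floor (x 0 i / e).
    exists (pickle k) => //; rewrite /F pickleK /B /= mx_norm_le ?(ltW e0)//.
    apply/forallP => i; rewrite !mxE.
    have := floor_itv (x 0 i / e); set c := Num.floor _ => /andP[c1 c2].
    rewrite ler_pdivlMr// in c1; rewrite ltr_pdivrMr// rmorphD mulrDl mul1r in c2.
    by move: c1 c2; move: (c%:~R * e) => u c1 c2; rewrite ler_norml; apply/andP; split; lra.
  apply: le_trans (lebesgue_outer_sigma_subadditive _) _.
  by rewrite eseries0// => n _ _; exact: F0.
by rewrite leNgt A0.
Qed.

Definition mass e : R := \int[leb]_(x in [set: T]) rho e x.

Lemma EFin_mass e : 0 < e -> (mass e)%:E = (\int[leb]_(x in [set: T]) (rho e x)%:E)%E.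
Proof.
move=> e0; rewrite /mass /Rintegral fineK//.
exact: (integrable_fin_num measurableT (rho_integrable e0)).
Qed.

Lemma mass_gt0 A e : (0 < leb A)%E -> 0 < e -> 0 < mass e.
Proof.
move=> A0 e0; rewrite lt_neqAle Rintegral_ge0 ?andbT; last by move=> x _; exact: rho_ge0.
apply/eqP => m0; have mr := measurable_continuous (rho_continuous e0).
have : (\int[leb]_(x in [set: T]) `|(rho e x)%:E|)%E = 0%E.
  rewrite -[RHS]/(0%:E) m0 EFin_mass//; apply: eq_integral => x _.
  by rewrite gee0_abs// lee_fin rho_ge0.
have mE : measurable_fun [set: T] (EFin \o (rho e : T -> R)) by exact/measurable_EFinP.
move=> /(ae_eq_integral_abs leb measurableT mE)[Z [mZ Z0 ZP]].
have e2 : 0 < e / 2 by rewrite divr_gt0.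
have := leb_ball_gt0 A0 e2; rewrite ltNge => /negP; apply.
rewrite -[leRHS]Z0; apply: le_lebesgue_outer => x /= xe; apply: ZP => /= /(_ I) [].
apply/eqP; rewrite gt_eqF// rho_gt0//; apply: le_lt_trans xe _.
by rewrite ltr_pdivrMr// mulr_natr mulr2n ltrDl.
Qed.

Lemma integral_rhoBl e x : 0 < e ->
  (\int[leb]_(y in [set: T]) (rho e (x - (y : 'rV[R]_N)))%:E = (mass e)%:E)%E.
Proof.
move=> e0; rewrite (EFin_mass e0).
have mr := measurable_continuous (rho_continuous e0).
rewrite -(@integral_translate _ _ (- x) (EFin \o rho e)); last exact/measurable_EFinP.
by apply: eq_integral => y _; rewrite /= -rho_even opprB.
Qed.

Lemma integral_rhoBr e (y : 'rV[R]_N) : 0 < e ->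
  (\int[leb]_(x in [set: T]) (rho e ((x : 'rV[R]_N) - y))%:E = (mass e)%:E)%E.
Proof.
move=> e0; rewrite -(integral_rhoBl y e0).
by apply: eq_integral => x _; rewrite -rho_even opprB.
Qed.

(** The normalization is put on f, so that the results on convolutions with [kern] apply to [rho] as
    it is. *)
Definition mollify e f : 'rV[R]_N -> R := convolution (fun y => (mass e)^-1 * f y) (rho e).

Lemma measurable_rhoB e : 0 < e ->
  measurable_fun [set: T * T] (fun z => rho e ((z.1 : 'rV[R]_N) - z.2)).
Proof.
move=> e0; apply: measurable_prod => j _.
have bc : continuous (scaled_bump e 0).
  exact: (bump_sequence_continuous (scaled_bump_sequence e0)).
apply: (measurableT_comp (continuous_measurable_fun bc)).
have -> : (fun z : T * T => ((z.1 : 'rV[R]_N) - z.2) 0 j) =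
    ((fun x : T => (x : 'rV[R]_N) 0 j) \o fst) \- ((fun x : T => (x : 'rV[R]_N) 0 j) \o snd).
  by apply/funext => z; rewrite !mxE.
apply: measurable_funB; apply: (measurableT_comp (measurable_coord j)).
- exact: measurable_fst.
- exact: measurable_snd.
Qed.

Local Open Scope ereal_scope.

(** An upper bound for the L1 distance between f and its mollification. It is the integral of a
    nonnegative function of two variables, to which Tonelli's theorem and pointwise inequalities
    apply. *)
Definition mollify_error e f : \bar R :=
  \int[leb]_(x in [set: T]) \int[leb]_(y in [set: T])
    (`|f y - f x| * ((mass e)^-1 * rho e ((x : 'rV[R]_N) - y)))%:E.

End Mollifier.

(** * Convergence of mollifications in L1 *)

Section MollifierConvergence.
Context {R : realType} {N : nat}.
Local Notation T := (lebesgue_rV R N).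
Implicit Types (f g h w : T -> R) (A B : set T) (e : R).

Local Notation nrho e := (fun x : 'rV[R]_N => (@mass R N e)^-1 * rho e x).

Context (A : set T) (A0 : (0 < leb A)%E).

Let mass0 e (e0 : 0 < e) : 0 < @mass R N e := mass_gt0 A0 e0.

Lemma nrho_ge0 e x : 0 < e -> 0 <= nrho e x.
Proof. by move=> e0; rewrite mulr_ge0 ?rho_ge0// invr_ge0 ltW// mass0. Qed.

Lemma measurable_nrhoB e : 0 < e ->
  measurable_fun [set: T * T] (fun z => nrho e ((z.1 : 'rV[R]_N) - z.2)).
Proof. by move=> e0; apply: measurable_funM => //; exact: measurable_rhoB. Qed.

Lemma measurable_nrho_section e x : 0 < e ->
  measurable_fun [set: T] (fun y : T => nrho e (x - (y : 'rV[R]_N))).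
Proof.
move=> e0; apply: measurable_funM; first exact: measurable_cst.
apply: measurable_reflect_translate; exact: rho_continuous.
Qed.

Lemma integral_nrhoBl e x : 0 < e ->
  (\int[leb]_(y in [set: T]) (nrho e (x - (y : 'rV[R]_N)))%:E = 1)%E.
Proof.
move=> e0; under eq_integral do rewrite EFinM.
rewrite (@ge0_integralZl _ _ _ _ _ measurableT).
- by rewrite integral_rhoBl// -EFinM mulVf// gt_eqF// mass0.
- apply/measurable_EFinP; apply: measurable_reflect_translate; exact: rho_continuous.
- by move=> y _; rewrite lee_fin rho_ge0.
- by rewrite lee_fin invr_ge0 ltW// mass0.
Qed.

Lemma integral_nrhoBr e (y : 'rV[R]_N) : 0 < e ->
  (\int[leb]_(x in [set: T]) (nrho e ((x : 'rV[R]_N) - y))%:E = 1)%E.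
Proof.
move=> e0; rewrite -(integral_nrhoBl y e0); apply: eq_integral => x _.
by rewrite -rho_even opprB.
Qed.

Local Open Scope ereal_scope.

Lemma measurable_weighted (k : T * T -> R) e : (0 < e)%R -> measurable_fun setT k ->
  measurable_fun setT (fun z : T * T => (`|k z| * nrho e ((z.1 : 'rV[R]_N) - z.2))%:E).
Proof.
move=> e0 mk; apply/measurable_EFinP; apply: measurable_funM.
- exact: measurableT_comp.
- exact: measurable_nrhoB.
Qed.

Lemma integral_weighted1 h e : (0 < e)%R -> measurable_fun setT h ->
  \int[leb]_(x in [set: T]) \int[leb]_(y in [set: T])
    (`|h x| * nrho e ((x : 'rV[R]_N) - y))%:E = L1norm h.
Proof.
move=> e0 mh; apply: eq_integral => x _.
under eq_integral do rewrite EFinM.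
rewrite (@ge0_integralZl _ _ _ _ _ measurableT); first by rewrite integral_nrhoBl// mule1.
- exact/measurable_EFinP/measurable_nrho_section.
- by move=> y _; rewrite lee_fin nrho_ge0.
- by rewrite lee_fin.
Qed.

(** Tonelli brings the integration in x inside, where the normalized kernel has mass one. *)
Lemma integral_weighted2 h e : (0 < e)%R -> measurable_fun setT h ->
  \int[leb]_(x in [set: T]) \int[leb]_(y in [set: T])
    (`|h y| * nrho e ((x : 'rV[R]_N) - y))%:E = L1norm h.
Proof.
move=> e0 mh.
have mk : measurable_fun setT (h \o snd : T * T -> R).
  exact: (measurableT_comp mh measurable_snd).
rewrite (@fubini_tonelli _ _ _ _ _ leb leb
  (fun z : T * T => (`|h z.2| * nrho e ((z.1 : 'rV[R]_N) - z.2))%:E)); last 2 first.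
- exact: (measurable_weighted e0 mk).
- by move=> z; rewrite lee_fin mulr_ge0// nrho_ge0.
apply: eq_integral => y _; rewrite /=.
under eq_integral do rewrite EFinM.
rewrite (@ge0_integralZl _ _ _ _ _ measurableT); first by rewrite integral_nrhoBr// mule1.
- apply/measurable_EFinP; apply: measurable_funM; first exact: measurable_cst.
  apply: measurable_continuous.
  move=> x; apply: continuous_comp; last exact: rho_continuous.
  by apply: (@continuousB _ _ _ id (fun=> y)); [move=> z; exact: cvg_id|exact: cst_continuous].
- by move=> x _; rewrite lee_fin nrho_ge0.
- by rewrite lee_fin.
Qed.

(** Pointwise |f(y) - f(x)| <= |w(y) - w(x)| + |(f - w)(x)| + |(f - w)(y)|, and integrating out the
    kernel turns each of the last two terms into an L1 norm. *)
Lemma mollify_error_le f w e : (0 < e)%R -> measurable_fun setT f -> measurable_fun setT w ->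
  mollify_error e f <= mollify_error e w + (L1norm (f \- w)%R + L1norm (f \- w)%R).
Proof.
move=> e0 mf mw; have mh : measurable_fun setT (f \- w)%R by exact: measurable_funB.
rewrite -{1}(integral_weighted1 e0 mh) -(integral_weighted2 e0 mh).
pose k1 : T * T -> R := fun z => (w z.2 - w z.1)%R.
pose k2 : T * T -> R := fun z => ((f \- w) z.1)%R.
pose k3 : T * T -> R := fun z => ((f \- w) z.2)%R.
pose k0 : T * T -> R := fun z => (f z.2 - f z.1)%R.
have mk0 : measurable_fun setT k0.
  by apply: measurable_funB; [exact: (measurableT_comp mf measurable_snd)|exact: (measurableT_comp mf measurable_fst)].
have mk1 : measurable_fun setT k1.
  by apply: measurable_funB; [exact: (measurableT_comp mw measurable_snd)|exact: (measurableT_comp mw measurable_fst)].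
have mk2 : measurable_fun setT k2 by exact: (measurableT_comp mh measurable_fst).
have mk3 : measurable_fun setT k3 by exact: (measurableT_comp mh measurable_snd).
have n0 (k : T * T -> R) z : 0 <= (`|k z| * nrho e ((z.1 : 'rV[R]_N) - z.2))%:E.
  by rewrite lee_fin mulr_ge0// nrho_ge0.
pose F (k : T * T -> R) z := (`|k z| * nrho e ((z.1 : 'rV[R]_N) - z.2))%:E.
rewrite /mollify_error.
rewrite -(fubini_tonelli1 (F k0)); [|exact: measurable_weighted|exact: n0].
rewrite -(fubini_tonelli1 (F k1)); [|exact: measurable_weighted|exact: n0].
rewrite -(fubini_tonelli1 (F k2)); [|exact: measurable_weighted|exact: n0].
rewrite -(fubini_tonelli1 (F k3)); [|exact: measurable_weighted|exact: n0].
have mF k : measurable_fun setT k -> measurable_fun setT (F k) by exact: measurable_weighted.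
rewrite -(ge0_integralD _ measurableT (fun z _ => n0 k2 z) (mF _ mk2) (fun z _ => n0 k3 z) (mF _ mk3)).
rewrite -(ge0_integralD _ measurableT (fun z _ => n0 k1 z) (mF _ mk1)
  (fun z _ => adde_ge0 (n0 k2 z) (n0 k3 z)) (emeasurable_funD (mF _ mk2) (mF _ mk3))).
apply: ge0_le_integral; first exact: measurableT.
- by move=> z _; exact: n0.
- exact: mF.
- exact: (emeasurable_funD (mF _ mk1) (emeasurable_funD (mF _ mk2) (mF _ mk3))).
- move=> z _; rewrite /F -!EFinD lee_fin -!mulrDl ler_wpM2r ?nrho_ge0//.
  rewrite /k0 /k1 /k2 /k3 /=.
  rewrite (_ : f z.2 - f z.1 = (w z.2 - w z.1) + (- (f z.1 - w z.1) + (f z.2 - w z.2)))%R; last by lra.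
  by rewrite (le_trans (ler_normD _ _))// lerD2l (le_trans (ler_normD _ _))// normrN.
Qed.

(** The kernel forces |x - y| < e, so the difference is at most L e; for e <= 1 it vanishes unless
    |x| <= M + 1, which is a set of finite measure. *)
Lemma mollify_error_lipschitz w : lipschitz_bounded_support w ->
  exists2 C : R, (0 < C)%R & forall e, (0 < e <= 1)%R -> mollify_error e w <= (C * e)%:E.
Proof.
move=> lw; have mw := lipschitz_bounded_support_measurable lw.
have [[M wM] [L L0 wL]] := lw.
pose B : set T := [set x : 'rV[R]_N | (`|x| <= M + 1)%R].
have mB : measurable B by exact: measurable_norm_le.
have Bfin : leb B \is a fin_num.
  by rewrite ge0_fin_numE//; exact/leb_bounded/bounded_closed_ball.
exists (L * (fine (leb B) + 1))%R => [|e /andP[e0 e1]].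
  by rewrite mulr_gt0// ltr_wpDl// fine_ge0.
apply: (@le_trans _ _ (\int[leb]_(x in [set: T]) ((L * e)%:E * (\1_B x)%:E))).
  have mk : measurable_fun setT (fun z : T * T => w z.2 - w z.1)%R.
    by apply: measurable_funB; [exact: (measurableT_comp mw measurable_snd)|exact: (measurableT_comp mw measurable_fst)].
  apply: ge0_le_integral; first exact: measurableT.
  - by move=> x _; apply: integral_ge0 => y _; rewrite lee_fin mulr_ge0// nrho_ge0.
  - apply: (@measurable_fun_fubini_tonelli_F _ _ _ _ _ leb
      (fun z : T * T => (`|w z.2 - w z.1| * nrho e ((z.1 : 'rV[R]_N) - z.2))%:E)).
    + exact: (measurable_weighted e0 mk).
    + by move=> z; rewrite lee_fin mulr_ge0// nrho_ge0.
  - by apply: measurable_funeM; apply/measurable_EFinP; exact: measurable_indic.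
  - move=> x _; rewrite -EFinM -[leRHS]mule1 -(integral_nrhoBl x e0) -(@ge0_integralZl _ _ _ _ _ measurableT); last 3 first.
      exact/measurable_EFinP/measurable_nrho_section.
      by move=> y _; rewrite lee_fin nrho_ge0.
      by rewrite lee_fin !mulr_ge0// ltW.
    apply: ge0_le_integral; first exact: measurableT.
    + by move=> y _; rewrite lee_fin mulr_ge0// nrho_ge0.
    + apply/measurable_EFinP; apply: measurable_funM; last exact: measurable_nrho_section.
      exact: (measurableT_comp (@normr_measurable R setT) (measurable_funB mw (measurable_cst _))).
    + by apply: measurable_funeM; exact/measurable_EFinP/measurable_nrho_section.
    + move=> y _; rewrite -EFinM lee_fin.
      have [ex|xe] := leP e `|(x : 'rV[R]_N) - y|%R.
        by rewrite rho_out// !mulr0.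
      rewrite ler_wpM2r ?nrho_ge0// indicE.
      have [xB|xB] := boolP (x \in B).
        rewrite mulr1 (le_trans (wL _ _))// ler_wpM2l ?(ltW L0)//.
        by rewrite distrC ltW.
      have xM : (M + 1 < `|x : 'rV[R]_N|)%R.
        by move: xB; rewrite notin_setE /B /= => /negP; rewrite -ltNge.
      rewrite wM ?wM ?subrr ?normr0 ?mulr0//; first by apply: le_lt_trans xM; rewrite lerDl.
      have := ler_normD ((x : 'rV[R]_N) - y)%R y; rewrite subrK => xy.
      by move: xM xy xe e1; lra.
rewrite (@ge0_integralZl _ _ _ _ _ measurableT); last 3 first.
- by apply/measurable_EFinP; exact: measurable_indic.
- by move=> x _; rewrite lee_fin.
- by rewrite lee_fin mulr_ge0// ltW.
rewrite integral_indic// setIT.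
apply: (@le_trans _ _ ((L * e)%:E * (fine (leb B))%:E)); first by rewrite fineK.
rewrite -EFinM lee_fin.
by rewrite mulrAC ler_wpM2r ?(ltW e0)// ler_wpM2l ?(ltW L0)// lerDl.
Qed.

Lemma L1norm_mollify_error f e : (0 < e)%R -> leb.-integrable setT (EFin \o f) ->
  L1norm (mollify e f \- f)%R <= mollify_error e f.
Proof.
move=> e0 intf; have mf : measurable_fun [set: T] f.
  exact/measurable_EFinP/(measurable_int leb).
have bb := scaled_bump_sequence e0.
have mk : measurable_fun setT (fun z : T * T => f z.2 - f z.1)%R.
  by apply: measurable_funB; [exact: (measurableT_comp mf measurable_snd)|exact: (measurableT_comp mf measurable_fst)].
have intm : leb.-integrable setT (EFin \o (fun y => (@mass R N e)^-1 * f y)%R).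
  exact: (integrableZl measurableT (@mass R N e)^-1 intf).
have mm : measurable_fun [set: T] (mollify e f).
  apply: measurable_continuous; exact: (conv_kern_continuous bb intm).
apply: ge0_le_integral; first exact: measurableT.
- by move=> x _; rewrite lee_fin.
- exact: (measurable_normr_EFin (measurable_funB mm mf)).
- apply: (@measurable_fun_fubini_tonelli_F _ _ _ _ _ leb
      (fun z : T * T => (`|f z.2 - f z.1| * nrho e ((z.1 : 'rV[R]_N) - z.2))%:E)).
  + exact: (measurable_weighted e0 mk).
  + by move=> z; rewrite lee_fin mulr_ge0// nrho_ge0.
move=> x _.
have i1 : leb.-integrable [set: T] (EFin \o (fun y : T => (@mass R N e)^-1 * f y * rho e ((x : 'rV[R]_N) - y))%R).
  exact: (integrable_conv_kern bb intm (fun=> 0%N) x).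
have inr : leb.-integrable [set: T] (EFin \o (fun y : T => nrho e ((x : 'rV[R]_N) - y))%R).
  apply/integrableP; split; first exact/measurable_EFinP/measurable_nrho_section.
  rewrite (eq_integral (fun y : T => (nrho e ((x : 'rV[R]_N) - y))%:E)).
    by rewrite integral_nrhoBl// ltry.
  by move=> y _; rewrite /= ger0_norm// nrho_ge0.
have i2 : leb.-integrable [set: T] (EFin \o (fun y : T => f x * nrho e ((x : 'rV[R]_N) - y))%R).
  exact: (integrableZl measurableT (f x) inr).
(* The kernel has mass one, so the constant f(x) is its own average and can be put under the
   integral. *)
have fx : f x = (\int[leb]_(y in [set: T]) (f x * nrho e ((x : 'rV[R]_N) - y)))%R.
  by rewrite RintegralZl// /Rintegral integral_nrhoBl//= mulr1.
have i3 := integrableB measurableT i1 i2.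
have dE : (mollify e f x - f x = \int[leb]_(y in [set: T])
    ((@mass R N e)^-1 * f y * rho e ((x : 'rV[R]_N) - y) - f x * nrho e ((x : 'rV[R]_N) - y)))%R.
  by rewrite RintegralB// -fx.
rewrite -[((mollify e f \- f) x)%R]/(mollify e f x - f x)%R dE EFin_normr_Rintegral//.
apply: (le_trans (le_abse_integral leb measurableT (measurable_int _ i3))).
rewrite le_eqVlt; apply/orP; left; apply/eqP; apply: eq_integral => y _ /=.
congr (_%:E); rewrite -[X in _ = (_ * X)%R]ger0_norm ?nrho_ge0// -normrM; congr `|_|%R.
by rewrite mulrBl; congr (_ - _)%R; rewrite [RHS]mulrA [(f y * _)%R]mulrC.
Qed.

Lemma mollify_cvg f (d : R) : leb.-integrable setT (EFin \o f) -> (0 < d)%R ->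
  exists2 e0 : R, (0 < e0)%R & forall e, (0 < e <= e0)%R ->
    L1norm (mollify e f \- f)%R <= d%:E.
Proof.
move=> intf d0; have [mf fw] := L1_approximable_integrable intf.
(* Three errors of size d/4 occur: one for the Lipschitz function w, and twice the distance from f
   to w. *)
have d4 : (0 < d / 4)%R by rewrite divr_gt0.
have [w [lw we]] := fw _ d4; have mw := lipschitz_bounded_support_measurable lw.
have [C C0 wC] := mollify_error_lipschitz lw.
exists (Num.min 1 (d / 4 / C))%R; first by rewrite lt_min ltr01/= divr_gt0.
move=> e /andP[e0]; rewrite le_min => /andP[e1 eC].
apply: (le_trans (L1norm_mollify_error e0 intf)).
apply: (le_trans (mollify_error_le e0 mf mw)).
apply: (@le_trans _ _ ((d / 4)%:E + ((d / 4)%:E + (d / 4)%:E))).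
  apply: leeD; last exact: leeD.
  apply: (le_trans (wC e _)); first by rewrite e0.
  by rewrite lee_fin mulrC -ler_pdivlMr.
by rewrite -!EFinD lee_fin; lra.
Qed.

End MollifierConvergence.

(** * Test fields *)

Section TestFields.
Context {R : realType} {N : nat}.
Local Notation T := (lebesgue_rV R N).
Implicit Types (phi : 'rV[R]_N -> 'rV[R]_N) (Omega : set 'rV[R]_N) (f g : 'rV[R]_N -> R).

Definition C1 f := forall i : 'I_N,
  (forall x, derivable f x (delta_mx 0 i)) /\
  continuous (fun x => 'D_(delta_mx 0 i) f x).

Lemma is_derive_mulf (V : normedModType R) (f g : V -> R) x v df dg :
  is_derive x v f df -> is_derive x v g dg ->
  is_derive x v (fun x => f x * g x) (f x * dg + g x * df).
Proof. by move=> h1 h2; exact: (is_deriveM h1 h2). Qed.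

(** The product f g has bounded support, so its partial derivative has integral 0. *)
Lemma integral_by_parts f g i : continuous f -> C1 f -> continuous g -> C1 g ->
  bounded_support g ->
  \int[leb]_(x in [set: T]) (f x * 'D_(delta_mx 0 i) g x) =
  - \int[leb]_(x in [set: T]) ('D_(delta_mx 0 i) f x * g x).
Proof.
move=> cf C1f cg C1g [M gM].
have [df cdf] := C1f i; have [dg cdg] := C1g i.
have dfg x : is_derive x (delta_mx 0 i) (fun x => f x * g x)
    (f x * 'D_(delta_mx 0 i) g x + g x * 'D_(delta_mx 0 i) f x).
  by apply: is_derive_mulf; exact: derivableP.
have cM (h k : 'rV[R]_N -> R) : continuous h -> continuous k -> continuous (fun x => h x * k x).
  by move=> ch ck x; apply: continuousM; [exact: ch|exact: ck].
have := @integral_partial_eq0 _ _ (fun x => f x * g x) i (cM _ _ cf cg).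
have sfg : bounded_support (fun x => f x * g x) by exists M => x Mx; rewrite gM ?mulr0.
have DE : (fun x => 'D_(delta_mx 0 i) (fun x => f x * g x) x) =
    (fun x => f x * 'D_(delta_mx 0 i) g x + 'D_(delta_mx 0 i) f x * g x).
  by apply/funext => x; rewrite derive_val mulrC [X in _ + X]mulrC.
move=> /(_ sfg (fun x => ex_derive)).
move=> h.
have cD : continuous (fun x => 'D_(delta_mx 0 i) (fun x => f x * g x) x).
  by rewrite DE => x; apply: (continuousD (cM _ _ cf cdg x) (cM _ _ cdf cg x)).
have i1 : leb.-integrable [set: T] (EFin \o (fun x => f x * 'D_(delta_mx 0 i) g x)).
  apply: (continuous_integrable (cM _ _ cf cdg)).
  by exists M => x Mx; rewrite (derive_bounded_support _ gM)// mulr0.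
have i2 : leb.-integrable [set: T] (EFin \o (fun x => 'D_(delta_mx 0 i) f x * g x)).
  apply: (continuous_integrable (cM _ _ cdf cg)).
  by exists M => x Mx; rewrite gM// mulr0.
apply/eqP; rewrite -addr_eq0 -RintegralD//; apply/eqP.
rewrite /Rintegral; rewrite (_ : integral _ _ _ = 0%E)//.
transitivity (\int[leb]_(x in [set: T]) ('D_(delta_mx 0 i) (fun x => f x * g x) x)%:E)%E.
  by apply: eq_integral => x _; rewrite derive_val mulrC [X in _ + X]mulrC.
exact: h cD.
Qed.

Lemma smooth_continuous phi : smooth phi -> continuous phi.
Proof. by move=> /(_ 0%N) []. Qed.

Lemma smooth_coord_C1 phi j : smooth phi -> C1 (fun x => phi x 0 j).
Proof.
move=> /(_ 1%N)/= [_ h] i; have [d [cd _]] := h i.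
have dj x : derivable (fun x => phi x 0 j) x (delta_mx 0 i).
  by have /derivable_mxP := d x; apply.
split=> // x.
have -> : (fun x => 'D_(delta_mx 0 i) (fun x => phi x 0 j) x) =
    (fun x => ('D_(delta_mx 0 i) phi x) 0 j).
  by apply/funext => y; rewrite derive_mx ?mxE.
apply: (@continuous_comp _ _ _ (fun x => 'D_(delta_mx 0 i) phi x) (fun M : 'rV[R]_N => M 0 j)).
  exact: cd.
exact: coord_continuous.
Qed.

Lemma coord_continuous_comp (V : topologicalType) (F : V -> 'rV[R]_N) j :
  continuous F -> continuous (fun x => F x 0 j).
Proof.
move=> cF x; apply: (@continuous_comp _ _ _ F (fun M : 'rV[R]_N => M 0 j)); first exact: cF.
exact: coord_continuous.
Qed.

Lemma continuous_sum (V : topologicalType) (I : Type) (s : seq I) (F : I -> V -> R) :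
  (forall i, continuous (F i)) -> continuous (fun x => \sum_(i <- s) F i x).
Proof.
move=> cF; elim: s => [|i s IH].
  by under eq_fun do rewrite big_nil; exact: cst_continuous.
under eq_fun do rewrite big_cons.
by move=> x; apply: continuousD; [exact: cF|exact: IH].
Qed.

Lemma divergenceE phi x : smooth phi ->
  divergence phi x = \sum_(i < N) 'D_(delta_mx 0 i) (fun x => phi x 0 i) x.
Proof.
move=> /(_ 1%N)/= [_ h]; apply: eq_bigr => i _; have [d _] := h i.
by rewrite derive_mx// mxE.
Qed.

Lemma divergence_continuous phi : smooth phi -> continuous (divergence phi).
Proof.
move=> sphi; rewrite (_ : divergence phi =
    (fun x => \sum_(i < N) 'D_(delta_mx 0 i) (fun x => phi x 0 i) x)); last first.
  by apply/funext => x; exact: divergenceE.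
by apply: continuous_sum => i; have [] := smooth_coord_C1 i sphi i.
Qed.

Lemma test_function_out Omega phi x : test_functions Omega phi -> ~ Omega x -> phi x = 0.
Proof.
move=> [_ _ sub] Ox; apply: contra_notP Ox => /eqP px; apply: sub.
exact: subset_closure.
Qed.

Lemma divergence_out Omega phi x : test_functions Omega phi -> ~ Omega x -> divergence phi x = 0.
Proof.
move=> tphi Ox; have [sphi _ sub] := tphi.
apply: big1 => i _; rewrite (_ : 'D_(delta_mx 0 i) phi x = 0) ?mxE//.
rewrite -(@derive_cst _ _ _ (0 : 'rV[R]_N) x (delta_mx 0 i)).
apply: near_eq_derive.
have : nbhs x (~` closure [set x | phi x != 0]).
  apply: open_nbhs_nbhs; split; last by move=> /sub.
  by rewrite openC; exact: closed_closure.
apply: filterS => y cy /=; apply/eqP; apply: contra_notT cy => py.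
exact: subset_closure.
Qed.

(** The distance from the compact support to the complement of Omega is positive; compactness is
    applied to the property, for small e, that every z within e of y lies in Omega. *)
Lemma test_function_dist Omega phi : open Omega -> test_functions Omega phi ->
  exists2 e : R, 0 < e & forall x y, phi x != 0 -> `|x - y| < e -> Omega y.
Proof.
move=> oO [_ cK sub].
have /(_ R (0^'+) (fun e y => forall z, `|y - z| < e -> Omega z)) := (compact_near_coveringP _).1 cK.
case=> [x /sub Ox|e /= e0 h].
  have /nbhs_ballP[r /= r0 rO] : nbhs x Omega by exact: open_nbhs_nbhs.
  exists (ball x (r / 2), [set e | e < r / 2]).
    split; first by apply: nbhsx_ballx; rewrite divr_gt0.
    by apply: nbhs_right_lt; rewrite divr_gt0.
  move=> [y e] /= [+ er] z yz; rewrite -ball_normE /= => xy; apply: rO.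
  rewrite -ball_normE /= -[x](subrK y) -addrA (le_lt_trans (ler_normD _ _))//.
  by rewrite [r]splitr ltrD// (lt_trans yz).
have e2 : 0 < e / 2 by rewrite divr_gt0.
exists (e / 2) => // x y px xy; apply: (h (e / 2)) xy => //=.
  by rewrite sub0r normrN gtr0_norm// ltr_pdivrMr// mulr_natr mulr2n ltrDl.
exact: subset_closure.
Qed.

Lemma bounded_set_out Omega : bounded_set Omega ->
  exists M : R, forall x, M < `|x| -> ~ Omega x.
Proof.
move=> /ex_strict_bound_gt0[M M0 OM]; exists M => x Mx /OM /=.
by rewrite ltNge (ltW Mx).
Qed.

Lemma divergence_bounded Omega phi : bounded_set Omega -> test_functions Omega phi ->
  exists2 C, 0 < C & forall x, `|divergence phi x| <= C.
Proof.
move=> bO tphi; apply: continuous_bounded.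
  by apply: divergence_continuous; have [] := tphi.
have [M MO] := bounded_set_out bO.
by exists M => x /MO; exact: divergence_out.
Qed.

(** The divergence vanishes outside Omega, so pairings can be moved to the whole space, where
    convolutions and Fubini's theorem are used. *)
Lemma pairing_eq Omega phi (f g : T -> R) : measurable (Omega : set T) ->
  test_functions Omega phi -> (forall x, Omega x -> f x = g x) ->
  (\int[leb]_(x in (Omega : set T)) (f x * divergence phi x)%:E =
   \int[leb]_(x in [set: T]) (g x * divergence phi x)%:E)%E.
Proof.
move=> mO tphi fg; rewrite integral_mkcond; apply: eq_integral => x _.
rewrite patchE; case: ifPn => [|]; first by rewrite inE => /fg->.
by rewrite notin_setE => Ox; rewrite (divergence_out tphi Ox) mulr0.
Qed.

End TestFields.

(** * The Euclidean norm by duality *)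

Section EuclideanNorm.
Context {R : realType} {N : nat}.
Implicit Types p q : 'rV[R]_N.

Lemma euclidean_norm_ge0 p : 0 <= euclidean_norm p.
Proof. exact: sqrtr_ge0. Qed.

Lemma sqr_euclidean_norm p : euclidean_norm p ^+ 2 = \sum_(i < N) p 0 i ^+ 2.
Proof. by rewrite sqr_sqrtr// sumr_ge0// => i _; exact: sqr_ge0. Qed.

Lemma dot_le_euclidean_norm p q : euclidean_norm q <= 1 ->
  `|\sum_(i < N) p 0 i * q 0 i| <= euclidean_norm p.
Proof.
move=> q1; set s := euclidean_norm p.
have q2 : \sum_(i < N) q 0 i ^+ 2 <= 1.
  by rewrite -sqr_euclidean_norm expr_le1// euclidean_norm_ge0.
have [s0|s0] := eqVneq s 0.
  have p0 i : p 0 i = 0.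
    have : \sum_(i < N) p 0 i ^+ 2 = 0 by rewrite -sqr_euclidean_norm -/s s0 expr0n.
    move=> /eqP; rewrite psumr_eq0 => [/allP/(_ i)|j _]; last exact: sqr_ge0.
    by rewrite mem_index_enum/= sqrf_eq0 => /(_ isT)/eqP.
  by rewrite big1 ?normr0 ?s0// => i _; rewrite p0 mul0r.
have sgt0 : 0 < s by rewrite lt_neqAle eq_sym s0 euclidean_norm_ge0.
(* AM-GM on each coordinate: [2 s |p_i q_i| <= p_i^2 + s^2 q_i^2] *)
rewrite -(ler_pM2l (_ : 0 < 2 * s)) ?mulr_gt0//.
apply: (@le_trans _ _ (\sum_(i < N) (p 0 i ^+ 2 + s ^+ 2 * q 0 i ^+ 2))).
  apply: (@le_trans _ _ (2 * s * \sum_(i < N) `|p 0 i * q 0 i|)).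
    by rewrite ler_wpM2l ?mulr_ge0 ?(ltW sgt0)//; exact: ler_norm_sum.
  rewrite mulr_sumr ler_sum// => i _; rewrite normrM.
  have := sqr_ge0 (`|p 0 i| - s * `|q 0 i|).
  rewrite -(real_normK (num_real (p 0 i))) -(real_normK (num_real (q 0 i))).
  by move: `|p 0 i| `|q 0 i| => a b; nra.
rewrite big_split/= -mulr_sumr -sqr_euclidean_norm -/s.
have := sqr_ge0 s; move: q2; move: (\sum_(i < N) _) => t t1 s2.
have : s ^+ 2 * t <= s ^+ 2 * 1 by rewrite ler_wpM2l.
by nra.
Qed.

(** Testing with q = p gives the bound. Scalar products with a fixed q commute with integration,
    which is how the norm of a mollified field gets controlled. *)
Lemma euclidean_norm_le1 p :
  (forall q, `|\sum_(i < N) q 0 i * p 0 i| <= euclidean_norm q) -> euclidean_norm p <= 1.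
Proof.
move=> /(_ p); rewrite (eq_bigr (fun i => p 0 i ^+ 2)) => [|i _]; last by rewrite expr2.
rewrite -sqr_euclidean_norm ger0_norm ?sqr_ge0// => h.
have := euclidean_norm_ge0 p; rewrite le_eqVlt => /predU1P[<-//|p0].
by rewrite -(ler_pM2l p0) mulr1 -expr2.
Qed.

End EuclideanNorm.

(** * Total variation of compositions *)

Section RintegralSum.
Context d (T : measurableType d) (R : realType) (mu : {measure set T -> \bar R}).

Lemma EFin_Rintegral (f : T -> R) : mu.-integrable [set: T] (EFin \o f) ->
  (\int[mu]_x f x)%:E = (\int[mu]_x (f x)%:E)%E.
Proof. by move=> /(integrable_fin_num measurableT) fin; rewrite /Rintegral fineK. Qed.

Lemma integrableZlR (c : R) (f : T -> R) : mu.-integrable [set: T] (EFin \o f) ->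
  mu.-integrable [set: T] (EFin \o (fun x => c * f x)).
Proof. exact: integrableZl. Qed.

Lemma integrable_sumR (I : Type) (s : seq I) (F : I -> T -> R) :
  (forall i, mu.-integrable [set: T] (EFin \o F i)) ->
  mu.-integrable [set: T] (EFin \o (fun x => \sum_(i <- s) F i x)).
Proof.
move=> iF; rewrite (_ : _ \o _ = (fun x => \sum_(i <- s) (F i x)%:E)%E).
  by apply: integrable_sum => // i _; exact: iF.
by apply/funext => x; rewrite /= sumEFin.
Qed.

Lemma Rintegral_sum (I : Type) (s : seq I) (F : I -> T -> R) :
  (forall i, mu.-integrable [set: T] (EFin \o F i)) ->
  \int[mu]_x (\sum_(i <- s) F i x) = \sum_(i <- s) \int[mu]_x F i x.
Proof.
move=> iF; elim: s => [|i s IH].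
  by under eq_Rintegral do rewrite big_nil; rewrite big_nil /Rintegral integral0.
under eq_Rintegral do rewrite big_cons.
rewrite big_cons -IH RintegralD//; exact: integrable_sumR.
Qed.

End RintegralSum.

Section DirectionalChainRule.
Context {R : realType} {V : normedModType R}.

Lemma is_derive_of_line (g : V -> R) (x v : V) (dg : R) :
  is_derive (0 : R) 1 (fun s => g (x + s *: v)) dg -> is_derive x v g dg.
Proof.
have E : (fun h : R => h^-1 *: (((fun s => g (x + s *: v)) \o shift (0 : R)) (h *: 1) - g (x + 0 *: v))) =
    (fun h => h^-1 *: ((g \o shift x) (h *: v) - g x)).
  apply/funext => h /=; congr (_ *: (g _ - g _)).
    by rewrite [h *: 1]mulr1 addr0 addrC.
  by rewrite scale0r addr0.
by move=> [d dE]; apply: DeriveDef; [move: d|move: dE]; rewrite /derivable /derive E.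
Qed.

(** g is differentiated along v only, so the chain rule is taken from one variable by restricting to
    the line x + s v. *)
Lemma is_derive_outer_comp (eta : R -> R) (deta : R) (g : V -> R) (x v : V) (dg : R) :
  is_derive (g x) 1 eta deta -> is_derive x v g dg ->
  is_derive x v (fun y => eta (g y)) (deta * dg).
Proof.
move=> he [hd hE]; apply: is_derive_of_line.
have x0 : x + 0 *: v = x by rewrite scale0r addr0.
have hl := @is_derive_line _ _ g x v 0; rewrite x0 hE in hl.
apply: (@is_derive1_comp _ eta (fun s => g (x + s *: v))); last exact: hl.
by rewrite x0.
Qed.

End DirectionalChainRule.

(** * Moving a convolution across a pairing *)

Section Duality.
Context {R : realType} {N : nat}.
Local Notation T := (lebesgue_rV R N).
Implicit Types (f g : T -> R).
Context (b : nat -> R -> R) (r : R) (bb : bump_sequence b r).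

Lemma measurable_kernB (al : 'I_N -> nat) :
  measurable_fun [set: T * T] (fun z => kern b al ((z.1 : 'rV[R]_N) - z.2)).
Proof.
apply: measurable_prod => j _.
have bc : continuous (b (al j)) by exact: (bump_sequence_continuous bb).
apply: (measurableT_comp (continuous_measurable_fun bc)).
have -> : (fun z : T * T => ((z.1 : 'rV[R]_N) - z.2) 0 j) =
    ((fun x : T => (x : 'rV[R]_N) 0 j) \o fst) \- ((fun x : T => (x : 'rV[R]_N) 0 j) \o snd).
  by apply/funext => z; rewrite !mxE.
apply: measurable_funB; apply: (measurableT_comp (measurable_coord j)).
- exact: measurable_fst.
- exact: measurable_snd.
Qed.

Lemma convolution_swap f g (al : 'I_N -> nat) :
  leb.-integrable [set: T] (EFin \o f) -> leb.-integrable [set: T] (EFin \o g) ->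
  \int[leb]_(x in [set: T]) (f x * convolution g (kern b al) x) =
  \int[leb]_(y in [set: T]) (g y *
    \int[leb]_(x in [set: T]) (f x * kern b al ((x : 'rV[R]_N) - (y : 'rV[R]_N)))).
Proof.
move=> intf intg.
have mf : measurable_fun [set: T] f by exact/measurable_EFinP/(measurable_int leb).
have mg : measurable_fun [set: T] g by exact/measurable_EFinP/(measurable_int leb).
have [C C0 kC] := kern_bounded bb al.
pose F (z : T * T) : \bar R := (f z.1 * (g z.2 * kern b al ((z.1 : 'rV[R]_N) - z.2)))%:E.
have mF : measurable_fun [set: T * T] F.
  apply/measurable_EFinP; apply: measurable_funM; first exact: (measurableT_comp mf measurable_fst).
  by apply: measurable_funM; [exact: (measurableT_comp mg measurable_snd)|exact: measurable_kernB].
have mk1 x : measurable_fun [set: T] (fun y : T => kern b al (x - (y : 'rV[R]_N))).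
  exact: (measurable_reflect_translate x (kern_continuous bb (al := al))).
have mk2 y : measurable_fun [set: T] (fun x : T => kern b al ((x : 'rV[R]_N) - y)).
  apply: (@measurable_continuous _ _ (fun x => kern b al (x - y))) => x.
  apply: continuous_comp; last exact: (kern_continuous bb).
  by apply: (@continuousB _ _ _ id (fun=> y)); [move=> z; exact: cvg_id|exact: cst_continuous].
have i1 x := integrable_mul_bounded intg (mk1 x) (fun y => kC _).
have i2 y := integrable_mul_bounded intf (mk2 y) (fun x => kC _).
have af : (\int[leb]_(x in [set: T]) `|f x|%:E < +oo)%E by have /integrableP[] := intf.
have ag : (\int[leb]_(x in [set: T]) `|g x|%:E < +oo)%E by have /integrableP[] := intg.
have magE : measurable_fun [set: T] (fun x => `|g x|%:E).
  exact/measurable_EFinP/measurableT_comp.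
have mafE : measurable_fun [set: T] (fun x => `|f x|%:E).
  exact/measurable_EFinP/measurableT_comp.
(* The kernel is bounded by C, so |F(x, y)| <= C |f(x)| |g(y)|, whose double integral is finite. *)
have intF : (leb \x leb)%E.-integrable [set: T * T] F.
  apply/(integrable12ltyP leb leb mF).
  apply: (@le_lt_trans _ _ (\int[leb]_(x in [set: T]) (`|f x|%:E * (C%:E * \int[leb]_(y in [set: T]) `|g y|%:E)))%E).
    apply: ge0_le_integral; first exact: measurableT.
    - by move=> x _; apply: integral_ge0.
    - apply: (@measurable_fun_fubini_tonelli_F _ _ _ _ _ leb (fun z => `|F z|%E)).
        exact: measurableT_comp.
      by move=> z.
    - by apply: emeasurable_funM => //; exact: measurable_cst.
    - move=> x _; rewrite muleA -EFinM -ge0_integralZl ?lee_fin ?mulr_ge0 ?(ltW C0)//.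
      apply: ge0_le_integral; first exact: measurableT.
      + by move=> y _.
      + have mFx := measurable_funM (measurable_cst (f x)) (measurable_funM mg (mk1 x)).
        by apply: (measurableT_comp (@abse_measurable R setT)); exact/measurable_EFinP/mFx.
      + exact: measurable_funeM.
      + move=> y _; rewrite /F /= -!EFinM lee_fin !normrM.
        by rewrite -mulrA ler_wpM2l// mulrC ler_wpM2r.
  rewrite ge0_integralZr//; last first.
    by rewrite mule_ge0 ?lee_fin ?(ltW C0)//; exact: integral_ge0.
  rewrite lte_mul_pinfty ?integral_ge0//.
    by rewrite ge0_fin_numE ?integral_ge0.
  by rewrite lte_mul_pinfty// ?lee_fin ?(ltW C0).
have FE := @Fubini _ _ _ _ _ (@leb R N) (@leb R N) F intF.
apply: (congr1 fine).
transitivity (\int[leb]_(x in [set: T]) \int[leb]_(y in [set: T]) F (x, y))%E.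
  apply: eq_integral => x _; rewrite /convolution -(RintegralZl _ measurableT (i1 x)).
  exact: (EFin_Rintegral (integrableZlR (f x) (i1 x))).
rewrite FE; apply: eq_integral => y _.
rewrite -(RintegralZl _ measurableT (i2 y)).
rewrite (EFin_Rintegral (integrableZlR (g y) (i2 y))).
by apply: eq_integral => x _; rewrite /F mulrCA.
Qed.

End Duality.

(** * Pairings of several compositions against one total variation *)

Section Superadditivity.
Context {R : realType} {N : nat}.
Local Notation T := (lebesgue_rV R N).
Context (Omega : set 'rV[R]_N) (oO : open Omega) (bO : bounded_set Omega).
Context (Opos : (0 < leb (Omega : set T))%E).
Implicit Types (f g : T -> R) (e : R).

Let mO : measurable (Omega : set T). Proof. exact: measurable_open. Qed.

Local Notation K e i := (kern (scaled_bump e) (incr i (fun=> 0%N))).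

(** Exchanging the roles of f and g reflects the kernel, and its first derivatives are odd. *)
Lemma convolution_dual e i f g : 0 < e ->
  leb.-integrable [set: T] (EFin \o f) -> leb.-integrable [set: T] (EFin \o g) ->
  \int[leb]_(x in [set: T]) (f x * convolution g (K e i) x) =
  - \int[leb]_(y in [set: T]) (g y * convolution f (K e i) y).
Proof.
move=> e0 intf intg; have bb := scaled_bump_sequence e0.
rewrite (convolution_swap bb)//.
have E y : \int[leb]_(x in [set: T]) (f x * K e i ((x : 'rV[R]_N) - y)) =
    - convolution f (K e i) y.
  rewrite -mulN1r /convolution -RintegralZl; [|exact: measurableT|].
    by apply: eq_Rintegral => x _; rewrite mulN1r -mulrN -kern_incr_odd opprB.
  exact: integrable_conv_kern bb _ _ _ _.
transitivity (\int[leb]_(y in [set: T]) (-1 * (g y * convolution f (K e i) y))).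
  by apply: eq_Rintegral => y _; rewrite E mulrN mulN1r.
rewrite RintegralZl; [by rewrite mulN1r|exact: measurableT|].
have [C _ cC] := conv_kern_bounded bb intf (incr i (fun=> 0%N)).
apply: (integrable_mul_bounded intg _ cC).
by apply: measurable_continuous; apply: (conv_kern_continuous bb intf).
Qed.

Lemma convolutionZ e i f (c : R) x : 0 < e -> leb.-integrable [set: T] (EFin \o f) ->
  convolution (fun y => c * f y) (K e i) x = c * convolution f (K e i) x.
Proof.
move=> e0 intf; have bb := scaled_bump_sequence e0.
rewrite /convolution -RintegralZl; [|exact: measurableT|].
  by apply: eq_Rintegral => y _; rewrite mulrA.
exact: (integrable_conv_kern bb intf).
Qed.

Context (I : finType) (eta deta : I -> R -> R).
Hypothesis eta_deriv : forall k (s : R), is_derive s 1 (eta k) (deta k s).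
Hypothesis deta_cont : forall k, continuous (deta k).
Hypothesis deta_le1 : forall s, \sum_(k : I) `|deta k s| <= 1.

Lemma eta_continuous k : continuous (eta k).
Proof.
move=> s; apply/differentiable_continuous/derivable1_diffP.
by have [] := eta_deriv k s.
Qed.

Lemma deta_norm_le1 k s : `|deta k s| <= 1.
Proof.
apply: le_trans (deta_le1 s); rewrite (bigD1 k)//= lerDl sumr_ge0//.
Qed.

Lemma eta_lipschitz k s t : `|eta k s - eta k t| <= `|s - t|.
Proof.
wlog st : s t / t <= s.
  by move=> W; case: (leP t s) => [/W//|/ltW/W]; rewrite distrC [`|t - s|]distrC.
have [|c _ ->] := MVT_segment st (fun z _ => eta_deriv k z).
  by apply: continuous_subspaceT; exact: eta_continuous.
by rewrite normrM ler_piMl// deta_norm_le1.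
Qed.

Context (phi : I -> 'rV[R]_N -> 'rV[R]_N).
Hypothesis phi_test : forall k, test_functions Omega (phi k).
Hypothesis phi_le1 : forall k x, euclidean_norm (phi k x) <= 1.

Definition glued_field (v : 'rV[R]_N -> R) (i : 'I_N) (x : 'rV[R]_N) : R :=
  \sum_(k : I) deta k (v x) * phi k x 0 i.

Lemma glued_field_continuous v i : continuous v -> continuous (glued_field v i).
Proof.
move=> cv; apply: continuous_sum => k x.
apply: (@continuousM _ _ (fun x => deta k (v x)) (fun x => phi k x 0 i)).
  by apply: continuous_comp; [exact: cv|exact: deta_cont].
by apply: coord_continuous_comp; apply: smooth_continuous; have [] := phi_test k.
Qed.

Lemma glued_field_out v i x : (forall k, phi k x = 0) -> glued_field v i x = 0.
Proof. by move=> h; apply: big1 => k _; rewrite h mxE mulr0. Qed.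

Lemma glued_field_bounded_support v i : bounded_support (glued_field v i).
Proof.
have [M MO] := bounded_set_out bO.
exists M => x /MO Ox; apply: glued_field_out => k.
exact: (test_function_out (phi_test k)).
Qed.

(** By Cauchy-Schwarz each phi k contributes at most the norm of p, and the weights |deta k (v x)|
    have sum at most 1: the glued field takes values in the unit ball. *)
Lemma glued_field_dot v (p : 'rV[R]_N) x :
  `|\sum_(i < N) p 0 i * glued_field v i x| <= euclidean_norm p.
Proof.
rewrite (_ : \sum_(i < N) _ = \sum_(k : I) deta k (v x) * \sum_(i < N) p 0 i * phi k x 0 i).
  apply: le_trans (ler_norm_sum _ _ _) _.
  apply: (@le_trans _ _ (\sum_(k : I) `|deta k (v x)| * euclidean_norm p)).
    by apply: ler_sum => k _; rewrite normrM ler_wpM2l// dot_le_euclidean_norm.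
  by rewrite -mulr_suml ler_piMl// euclidean_norm_ge0.
under [RHS]eq_bigr do rewrite mulr_sumr.
rewrite exchange_big/=; apply: eq_bigr => i _; rewrite mulr_sumr.
by apply: eq_bigr => k _; rewrite mulrCA.
Qed.

Lemma glued_field_integrable v i : continuous v ->
  leb.-integrable [set: T] (EFin \o glued_field v i).
Proof.
move=> cv; apply: continuous_integrable; first exact: glued_field_continuous.
exact: glued_field_bounded_support.
Qed.

Definition mollified_field e v : 'rV[R]_N -> 'rV[R]_N :=
  conv_field (scaled_bump e) (fun i y => (@mass R N e)^-1 * glued_field v i y) (fun=> 0%N).

Let mass0 e (e0 : 0 < e) : 0 < @mass R N e := mass_gt0 Opos e0.

Section FixedScale.
Context (e : R) (e0 : 0 < e) (v : 'rV[R]_N -> R) (cv : continuous v).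

Let bb := scaled_bump_sequence e0.

Let intz i : leb.-integrable [set: T]
  (EFin \o (fun y : T => (@mass R N e)^-1 * glued_field v i y)).
Proof. by apply: integrableZlR; exact: glued_field_integrable. Qed.

(** The mollified field averages the glued field against a probability density, so its scalar
    product with q stays below the norm of q. *)
Lemma mollified_field_norm x : euclidean_norm (mollified_field e v x) <= 1.
Proof.
apply: euclidean_norm_le1 => q.
have E : \sum_(i < N) q 0 i * mollified_field e v x 0 i =
    \int[leb]_(y in [set: T]) ((\sum_(i < N) q 0 i * glued_field v i y) *
      ((@mass R N e)^-1 * rho e (x - (y : 'rV[R]_N)))).
  under eq_bigr do rewrite mxE -(RintegralZl _ measurableT (integrable_conv_kern bb (intz _) _ x)).
  rewrite -Rintegral_sum.
    apply: eq_Rintegral => y _; rewrite mulr_suml; apply: eq_bigr => i _.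
    by rewrite -!mulrA; congr (_ * _); rewrite mulrCA.
  move=> i; apply: integrableZlR.
  exact: (integrable_conv_kern bb (intz i) (fun=> 0%N) x).
have n0 y : 0 <= (@mass R N e)^-1 * rho e (x - y).
  by rewrite mulr_ge0 ?rho_ge0// invr_ge0 ltW// mass0.
have inr : leb.-integrable [set: T]
    (EFin \o (fun y : T => (@mass R N e)^-1 * rho e (x - (y : 'rV[R]_N)))).
  apply/integrableP; split.
    exact/measurable_EFinP/(measurable_nrho_section _ e0).
  rewrite (eq_integral (fun y : T => ((@mass R N e)^-1 * rho e (x - (y : 'rV[R]_N)))%:E)).
    by rewrite (integral_nrhoBl Opos x e0) ltry.
  by move=> y _; rewrite /= ger0_norm.
have n1 : \int[leb]_(y in [set: T]) `|(@mass R N e)^-1 * rho e (x - (y : 'rV[R]_N))| = 1.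
  under eq_Rintegral do rewrite ger0_norm//.
  by apply/EFin_inj; rewrite (EFin_Rintegral inr) (integral_nrhoBl Opos x e0).
rewrite E; under eq_Rintegral do rewrite mulrC.
rewrite -[leRHS]mulr1 -n1.
apply: (Rintegral_mul_bounded inr) => [|y]; last exact: glued_field_dot.
apply: measurable_continuous; apply: continuous_sum => i y.
apply: (@continuousM _ _ (fun=> q 0 i) (glued_field v i)); first exact: cst_continuous.
exact: glued_field_continuous.
Qed.

Lemma mollified_field_near x : mollified_field e v x != 0 ->
  exists k y, phi k y != 0 /\ `|x - y| < e.
Proof.
apply: contra_neqP => /forallNP h; apply/rowP => i; rewrite !mxE.
rewrite /convolution -[RHS](@Rintegral_set0 _ _ _ (@leb R N) (fun=> 0)).
rewrite Rintegral_set0 /Rintegral integral0_eq// => y _.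
have [ey|ye] := leP e `|x - (y : 'rV[R]_N)|; first by rewrite (kern_out bb _ ey) mulr0.
rewrite glued_field_out ?mulr0 ?mul0r// => k.
apply/eqP; apply: contrapT => py; apply: (h k).
by exists y; split; first exact/negP.
Qed.

(** One e is the radius of the kernel, the other leaves room for taking the closure of the
    support. *)
Hypothesis e_small : forall k x y, phi k x != 0 -> `|x - y| < e + e -> Omega y.

Lemma mollified_field_test : test_functions Omega (mollified_field e v).
Proof.
have sub : closure [set x | mollified_field e v x != 0] `<=` Omega.
  move=> x cx; have /cx : nbhs x (ball x e) by exact: nbhsx_ballx.
  move=> [z [/mollified_field_near[k [y [py zy]]]]].
  rewrite -ball_normE /= => xz; apply: (e_small py).
  rewrite -[y](subrK z) -addrA (le_lt_trans (ler_normD _ _))// ltrD//.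
    by rewrite distrC.
  by rewrite distrC.
split => //; first exact: smooth_conv_field bb _ intz _.
apply: bounded_closed_compact; last exact: closed_closure.
have [M [Mr OM]] := bO; exists M; split=> // y My x /sub Ox.
exact: (OM y My x Ox).
Qed.

End FixedScale.

Context (u : 'rV[R]_N -> R).
Hypothesis intu : leb.-integrable (Omega : set T) (EFin \o u).

Let U : T -> R := u \_ Omega.

Let intU : leb.-integrable [set: T] (EFin \o U).
Proof. by have /(integrable_mkcond _ mO) := intu; rewrite restrict_EFin. Qed.

Lemma phi_coord_bounded_support k i : bounded_support (fun x => phi k x 0 i).
Proof.
have [M MO] := bounded_set_out bO.
by exists M => x /MO /(test_function_out (phi_test k)) ->; rewrite mxE.
Qed.

(** Two transfers whose signs cancel. The derivative first passes from the kernel of the field to v,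
    where deta k (v) times a partial derivative of v is the partial derivative of eta k o v;
    integration by parts then moves it to phi k. *)
Lemma glued_pairing e (v := mollify e U) : 0 < e ->
  \int[leb]_(x in [set: T]) (U x * divergence (mollified_field e v) x) =
  \sum_(k : I) \int[leb]_(x in [set: T]) (eta k (v x) * divergence (phi k) x).
Proof.
move=> e0; have bb := scaled_bump_sequence e0.
have intm : leb.-integrable [set: T] (EFin \o (fun y => (@mass R N e)^-1 * U y)).
  exact: (integrableZlR _ intU).
have cv : continuous v by apply: (conv_kern_continuous bb intm).
pose dv i := convolution (fun y => (@mass R N e)^-1 * U y) (K e i).
have dvP i x : is_derive x (delta_mx 0 i) v (dv i x) by apply: (is_derive_conv_kern bb intm).
have cdv i : continuous (dv i) by apply: (conv_kern_continuous bb intm).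
have iz i := glued_field_integrable i cv.
have izm i := integrableZlR (@mass R N e)^-1 (iz i).
have iU i : leb.-integrable [set: T] (EFin \o (fun x => U x *
    convolution (fun y => (@mass R N e)^-1 * glued_field v i y) (K e i) x)).
  have [C _ cC] := conv_kern_bounded bb (izm i) (incr i (fun=> 0%N)).
  apply: (integrable_mul_bounded intU _ cC).
  by apply: measurable_continuous; apply: (conv_kern_continuous bb (izm i)).
have etav k i x : is_derive x (delta_mx 0 i) (fun y => eta k (v y)) (deta k (v x) * dv i x).
  exact: (is_derive_outer_comp (eta_deriv k (v x)) (dvP i x)).
have cetav k : continuous (fun y => eta k (v y)).
  by move=> x; apply: continuous_comp; [exact: cv|exact: eta_continuous].
have cdetav k i : continuous (fun x => deta k (v x) * dv i x).
  move=> x; apply: (@continuousM _ _ (fun x => deta k (v x)) (dv i)); last exact: cdv.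
  by apply: continuous_comp; [exact: cv|exact: deta_cont].
have DE k i : (fun x => 'D_(delta_mx 0 i) (fun y => eta k (v y)) x) =
    (fun x => deta k (v x) * dv i x).
  by apply/funext => x; exact: derive_val.
have C1etav k : C1 (fun y => eta k (v y)).
  by move=> i; split; [move=> x; exact: ex_derive|rewrite DE].
have C1phi k i : C1 (fun x => phi k x 0 i).
  by apply: smooth_coord_C1; have [] := phi_test k.
have cphi k i : continuous (fun x => phi k x 0 i).
  by apply: coord_continuous_comp; apply: smooth_continuous; have [] := phi_test k.
have cMul (h h' : 'rV[R]_N -> R) : continuous h -> continuous h' -> continuous (fun x => h x * h' x).
  by move=> ch ch' x; apply: continuousM; [exact: ch|exact: ch'].
have idp k i : leb.-integrable [set: T]
    (EFin \o (fun x => deta k (v x) * dv i x * phi k x 0 i)).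
  apply: continuous_integrable; first exact: cMul.
  have [M phiM] := phi_coord_bounded_support k i.
  by exists M => x Mx; rewrite phiM ?mulr0.
have iep k i : leb.-integrable [set: T]
    (EFin \o (fun x => eta k (v x) * 'D_(delta_mx 0 i) (fun x => phi k x 0 i) x)).
  apply: continuous_integrable; first by apply: cMul => //; have [] := C1phi k i i.
  have [M phiM] := phi_coord_bounded_support k i.
  by exists M => x Mx; rewrite (derive_bounded_support _ phiM) ?mulr0.
transitivity (\sum_(i < N) \int[leb]_(x in [set: T])
    (U x * convolution (fun y => (@mass R N e)^-1 * glued_field v i y) (K e i) x)).
  rewrite -Rintegral_sum//; apply: eq_Rintegral => x _.
  by rewrite (divergence_conv_field bb izm) mulr_sumr.
transitivity (\sum_(i < N) \sum_(k : I) \int[leb]_(x in [set: T])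
    (eta k (v x) * 'D_(delta_mx 0 i) (fun x => phi k x 0 i) x)); last first.
  rewrite exchange_big/=; apply: eq_bigr => k _.
  rewrite -Rintegral_sum//; apply: eq_Rintegral => x _.
  by rewrite -mulr_sumr divergenceE//; have [] := phi_test k.
apply: eq_bigr => i _; rewrite convolution_dual//.
transitivity (- \int[leb]_(x in [set: T]) (\sum_(k : I) deta k (v x) * dv i x * phi k x 0 i)).
  congr (- _); apply: eq_Rintegral => x _.
  rewrite /dv convolutionZ// -mulrA mulrCA /glued_field mulr_suml.
  by apply: eq_bigr => k _; rewrite mulrAC.
rewrite Rintegral_sum// -sumrN; apply: eq_bigr => k _.
rewrite integral_by_parts//; last exact: phi_coord_bounded_support.
by congr (- _); apply: eq_Rintegral => x _; congr (_ * _); exact/esym/derive_val.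
Qed.

(** As eta k 0 may differ from 0, eta k o U need not be integrable over the space. Its difference
    with eta k 0 is, since eta k is 1-Lipschitz, and the constant multiplies a divergence of bounded
    support. *)
Lemma composition_integrable k : leb.-integrable [set: T]
  (EFin \o (fun x => eta k (U x) * divergence (phi k) x)).
Proof.
have [sphi _ _] := phi_test k; have cd := divergence_continuous sphi.
have [C C0 dC] := divergence_bounded bO (phi_test k).
have mU : measurable_fun [set: T] U by exact/measurable_EFinP/(measurable_int leb).
have meU : measurable_fun [set: T] (fun x => eta k (U x)).
  exact: (measurableT_comp (continuous_measurable_fun (eta_continuous (k := k))) mU).
have i1 : leb.-integrable [set: T] (EFin \o (fun x => eta k (U x) - eta k 0)).
  apply: (le_integrable measurableT _ _ intU).
    by apply/measurable_EFinP; apply: measurable_funB.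
  by move=> x _; rewrite /= lee_fin (le_trans (eta_lipschitz _ _ _))// subr0.
have i2 := integrable_mul_bounded i1 (measurable_continuous cd) dC.
have i3 : leb.-integrable [set: T] (EFin \o (fun x => eta k 0 * divergence (phi k) x)).
  apply: integrableZlR; apply: continuous_integrable => //.
  have [M MO] := bounded_set_out bO.
  by exists M => x /MO; exact: divergence_out.
have := integrableD measurableT i2 i3.
apply: eq_integrable => //.
by move=> x _; rewrite /= -EFinD -mulrDl subrK.
Qed.

Lemma finite_pos_lower_bound (a : I -> R) : (forall k, 0 < a k) ->
  exists2 c, 0 < c & forall k, c <= a k.
Proof.
move=> a0; have s0 : 0 < 1 + \sum_(k : I) (a k)^-1.
  by rewrite ltr_pwDl// sumr_ge0// => k _; rewrite invr_ge0 ltW.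
(* The inverse of 1 plus the sum of the inverses lies below every a k, and makes sense also for an
   empty I. *)
exists (1 + \sum_(k : I) (a k)^-1)^-1; first by rewrite invr_gt0.
move=> k; rewrite -[leRHS]invrK lef_pV2 ?posrE ?invr_gt0//.
rewrite (bigD1 k)//= addrCA lerDl addr_ge0// sumr_ge0// => j _.
by rewrite invr_ge0 ltW.
Qed.

(** Since eta k is 1-Lipschitz, replacing U by its mollification costs at most the L1 distance times
    the bound C of the divergence. *)
Lemma composition_error k e (C d : R) : 0 < e -> 0 <= C ->
  (forall x, `|divergence (phi k) x| <= C) ->
  (L1norm (mollify e U \- U)%R <= d%:E)%E ->
  \int[leb]_(x in [set: T]) (eta k (U x) * divergence (phi k) x) <=
  \int[leb]_(x in [set: T]) (eta k (mollify e U x) * divergence (phi k) x) + C * d.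
Proof.
move=> e0 C0 dC vU; set v := mollify e U.
have bb := scaled_bump_sequence e0.
have intm := integrableZlR (@mass R N e)^-1 intU.
have cv : continuous v by apply: (conv_kern_continuous bb intm).
have [sphi _ _] := phi_test k; have cd := divergence_continuous sphi.
have mU : measurable_fun [set: T] U by exact/measurable_EFinP/(measurable_int leb).
have meU : measurable_fun [set: T] (fun x => eta k (U x)).
  exact: (measurableT_comp (continuous_measurable_fun (eta_continuous (k := k))) mU).
have cev : continuous (fun y => eta k (v y)).
  by move=> x; apply: continuous_comp; [exact: cv|exact: eta_continuous].
have mev := measurable_continuous cev.
have ivd : leb.-integrable [set: T] (EFin \o (fun x => eta k (v x) * divergence (phi k) x)).
  apply: continuous_integrable.
    by move=> x; apply: continuousM; [exact: cev|exact: cd].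
  have [M MO] := bounded_set_out bO.
  by exists M => x /MO /(divergence_out (phi_test k)) ->; rewrite mulr0.
have mvU : measurable_fun [set: T] (v \- U).
  exact: (measurable_funB (measurable_continuous cv) mU).
have ivU : leb.-integrable [set: T] (EFin \o (v \- U)).
  apply/integrableP; split; first exact/measurable_EFinP.
  by apply: le_lt_trans vU _; exact: ltry.
have ih : leb.-integrable [set: T] (EFin \o (fun x => eta k (U x) - eta k (v x))).
  apply: (le_integrable measurableT _ _ ivU).
    by apply/measurable_EFinP; apply: measurable_funB.
  by move=> x _; rewrite /= lee_fin (le_trans (eta_lipschitz _ _ _))// distrC.
rewrite -lerBlDl -(RintegralB measurableT (composition_integrable k) ivd).
under eq_Rintegral do rewrite -mulrBl.
apply: le_trans (ler_norm _) _.
apply: le_trans (Rintegral_mul_bounded ih (measurable_continuous cd) dC) _.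
rewrite ler_wpM2l// -lee_fin (EFin_Rintegral (integrable_norm ih)).
apply: le_trans vU; apply: ge0_le_integral; first exact: measurableT.
- by move=> x _; rewrite /= lee_fin normr_ge0.
- by apply: (measurable_int leb); exact: (integrable_norm ih).
- by apply: (measurable_int leb); exact: (integrable_norm ivU).
- by move=> x _; rewrite /= lee_fin (le_trans (eta_lipschitz _ _ _))// distrC.
Qed.

Lemma compositions_pairing_le :
  (\sum_(k : I) \int[leb]_(x in (Omega : set T)) (eta k (u x) * divergence (phi k) x)%:E
    <= total_variation_in Omega u)%E.
Proof.
have UE x : Omega x -> u x = U x by move=> Ox; rewrite /U patchE mem_set.
rewrite (eq_bigr (fun k => (\int[leb]_(x in [set: T]) (eta k (U x) * divergence (phi k) x))%:E)); last first.
  move=> k _; rewrite (EFin_Rintegral (composition_integrable k)).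
  by apply: pairing_eq => // x Ox; rewrite UE.
rewrite sumEFin; apply/lee_addgt0Pr => d d0.
have /choice[C CP] k : exists C, 0 < C /\ forall x, `|divergence (phi k) x| <= C.
  by have [C ? ?] := divergence_bounded bO (phi_test k); exists C.
have /choice[r rP] k : exists r, 0 < r /\ forall x y, phi k x != 0 -> `|x - y| < r -> Omega y.
  by have [r ? ?] := test_function_dist oO (phi_test k); exists r.
have [r' r'0 r'P] := finite_pos_lower_bound (fun k => (rP k).1).
have C0 : 0 < 1 + \sum_(k : I) C k.
  by rewrite ltr_pwDl// sumr_ge0// => k _; rewrite ltW// (CP k).1.
(* With this accuracy the errors, C k times it for each k, add up to at most d. *)
have dC0 : 0 < d / (1 + \sum_(k : I) C k) by rewrite divr_gt0.
have [e0 e00 e0P] := mollify_cvg Opos intU dC0.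
(* Halving r' ensures e + e <= r', as [e_small] demands. *)
pose e := Num.min e0 (r' / 2).
have e_gt0 : 0 < e by rewrite lt_min e00 divr_gt0.
have vU : (L1norm (mollify e U \- U)%R <= (d / (1 + \sum_(k : I) C k))%:E)%E.
  by apply: e0P; rewrite e_gt0 ge_min lexx.
have e_small k x y : phi k x != 0 -> `|x - y| < e + e -> Omega y.
  move=> px xy; apply: ((rP k).2 x y px); apply: (lt_le_trans xy).
  apply: le_trans (r'P k); rewrite [leRHS]splitr lerD// ge_min lexx orbT//.
set Psi := mollified_field e (mollify e U).
have intm := integrableZlR (@mass R N e)^-1 intU.
have cv : continuous (mollify e U).
  by apply: (conv_kern_continuous (scaled_bump_sequence e_gt0) intm).
have tPsi : test_functions Omega Psi by apply: mollified_field_test.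
have [CP' CP'0 dPsi] := divergence_bounded bO tPsi.
have iP : leb.-integrable [set: T] (EFin \o (fun x => U x * divergence Psi x)).
  apply: (integrable_mul_bounded intU _ dPsi); apply: measurable_continuous.
  by apply: divergence_continuous; have [] := tPsi.
apply: (@le_trans _ _ ((\int[leb]_(x in [set: T]) (U x * divergence Psi x))%:E + d%:E)%E); last first.
  rewrite leeD2r// (EFin_Rintegral iP) -(pairing_eq mO tPsi UE).
  apply: ereal_sup_ubound; exists Psi => //; split => // x.
  exact: mollified_field_norm.
rewrite -EFinD lee_fin glued_pairing//.
apply: (@le_trans _ _ (\sum_(k : I) (\int[leb]_(x in [set: T]) (eta k (mollify e U x) * divergence (phi k) x)
    + C k * (d / (1 + \sum_(k : I) C k))))).
  apply: ler_sum => k _; apply: composition_error => //; first by rewrite ltW// (CP k).1.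
  exact: (CP k).2.
rewrite big_split/= lerD2l -mulr_suml mulrCA ler_piMr ?(ltW d0)//.
by rewrite ler_pdivrMr// mul1r lerDr.
Qed.

End Superadditivity.

(** * The coarea inequality *)

(** The choices for different k are independent, so a bound on sums of chosen values passes to the
    sum of the suprema. The point x0, of value 0, makes each supremum nonnegative and, used for all
    the other indices, bounds it by M; near-maximizers therefore exist. *)
Lemma sum_ereal_sup_le (R : realType) (I : finType) (X : Type) (P : set X) (x0 : X)
    (f : I -> X -> R) (M : \bar R) :
  P x0 -> (forall k, f k x0 = 0) ->
  (forall x : I -> X, (forall k, P (x k)) -> (\sum_k (f k (x k))%:E <= M)%E) ->
  (\sum_k ereal_sup [set (f k x)%:E | x in P] <= M)%E.
Proof.
move=> Px0 fx0 fM.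
case: M fM => [M|_|fM]; last 2 first.
- exact: leey.
- by have := fM (fun=> x0) (fun=> Px0); rewrite sumEFin leeNy_eq.
move=> fM.
have fin k : (ereal_sup [set (f k x)%:E | x in P]) \is a fin_num.
  rewrite ge0_fin_numE; last first.
    by apply: ereal_sup_ubound; exists x0 => //; rewrite fx0.
  apply: le_lt_trans (ltry M); apply: ge_ereal_sup => _ [x Px <-].
  have := fM (fun j => if j == k then x else x0).
  rewrite (bigD1 k)//= eqxx big1 ?adde0; last by move=> j /negbTE ->; rewrite fx0.
  by apply=> j; case: ifP.
apply/lee_addgt0Pr => e e0.
(* One more than the number of indices, to allow for an empty I. *)
have c0 : 0 < #|I|.+1%:R :> R by [].
have d0 : 0 < e / #|I|.+1%:R by rewrite divr_gt0.
have /choice[x xP] k : exists x, P x /\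
    (ereal_sup [set (f k x)%:E | x in P] - (e / #|I|.+1%:R)%:E < (f k x)%:E)%E.
  by have [_ [x Px <-] h] := ub_ereal_sup_adherent d0 (fin k); exists x.
apply: (@le_trans _ _ (\sum_k ((f k (x k))%:E + (e / #|I|.+1%:R)%:E))%E).
  by apply: lee_sum => k _; rewrite -leeBlDr// ltW// (xP k).2.
rewrite big_split/= leeD//; first by apply: fM => k; exact: (xP k).1.
rewrite sumEFin lee_fin sumr_const -[leLHS]mulr_natr mulrAC ler_pdivrMr//.
by rewrite ler_wpM2l ?(ltW e0)// ler_nat.
Qed.

(** * A C^1 unit step whose derivatives form a partition of unity *)

Section HatFunctions.
Context {R : realType}.
Implicit Types s h y : R.

Definition relu s : R := Num.max 0 s.
(** Half the second difference of the squared positive part: a C^1 step rising from 0 to 1 on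
    [-1, 1]. Its derivative [hat] is the second difference of the positive part, the piecewise
    linear tent. *)
Definition ramp s : R := (relu (s + 1) ^+ 2 - relu s ^+ 2 *+ 2 + relu (s - 1) ^+ 2) / 2.
Definition hat s : R := relu (s + 1) - relu s *+ 2 + relu (s - 1).

Lemma relu_ge0 s : 0 <= s -> relu s = s. Proof. by move=> ?; rewrite /relu max_r. Qed.
Lemma relu_le0 s : s <= 0 -> relu s = 0. Proof. by move=> ?; rewrite /relu max_l. Qed.

Lemma is_derive_sqr_relu s c : is_derive s 1 (fun s => relu (s + c) ^+ 2) (relu (s + c) * 2).
Proof.
apply: (@is_derive_quadratic _ _ _ _ _ _ 1) => // h.
rewrite [h *: 1]mulr1 mul1r (_ : s + h + c = s + c + h); last by lra.
move: (s + c) => {}s.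
have [s0|s0] := leP 0 s; have [sh|sh] := leP 0 (s + h).
- rewrite !relu_ge0// (_ : _ - _ - _ = h ^+ 2) ?ger0_norm ?sqr_ge0//; lra.
- rewrite (relu_le0 (ltW sh)) relu_ge0// ler_norml; apply/andP; split; nra.
- rewrite (relu_le0 (ltW s0)) relu_ge0// ler_norml; apply/andP; split; nra.
- rewrite (relu_le0 (ltW s0)) (relu_le0 (ltW sh)) mul0r mulr0 subr0 subrr normr0.
  exact: sqr_ge0.
Qed.

Lemma is_derive_ramp s : is_derive s 1 ramp (hat s).
Proof.
have h1 := is_derive_sqr_relu s 1; have h2 := is_derive_sqr_relu s 0.
have h3 := is_derive_sqr_relu s (-1).
have -> : ramp = 2^-1 *: ((fun s => relu (s + 1) ^+ 2) - 2 *: (fun s => relu (s + 0) ^+ 2)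
    + (fun s => relu (s - 1) ^+ 2)).
  by apply/funext => t; rewrite /ramp !fctE addr0 -[_ *: _]/(_ * _) -[2 *: _]/(_ * _); lra.
apply: is_derive_eq; rewrite addr0 /hat -[_ *: _]/(_ * _) -[2 *: _]/(_ * _); lra.
Qed.

Lemma relu_continuous : continuous relu.
Proof.
apply: (@lipschitz_bound_continuous _ _ _ _ 1) => // x y; rewrite mul1r /relu.
case: (leP 0 x) => ?; case: (leP 0 y) => ?; rewrite ler_norml; apply/andP; split;
  have := ler_norm (x - y); have := ler_norm (- (x - y)); rewrite normrN; lra.
Qed.

Lemma hat_continuous : continuous hat.
Proof.
have sc c : continuous (fun s => relu (s + c)).
  move=> s; apply: (@continuous_comp _ _ _ (fun s => s + c) relu); last exact: relu_continuous.
  by apply: (@continuousD _ _ _ id (fun=> c)); [exact: cvg_id|exact: cst_continuous].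
have -> : hat = (fun s => relu (s + 1) - (relu (s + 0) + relu (s + 0)) + relu (s - 1)).
  by apply/funext => s; rewrite /hat addr0 mulr2n.
move=> s; apply: (@continuousD _ _ _ (fun s => relu (s + 1) - (relu (s + 0) + relu (s + 0)))); last exact: sc.
apply: (@continuousB _ _ _ (fun s => relu (s + 1)) (fun s => relu (s + 0) + relu (s + 0))); first exact: sc.
by apply: (@continuousD _ _ _ (fun s => relu (s + 0))); exact: sc.
Qed.

Lemma ramp_le s : s <= -1 -> ramp s = 0.
Proof. by move=> s1; rewrite /ramp !relu_le0; lra. Qed.

Lemma ramp_ge s : 1 <= s -> ramp s = 1.
Proof. by move=> s1; rewrite /ramp !relu_ge0; lra. Qed.

Lemma hat_ge0 s : 0 <= hat s.
Proof.
rewrite /hat /relu; case: (leP 0 (s + 1)) => ?; case: (leP 0 s) => ?;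
  case: (leP 0 (s - 1)) => ?; lra.
Qed.

Lemma ramp_itv s : 0 <= ramp s <= 1.
Proof.
have [s1|s1] := leP s (-1); first by rewrite ramp_le// lexx ler01.
have [s2|s2] := leP 1 s; first by rewrite ramp_ge// lexx ler01.
have sp : 0 <= s + 1 by lra.
have sm : s - 1 <= 0 by lra.
rewrite /ramp (relu_ge0 sp) (relu_le0 sm).
have [s0|s0] := leP 0 s; first by rewrite (relu_ge0 s0); apply/andP; split; nra.
by rewrite (relu_le0 (ltW s0)); apply/andP; split; nra.
Qed.

(** Second differences telescope. The integer translates of the tent form a partition of unity, of
    which this is a finite piece. *)
Lemma sum_hat y m : \sum_(k < m) hat (y - k%:R) =
  relu (y + 1) - relu y - (relu (y - m%:R + 1) - relu (y - m%:R)).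
Proof.
elim: m => [|m IH]; first by rewrite big_ord0 subr0 subrr.
rewrite big_ord_recr/= IH /hat -natr1.
rewrite (_ : y - (m%:R + 1) + 1 = y - m%:R); last by lra.
by rewrite (_ : y - (m%:R + 1) = y - m%:R - 1); last lra; lra.
Qed.

Lemma relu_increment y : 0 <= relu (y + 1) - relu y <= 1.
Proof. by rewrite /relu; case: (leP 0 (y + 1)) => ?; case: (leP 0 y) => ?; lra. Qed.

Lemma sum_hat_le1 y m : \sum_(k < m) hat (y - k%:R) <= 1.
Proof.
rewrite sum_hat; have := relu_increment y; have := relu_increment (y - m%:R).
by move=> /andP[? ?] /andP[? ?]; lra.
Qed.

Lemma sum_hat_eq0 y m : y <= -1 -> \sum_(k < m) hat (y - k%:R) = 0.
Proof.
move=> y1; apply: big1 => k _; rewrite /hat.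
have k0 : 0 <= k%:R :> R by [].
by rewrite !relu_le0 ?mul0rn; lra.
Qed.

End HatFunctions.

(** * The family of steps cutting out the slabs of u and -u *)

Section CoareaFamily.
Context {R : realType} (n m : nat).
Implicit Types s : R.

(** [false] stands for u and [true] for -u. *)
Definition sgnb (b : bool) : R := (-1) ^+ b.

(** With p = (k, b), the step rises while sgnb b * s goes from (k+1)/(n+1) to (k+3)/(n+1). The shift
    by 2 keeps it at 0 when sgnb b * s <= t with t in the cell [k/(n+1), (k+1)/(n+1)[, and keeps the
    families for u and -u apart. *)
Definition level_fun (p : 'I_m * bool) s : R :=
  n.+1%:R^-1 * ramp (n.+1%:R * (sgnb p.2 * s) - p.1%:R - 2).

Definition level_deriv (p : 'I_m * bool) s : R :=
  sgnb p.2 * hat (n.+1%:R * (sgnb p.2 * s) - p.1%:R - 2).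

Lemma is_derive_affine (a c s : R) : is_derive s 1 (fun s => a * s + c) a.
Proof.
have -> : (fun s => a * s + c) = a *: id + cst c by apply/funext => t; rewrite !fctE.
by apply: is_derive_eq; rewrite addr0 -[_ *: _]/(_ * _) mulr1.
Qed.

Lemma is_derive_level p s : is_derive s 1 (level_fun p) (level_deriv p s).
Proof.
have da := is_derive_affine (n.+1%:R * sgnb p.2) (- p.1%:R - 2) s.
have E t : n.+1%:R * sgnb p.2 * t + (- p.1%:R - 2) = n.+1%:R * (sgnb p.2 * t) - p.1%:R - 2.
  by rewrite mulrA addrA.
have dr := is_derive_ramp (n.+1%:R * sgnb p.2 * s + (- p.1%:R - 2)).
have := @is_derive_outer_comp _ _ ramp _
  (fun s => n.+1%:R * sgnb p.2 * s + (- p.1%:R - 2)) s 1 _ dr da.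
have -> : level_fun p = n.+1%:R^-1 *: (fun t => ramp (n.+1%:R * sgnb p.2 * t + (- p.1%:R - 2))).
  by apply/funext => t; rewrite !fctE /level_fun E.
move=> d; apply: is_derive_eq; rewrite -[_ *: _]/(_ * _) E /level_deriv.
by rewrite mulrCA mulKf// mulrC.
Qed.

Lemma level_deriv_continuous p : continuous (level_deriv p).
Proof.
move=> s; apply: (@continuousM _ _ (fun=> sgnb p.2)
  (fun s => hat (n.+1%:R * (sgnb p.2 * s) - p.1%:R - 2))); first exact: cst_continuous.
apply: (@continuous_comp _ _ _ (fun s => n.+1%:R * (sgnb p.2 * s) - p.1%:R - 2) hat);
  last exact: hat_continuous.
have -> : (fun s => n.+1%:R * (sgnb p.2 * s) - p.1%:R - 2) =
    (fun s => n.+1%:R * sgnb p.2 * s + (- p.1%:R - 2)).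
  by apply/funext => t; rewrite mulrA addrA.
apply/differentiable_continuous/derivable1_diffP.
by have [] := is_derive_affine (n.+1%:R * sgnb p.2) (- p.1%:R - 2) s.
Qed.

Lemma level_deriv_sum s : \sum_p `|level_deriv p s| <= 1.
Proof.
rewrite (eq_bigr (fun p : 'I_m * bool => hat (n.+1%:R * (sgnb p.2 * s) - 2 - p.1%:R))); last first.
  move=> p _; rewrite /level_deriv normrM normrX normrN1 expr1n mul1r ger0_norm ?hat_ge0//.
  by rewrite addrAC.
rewrite -(pair_big xpredT xpredT (fun (k : 'I_m) b => hat (n.+1%:R * (sgnb b * s) - 2 - k%:R)))/=.
rewrite exchange_big/= big_bool/= /sgnb expr0 expr1 mul1r mulN1r mulrN.
(* One of s and -s is nonpositive; for that sign the arguments are at most -2 and all the tents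
   vanish. *)
have [s0|s0] := leP 0 (n.+1%:R * s).
  rewrite [X in X + _]sum_hat_eq0 ?add0r ?sum_hat_le1//; lra.
by rewrite [X in _ + X]sum_hat_eq0 ?addr0 ?sum_hat_le1//; lra.
Qed.

End CoareaFamily.

Section LimInf.
Context {R : realType}.
Local Open Scope ereal_scope.

Lemma le_limn_einf (a b : (\bar R)^nat) : (forall k, a k <= b k) -> limn_einf a <= limn_einf b.
Proof.
move=> ab; rewrite !limn_einf_lim; apply: lee_lim; [exact: is_cvg_einfs..|].
apply: nearW => n; apply: le_ereal_inf_tmp => _ [k /= nk <-].
by apply: le_trans (ab k); apply: ereal_inf_lbound; exists k.
Qed.

Lemma limn_einf_le_cst (a : (\bar R)^nat) (M : \bar R) : (forall k, a k <= M) -> limn_einf a <= M.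
Proof.
move=> aM; apply: (le_trans (le_limn_einf aM)).
by have [-> _] := @cvg_limn_einf_sup R (fun=> M) M (cvg_cst M).
Qed.

Lemma cvg_le_limn_einf (a b : (\bar R)^nat) (l : \bar R) : a @ \oo --> l ->
  (forall k, a k <= b k) -> l <= limn_einf b.
Proof.
by move=> al ab; apply: le_trans (le_limn_einf ab); have [-> _] := cvg_limn_einf_sup al.
Qed.

End LimInf.

(** * From slabs to superlevel sets *)

Section Coarea.
Context {R : realType} {N : nat}.
Local Notation T := (lebesgue_rV R N).
Context (Omega : set 'rV[R]_N) (oO : open Omega) (bO : bounded_set Omega).
Context (Opos : (0 < leb Omega)%E).
Implicit Types (u : 'rV[R]_N -> R).

Let mO : measurable (Omega : set T). Proof. exact: measurable_open. Qed.

Let unit_fields := [set phi | test_functions Omega phi /\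
                      forall x, (euclidean_norm (phi x) <= 1)%R].

Lemma unit_field0 : unit_fields (fun=> 0).
Proof.
have D0 i : (fun x => 'D_(delta_mx 0 i) (fun=> 0 : 'rV[R]_N) x) = (fun=> 0 : 'rV[R]_N).
  by apply/funext => x; exact: derive_cst.
have e0 : [set x : 'rV[R]_N | (0 : 'rV[R]_N) != 0] = set0.
  by apply/seteqP; split => // x /=; rewrite eqxx.
split; last by move=> x; rewrite /euclidean_norm big1 ?sqrtr0// => i _; rewrite mxE expr0n.
split; [|by rewrite e0 closure0; exact: compact0|by rewrite e0 closure0].
move=> k; elim: k => [|k IH]; split; try exact: cst_continuous; first by [].
by move=> i; split; [move=> x; exact: derivable_cst|rewrite D0].
Qed.

Lemma divergence0 (x : 'rV[R]_N) : divergence (fun=> 0) x = 0.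
Proof. by apply: big1 => i _; rewrite derive_cst mxE. Qed.

Lemma total_variation_in_ge0 u : (0 <= total_variation_in Omega u)%E.
Proof.
apply: ereal_sup_ubound; exists (fun=> 0); first exact: unit_field0.
by rewrite integral0_eq// => x _; rewrite divergence0 mulr0.
Qed.

Lemma pairing_integrable u phi :
  leb.-integrable (Omega : set T) (EFin \o u) -> unit_fields phi ->
  leb.-integrable (Omega : set T) (EFin \o (fun x => u x * divergence phi x)).
Proof.
move=> iu [tphi _]; have [C' _ dC] := divergence_bounded bO tphi.
rewrite (_ : _ \o _ = (EFin \o u) \* (EFin \o divergence phi))%E //.
have [sphi _ _] := tphi.
apply: integrableMl => //.
  exact: measurable_funTS (measurable_continuous (divergence_continuous sphi)).
exists C'; split; first exact: num_real.
by move=> y Cy x _; exact: le_trans (dC x) (ltW Cy).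
Qed.

Lemma indic_integrable (A : set 'rV[R]_N) : measurable (A : set T) ->
  leb.-integrable (Omega : set T) (EFin \o (\1_A : 'rV[R]_N -> R)).
Proof.
move=> mA; apply: measurable_bounded_integrable => //; first exact: leb_bounded.
exists 1; split; first exact: num_real.
by move=> y y1 x _; apply: le_trans (ltW y1); rewrite indicE; case: (_ \in _); rewrite ?normr1 ?normr0.
Qed.

Section FixedFunction.
Context (u : 'rV[R]_N -> R).
Hypothesis intu : leb.-integrable (Omega : set T) (EFin \o u).

(** Each total variation is a supremum over its own test field; the zero field is the neutral choice
    that [sum_ereal_sup_le] asks for. *)
Lemma total_variation_compositions (I : finType) (eta deta : I -> R -> R) :
  (forall k (s : R), is_derive s 1 (eta k) (deta k s)) ->
  (forall k, continuous (deta k)) -> (forall s, \sum_k `|deta k s| <= 1) ->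
  (\sum_k total_variation_in Omega (fun x => eta k (u x)) <= total_variation_in Omega u)%E.
Proof.
move=> ed dc d1.
pose f (k : I) (phi : 'rV[R]_N -> 'rV[R]_N) : R :=
  fine (\int[leb]_(x in (Omega : set T)) (eta k (u x) * divergence phi x)%:E)%E.
have fE k phi : unit_fields phi ->
    (\int[leb]_(x in (Omega : set T)) (eta k (u x) * divergence phi x)%:E)%E = (f k phi)%:E.
  move=> [tphi _]; rewrite /f fineK//.
  have UE x : Omega x -> eta k (u x) = eta k ((u \_ Omega) x) by move=> Ox; rewrite patchE mem_set.
  rewrite (pairing_eq mO tphi UE).
  have := @composition_integrable _ _ _ oO bO I eta deta ed d1 (fun=> phi) (fun=> tphi) u intu k.
  exact: (integrable_fin_num measurableT).
rewrite (eq_bigr (fun k => ereal_sup [set (f k phi)%:E | phi in unit_fields])).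
  apply: (sum_ereal_sup_le unit_field0).
    by move=> k; rewrite /f integral0_eq// => x _; rewrite divergence0 mulr0.
  move=> phi Pphi; under eq_bigr do rewrite -fE//.
  apply: (@compositions_pairing_le _ _ _ oO bO Opos I eta deta) => // k.
  - by have [] := Pphi k.
  - by have [_] := Pphi k.
move=> k _; congr ereal_sup; apply/seteqP; split=> _ [phi Pphi <-]; exists phi => //.
  by rewrite fE.
by rewrite fE.
Qed.

Lemma le_total_variation_scale (w : 'rV[R]_N -> R) (c : R) : 0 < c ->
  leb.-integrable (Omega : set T) (EFin \o w) ->
  (total_variation_in Omega (fun x => (c^-1 * w x)%R)
    >= c^-1%:E * total_variation_in Omega w)%E.
Proof.
move=> c0 iw; rewrite -lee_pdivlMl ?invr_gt0// invrK.
apply: ge_ereal_sup => _ [phi Pphi <-].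
have ip := pairing_integrable iw Pphi.
apply: (@le_trans _ _ (c%:E * \int[leb]_(x in (Omega : set T)) (c^-1 * w x * divergence phi x)%:E)%E).
  rewrite [X in (_ <= _ * X)%E](eq_integral (fun x : T => c^-1%:E * (w x * divergence phi x)%:E)%E); last first.
    by move=> x _; rewrite -EFinM mulrA.
  rewrite (integralZl mO ip) muleA -EFinM mulfV ?gt_eqF// mul1e//.
by rewrite lee_pmul2l// ?lte_fin//; apply: ereal_sup_ubound; exists phi.
Qed.

(* If t >= 0 and k is the integer part of (n+1) t, the slice approximates the indicator of
   the set where t < sgnb b * u x. *)
Definition slice (n k : nat) (b : bool) : 'rV[R]_N -> R :=
  fun x => ramp (n.+1%:R * (sgnb b * u x) - k%:R - 2).

Definition slice_variation n k b : \bar R := total_variation_in Omega (slice n k b).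

Let mu : measurable_fun (Omega : set T) u.
Proof. exact/measurable_EFinP/(measurable_int leb). Qed.

Lemma measurable_slice n k b : measurable_fun (Omega : set T) (slice n k b).
Proof.
have cr : continuous (@ramp R).
  by move=> s; apply/differentiable_continuous/derivable1_diffP; have [] := is_derive_ramp s.
apply: (measurableT_comp (continuous_measurable_fun cr)).
apply: measurable_funB; last exact: measurable_cst.
apply: measurable_funB; last exact: measurable_cst.
exact: (measurable_funM (measurable_cst _) (measurable_funM (measurable_cst _) mu)).
Qed.

Lemma slice_integrable n k b : leb.-integrable (Omega : set T) (EFin \o slice n k b).
Proof.
apply: measurable_bounded_integrable => //.
- exact: leb_bounded.
- exact: measurable_slice.
exists 1; split; first exact: num_real.
move=> y y1 x _; apply: le_trans (ltW y1).
by have /andP[h0 h1] := ramp_itv (n.+1%:R * (sgnb b * u x) - k%:R - 2); rewrite ger0_norm.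
Qed.

Lemma sum_slice_variation n m :
  (\sum_(0 <= k < m) (n.+1%:R^-1)%:E * (slice_variation n k false + slice_variation n k true)
    <= total_variation_in Omega u)%E.
Proof.
have := @total_variation_compositions ('I_m * bool)%type (@level_fun R n m) (@level_deriv R n m)
  (@is_derive_level R n m) (@level_deriv_continuous R n m) (@level_deriv_sum R n m).
apply: le_trans.
rewrite -(pair_big xpredT xpredT (fun (k : 'I_m) b =>
  total_variation_in Omega (fun x => level_fun n (k, b) (u x))))/=.
rewrite big_mkord; apply: lee_sum => k _.
rewrite big_bool/= muleDr//; last first.
  by rewrite ge0_adde_def// inE; exact: total_variation_in_ge0.
rewrite addeC; apply: leeD.
- exact: (le_total_variation_scale _ (slice_integrable n k true)).
- exact: (le_total_variation_scale _ (slice_integrable n k false)).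
Qed.

Hypothesis tvu : (total_variation_in Omega u < +oo)%E.

(** Up to the factor 1/(n+1) this is a summand in a sum bounded by the variation of u. Finiteness
    allows [level_profile] to have real coefficients. *)
Lemma slice_variation_fin n k b : slice_variation n k b \is a fin_num.
Proof.
rewrite ge0_fin_numE; last exact: total_variation_in_ge0.
have h : (n.+1%:R^-1%:E * slice_variation n k b < +oo)%E.
  apply: le_lt_trans tvu; apply: le_trans (sum_slice_variation n k.+1).
  rewrite big_nat_recr//=; apply: (@le_trans _ _ (n.+1%:R^-1%:E *
      (slice_variation n k false + slice_variation n k true))%E).
    rewrite lee_pmul2l ?lte_fin ?invr_gt0//.
    by case: b; [rewrite leeDr|rewrite leeDl]; rewrite ?total_variation_in_ge0.
  rewrite leeDr// sume_ge0// => j _; rewrite mule_ge0 ?lee_fin ?invr_ge0//.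
  by rewrite adde_ge0//; exact: total_variation_in_ge0.
rewrite ltey; apply/eqP => sy; move: h.
by rewrite sy gt0_muley ?lte_fin ?invr_gt0// ltxx.
Qed.

Definition level_variation n k : \bar R :=
  (slice_variation n k false + slice_variation n k true)%E.

Definition level_cell n k : set R := `[(k%:R / n.+1%:R), (k.+1%:R / n.+1%:R)[%classic.

(** A step function of t, equal to [level_variation n k] on the k-th cell and to 0 for t < 0; its
    integral is the limit of the sums in [sum_slice_variation]. *)
Definition level_profile n (t : R) : \bar R :=
  (\sum_(k <oo) (fine (level_variation n k))%:E * (\1_(level_cell n k) t)%:E)%E.

Lemma level_variation_ge0 n k : (0 <= level_variation n k)%E.
Proof. by rewrite adde_ge0//; exact: total_variation_in_ge0. Qed.

Lemma level_variationE n k : level_variation n k = (fine (level_variation n k))%:E.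
Proof. by rewrite fineK// fin_numD !slice_variation_fin. Qed.

Lemma lebesgue_level_cell n k : lebesgue_measure (level_cell n k) = (n.+1%:R^-1)%:E.
Proof.
rewrite /level_cell lebesgue_measure_itv/= lte_fin ltr_pM2r ?invr_gt0// ltr_nat ltnSn.
by rewrite -EFinB -mulrBl -natrB// subSnn mul1r.
Qed.

Lemma level_term_ge0 n k t :
  (0 <= (fine (level_variation n k))%:E * (\1_(level_cell n k) t)%:E)%E.
Proof. by rewrite -level_variationE mule_ge0 ?level_variation_ge0 ?lee_fin. Qed.

Lemma level_profile_ge0 n t : (0 <= level_profile n t)%E.
Proof. by apply: nneseries_ge0 => k _ _; exact: level_term_ge0. Qed.

Lemma measurable_level_term n k : measurable_fun setT
  (fun t : R => (fine (level_variation n k))%:E * (\1_(level_cell n k) t)%:E)%E.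
Proof.
apply/measurable_EFinP; apply: measurable_funM; first exact: measurable_cst.
by apply: measurable_indic; exact: measurable_itv.
Qed.

Lemma measurable_level_profile n : measurable_fun setT (level_profile n).
Proof.
apply: ge0_emeasurable_sum; first by move=> k t _ _; exact: level_term_ge0.
by move=> k _; exact: measurable_level_term.
Qed.

Lemma integral_level_profile n :
  (\int[lebesgue_measure]_t level_profile n t <= total_variation_in Omega u)%E.
Proof.
rewrite integral_nneseries//; last 2 first.
- by move=> k; exact: measurable_level_term.
- by move=> k t _; exact: level_term_ge0.
apply: lime_le; first by apply: is_cvg_nneseries => k _ _; apply: integral_ge0 => t _; exact: level_term_ge0.
apply: nearW => m; apply: le_trans (sum_slice_variation n m).
apply: lee_sum => k _; rewrite ge0_integralZl_EFin//; last 2 first.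
- by apply/measurable_EFinP; apply: measurable_indic; exact: measurable_itv.
- by rewrite fine_ge0// level_variation_ge0.
rewrite integral_indic ?setIT//; last exact: measurable_itv.
by rewrite [X in (_ * X)%E](lebesgue_level_cell n k) -level_variationE muleC.
Qed.

Lemma level_profile_ge n t : 0 <= t ->
  (level_variation n (Num.truncn (n.+1%:R * t)) <= level_profile n t)%E.
Proof.
move=> t0; set k := Num.truncn _.
have /andP[k1 k2] := truncn_itv (mulr_ge0 (ler0n R n.+1) t0).
have /nneseries_lim_ge := fun j (_ : (0 <= j)%N) (_ : xpredT j) => level_term_ge0 n j t.
move=> /(_ k.+1); apply: le_trans; rewrite big_nat_recr//= [X in (_ + X)%E](_ : _ = level_variation n k).
  by rewrite leeDr// sume_ge0// => j _; exact: level_term_ge0.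
rewrite indicE mem_set ?mule1 -?level_variationE// /level_cell/= in_itv/=.
by rewrite ler_pdivrMr// ltr_pdivlMr// mulrC k1.
Qed.

Lemma slice_near t b x : 0 <= t ->
  \forall n \near \oo, slice n (Num.truncn (n.+1%:R * t)) b x = \1_[set x | t < sgnb b * u x] x.
Proof.
move=> t0; rewrite indicE /slice; have [tu|ut] := ltP t (sgnb b * u x).
  rewrite mem_set//.
  have d0 : 0 < sgnb b * u x - t by rewrite subr_gt0.
  near=> n; apply: ramp_ge.
  have /andP[k1 k2] := truncn_itv (mulr_ge0 (ler0n R n.+1) t0).
  (* As k <= (n+1) t, a gap of 3 leaves at least 1 after the shift by 2 in the argument of the
     ramp. *)
  have : 3 <= n.+1%:R * (sgnb b * u x - t).
    rewrite -ler_pdivrMr//; apply: (@le_trans _ _ n%:R); last by rewrite ler_nat.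
    by near: n; exact: nbhs_infty_ger.
  rewrite mulrBr; move: k1; set k := (_%:R : R) => k1; lra.
rewrite memNset; last by apply/negP; rewrite -leNgt.
apply: nearW => n; apply: ramp_le.
(* Here (n+1) t < k + 1, so the argument of the ramp is below -1 for every n. *)
have /andP[k1 k2] := truncn_itv (mulr_ge0 (ler0n R n.+1) t0).
have : n.+1%:R * (sgnb b * u x) <= n.+1%:R * t by rewrite ler_wpM2l.
move: k2; rewrite -natr1; set k := (_%:R : R) => k2; lra.
Unshelve. all: by end_near. Qed.

Definition superlevel b t : set 'rV[R]_N := Omega `&` [set x | t < sgnb b * u x].

Lemma measurable_superlevel b t : measurable (superlevel b t : set T).
Proof.
rewrite [X in measurable X](_ : _ = (Omega : set T) `&` (fun x => sgnb b * u x) @^-1` `]t, +oo[).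
  by apply: (measurable_funM (measurable_cst _) mu) => //; exact: measurable_itv.
by congr (_ `&` _); apply/seteqP; split => x /=; rewrite in_itv/= andbT.
Qed.

Lemma cvg_slice_pairing phi t b : 0 <= t -> unit_fields phi ->
  (\int[leb]_(x in (Omega : set T))
    (slice n (Num.truncn (n.+1%:R * t)) b x * divergence phi x)%:E)%E @[n --> \oo] -->
  (\int[leb]_(x in (Omega : set T)) (\1_(superlevel b t) x * divergence phi x)%:E)%E.
Proof.
move=> t0 Pphi; have [tphi _] := Pphi; have [C C0 dC] := divergence_bounded bO tphi.
pose f n (x : T) := (slice n (Num.truncn (n.+1%:R * t)) b x * divergence phi x)%:E.
have mf n : measurable_fun (Omega : set T) (f n).
  have /measurable_int := pairing_integrable (slice_integrable n (Num.truncn (n.+1%:R * t)) b) Pphi.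
  exact.
have intC : leb.-integrable (Omega : set T) (EFin \o (fun=> C) : T -> \bar R).
  apply: measurable_bounded_integrable => //; first exact: leb_bounded.
  by exists `|C|; split => // y y1 x _; exact: ltW.
apply: (@dominated_cvg _ T R leb Omega mO f _ (fun=> C%:E)) => //.
- move=> x Ox; apply: cvg_near_cst; apply: filterS (slice_near b x t0) => n nE.
  rewrite /f nE !indicE; have -> // : (x \in superlevel b t) = (x \in [set x | t < sgnb b * u x]).
  by apply/idP/idP => /set_mem h; apply: mem_set => /=; [case: h|split].
- move=> n x Ox; rewrite /f lee_fin normrM.
  have /andP[h0 h1] := ramp_itv (n.+1%:R * (sgnb b * u x) - (Num.truncn (n.+1%:R * t))%:R - 2).
  by rewrite (ger0_norm h0) -[leRHS]mul1r ler_pM.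
Qed.

(** Lower semicontinuity: for fixed test fields, one for each sign, the pairings with the slices
    converge by dominated convergence; the two suprema are taken afterwards, jointly. *)
Lemma perimeter_superlevels_le t : 0 <= t ->
  (perimeter (superlevel false t) Omega + perimeter (superlevel true t) Omega
    <= limn_einf (level_profile ^~ t))%E.
Proof.
move=> t0.
have ind_int b := indic_integrable (measurable_superlevel b t).
pose f (b : bool) phi := fine (\int[leb]_(x in (Omega : set T))
  (\1_(superlevel b t) x * divergence phi x)%:E)%E.
have fE b phi : unit_fields phi -> (\int[leb]_(x in (Omega : set T))
    (\1_(superlevel b t) x * divergence phi x)%:E)%E = (f b phi)%:E.
  move=> Pphi; rewrite /f fineK//; apply: integrable_fin_num => //.
  exact: (pairing_integrable (ind_int b) Pphi).
have PE b : perimeter (superlevel b t) Omega = ereal_sup [set (f b phi)%:E | phi in unit_fields].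
  by congr ereal_sup; apply/seteqP; split=> _ [phi Pphi <-]; exists phi => //; rewrite fE.
have := @sum_ereal_sup_le R bool _ unit_fields (fun=> 0) f (limn_einf (level_profile ^~ t)) unit_field0.
rewrite big_bool /= !PE addeC; apply.
  by move=> b; rewrite /f integral0_eq// => x _; rewrite divergence0 mulr0.
move=> phi Pphi; rewrite big_bool.
have cv b : (\int[leb]_(x in (Omega : set T))
      (slice n (Num.truncn (n.+1%:R * t)) b x * divergence (phi b) x)%:E)%E @[n --> \oo]
    --> (f b (phi b))%:E.
  by rewrite -fE; [exact: cvg_slice_pairing|exact: Pphi].
apply: (@cvg_le_limn_einf _ _ _ _ (cvgeD _ (cv true) (cv false))) => [//|n].
apply: le_trans (level_profile_ge n t0); rewrite /level_variation addeC.
by apply: leeD; apply: ereal_sup_ubound; eexists => //; exact: Pphi.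
Qed.

Lemma coarea_inequality : exists G : R -> \bar R,
  [/\ measurable_fun setT G, forall t, (0 <= G t)%E,
      (\int[lebesgue_measure]_t G t <= total_variation_in Omega u)%E &
      forall t, 0 <= t -> (perimeter (superlevel false t) Omega +
        perimeter (superlevel true t) Omega <= G t)%E].
Proof.
exists (fun t => limn_einf (level_profile ^~ t)); split.
(* The measurability of a liminf is reduced to that of a limsup by a change of sign. *)
- rewrite [X in measurable_fun _ X](_ : _ = \- (fun t => limn_esup (fun n => - level_profile n t)%E))%E.
    apply: (measurableT_comp (@oppe_measurable R setT)); apply: measurable_fun_limn_esup => n.
    exact: (measurableT_comp (@oppe_measurable R setT) (measurable_level_profile n)).
  by apply/funext => t; rewrite -limn_einfN; congr limn_einf; apply/funext => n /=; rewrite oppeK.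
- move=> t; apply: (@cvg_le_limn_einf _ (fun=> 0%E)); first exact: cvg_cst.
  by move=> n; exact: level_profile_ge0.
- apply: (@le_trans _ _ (limn_einf (fun n => \int[lebesgue_measure]_t level_profile n t)%E)).
    apply: fatou => //; first by move=> n; exact: measurable_level_profile.
    by move=> n t _; exact: level_profile_ge0.
  by apply: limn_einf_le_cst => n; exact: integral_level_profile.
- by move=> t t0; exact: perimeter_superlevels_le.
Qed.

End FixedFunction.

End Coarea.

(** * The layer cake formula *)

Section LayerCake.
Context d (T : measurableType d) (R : realType) (mu : {sigma_finite_measure set T -> \bar R}).
Context (f : T -> R) (mf : measurable_fun [set: T] f).

Let hypograph : set (T * R) := [set p | 0 <= p.2 < f p.1].

Let measurable_hypograph : measurable hypograph.
Proof.
have -> : hypograph = (snd @^-1` `[0, +oo[) `&` ((fun p : T * R => f p.1 - p.2) @^-1` `]0, +oo[).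
  apply/seteqP; split => -[x t]/=; rewrite !in_itv/= !andbT subr_gt0.
    by case/andP.
  by move=> [h1 h2]; apply/andP; split.
have ms : measurable_fun setT (fun p : T * R => f p.1 - p.2).
  by apply: measurable_funB; [exact: measurableT_comp|exact: measurable_snd].
apply: measurableI; rewrite -[X in measurable X]setTI.
  exact: (@measurable_snd _ _ T R measurableT _ (measurable_itv _)).
exact: (ms measurableT _ (measurable_itv _)).
Qed.

Let ysection_hypograph t : ysection hypograph t = [set x | 0 <= t < f x].
Proof. by apply/seteqP; split => x; rewrite /ysection/= inE. Qed.

Lemma measurable_distribution_function :
  measurable_fun setT (fun t : R => mu [set x | 0 <= t < f x]).
Proof.
rewrite [X in measurable_fun _ X](_ : _ = (fun t => mu (ysection hypograph t))).
  exact: measurable_fun_ysection.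
by apply/funext => t; rewrite ysection_hypograph.
Qed.

(** Both sides are the product measure of the region 0 <= t < f(x), sliced in the two directions;
    keeping 0 <= t in the set lets t run over the whole line. *)
Lemma layer_cake : (forall x, 0 <= f x) ->
  (\int[mu]_x (f x)%:E = \int[lebesgue_measure]_t mu [set x | (0 <= t < f x)%R])%E.
Proof.
move=> f0; have := indic_fubini_tonelli mu (@lebesgue_measure R) measurable_hypograph.
rewrite indic_fubini_tonelli_FE// indic_fubini_tonelli_GE// => fubini.
transitivity (\int[mu]_x (lebesgue_measure \o xsection hypograph) x)%E; last first.
  by rewrite fubini; apply: eq_integral => t _; rewrite /= ysection_hypograph.
apply: eq_integral => x _ /=; have -> : xsection hypograph x = `[0, f x[%classic.
  by apply/seteqP; split => t; rewrite /xsection/= inE /hypograph/= in_itv.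
rewrite lebesgue_measure_itv/= lte_fin; case: ltgtP (f0 x) => // [? _|<- _].
  by rewrite oppr0 addr0.
by [].
Qed.

End LayerCake.

(** * Total variation and perimeter *)

Section VariationAlgebra.
Context {R : realType} {N : nat}.
Local Notation T := (lebesgue_rV R N).
Context (Omega : set 'rV[R]_N) (oO : open Omega) (bO : bounded_set Omega).
Implicit Types (u w : 'rV[R]_N -> R) (phi : 'rV[R]_N -> 'rV[R]_N).

Let mO : measurable (Omega : set T). Proof. exact: measurable_open. Qed.

Let unit_fields := [set phi | test_functions Omega phi /\
                      forall x, (euclidean_norm (phi x) <= 1)%R].

Lemma CkN k phi : Ck k phi -> Ck k (fun x => - phi x).
Proof.
elim: k phi => [|k IH] phi [cphi]; first by split => // x; apply: continuousN; exact: cphi.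
move=> h; split; first by move=> x; apply: continuousN; exact: cphi.
move=> i; have [d Cd] := h i; split; first by move=> x; exact: derivableN.
rewrite (_ : (fun x => _) = (fun x => - 'D_(delta_mx 0 i) phi x)); first exact: IH.
by apply/funext => x; exact: deriveN.
Qed.

Lemma unit_fieldN phi : unit_fields phi -> unit_fields (fun x => - phi x).
Proof.
move=> [[sphi cphi phiO] phi1].
have E : [set x | - phi x != 0] = [set x | phi x != 0].
  by apply/seteqP; split => x /=; rewrite oppr_eq0.
split; first by split; rewrite ?E// => k; exact: CkN.
move=> x; rewrite /euclidean_norm; under eq_bigr do rewrite mxE sqrrN.
exact: phi1.
Qed.

Lemma divergenceN phi x : smooth phi -> divergence (fun x => - phi x) x = - divergence phi x.
Proof.
move=> /(_ 1%N)[_ h]; rewrite /divergence -sumrN; apply: eq_bigr => i _.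
by rewrite deriveN ?mxE//; exact: (h i).1.
Qed.

Local Open Scope ereal_scope.

(** The opposite of an admissible field is admissible, which gives the absolute value. *)
Lemma abs_pairing_le u phi : leb.-integrable (Omega : set T) (EFin \o u) -> unit_fields phi ->
  `|\int[leb]_(x in (Omega : set T)) (u x * divergence phi x)%:E| <= total_variation_in Omega u.
Proof.
move=> iu Pphi; have ip := pairing_integrable oO bO iu Pphi.
set I := integral _ _ _; case: (leP 0 I) => [I0|/ltW I0]; rewrite ?(gee0_abs I0) ?(lee0_abs I0); first by apply: ereal_sup_ubound; exists phi.
rewrite -(integralN (integrable_add_def mO ip)); apply: ereal_sup_ubound.
exists (fun x => - phi x)%R; first exact: unit_fieldN.
apply: eq_integral => x _; have [[sphi _ _] _] := Pphi.
by rewrite divergenceN// mulrN EFinN.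
Qed.

Lemma total_variation_inZ u (a : R) : leb.-integrable (Omega : set T) (EFin \o u) ->
  total_variation_in Omega (fun x => a * u x)%R <= `|a|%:E * total_variation_in Omega u.
Proof.
move=> iu; apply: ge_ereal_sup => _ [phi Pphi <-].
rewrite (eq_integral (fun x : T => a%:E * (u x * divergence phi x)%:E)); last first.
  by move=> x _; rewrite -EFinM mulrA.
rewrite (integralZl mO (pairing_integrable oO bO iu Pphi)).
apply: le_trans (lee_abs _) _; rewrite abseM.
by rewrite lee_wpmul2l ?abse_ge0//; exact: abs_pairing_le.
Qed.

Lemma total_variation_inD u w : leb.-integrable (Omega : set T) (EFin \o u) ->
  leb.-integrable (Omega : set T) (EFin \o w) ->
  total_variation_in Omega (fun x => u x + w x)%R <=
  total_variation_in Omega u + total_variation_in Omega w.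
Proof.
move=> iu iw; apply: ge_ereal_sup => _ [phi Pphi <-].
rewrite (eq_integral (fun x : T => (u x * divergence phi x)%:E + (w x * divergence phi x)%:E)); last first.
  by move=> x _; rewrite -EFinD mulrDl.
rewrite (integralD mO (pairing_integrable oO bO iu Pphi) (pairing_integrable oO bO iw Pphi)).
by apply: leeD; apply: ereal_sup_ubound; exists phi.
Qed.

Lemma perimeter_set0 : perimeter set0 Omega = 0.
Proof.
apply/eqP; rewrite eq_le total_variation_in_ge0 andbT; apply: ge_ereal_sup => _ [phi _ <-].
by rewrite integral0_eq// => x _; rewrite indicE in_set0 mul0r.
Qed.

Local Close Scope ereal_scope.

(** Integration by parts moves the derivatives to u, and |phi_i| <= 1, so the variation is at most
    the sum of the L1 norms of the partial derivatives. *)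
Lemma C1_total_variation_fin u : continuous u -> C1 u -> bounded_support u ->
  (total_variation_in Omega u < +oo)%E.
Proof.
move=> cu C1u [M uM].
have iD i : leb.-integrable [set: T] (EFin \o (fun x => 'D_(delta_mx 0 i) u x)).
  apply: continuous_integrable; first exact: (C1u i).2.
  by exists M => x; exact: derive_bounded_support.
pose S := \sum_(i < N) \int[leb]_x `|'D_(delta_mx 0 i) u x|.
apply: (@le_lt_trans _ _ S%:E); last exact: ltry.
apply: ge_ereal_sup => _ [phi [tphi phi1] <-]; have [sphi _ _] := tphi.
rewrite (pairing_eq mO tphi (fun x _ => erefl (u x))).
have cphi i : continuous (fun x => phi x 0 i).
  by apply: coord_continuous_comp; exact: smooth_continuous.
have cD i : continuous (fun x => 'D_(delta_mx 0 i) (fun x => phi x 0 i) x).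
  exact: (smooth_coord_C1 i sphi i).2.
have ip i : leb.-integrable [set: T]
    (EFin \o (fun x => u x * 'D_(delta_mx 0 i) (fun x => phi x 0 i) x)).
  apply: continuous_integrable; last by exists M => x Mx; rewrite uM// mul0r.
  move=> x; apply: (@continuousM _ _ u (fun x => 'D_(delta_mx 0 i) (fun x => phi x 0 i) x)).
    exact: cu.
  exact: cD.
have -> : (\int[leb]_(x in [set: T]) (u x * divergence phi x)%:E)%E =
    (\int[leb]_x (\sum_(i < N) u x * 'D_(delta_mx 0 i) (fun x => phi x 0 i) x))%:E.
  rewrite EFin_Rintegral; last exact: integrable_sumR.
  by apply: eq_integral => x _; rewrite divergenceE// mulr_sumr.
rewrite lee_fin Rintegral_sum// ler_sum// => i _.
apply: le_trans (ler_norm _) _.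
have bphi : bounded_support (fun x => phi x 0 i).
  have [M' MO] := bounded_set_out bO.
  by exists M' => x /MO/(test_function_out tphi) ->; rewrite mxE.
rewrite (integral_by_parts i cu C1u (cphi i) (smooth_coord_C1 i sphi) bphi) normrN.
rewrite -[leRHS]mul1r; apply: (Rintegral_mul_bounded (iD i)).
  exact: measurable_continuous.
move=> x; apply: le_trans (phi1 x); rewrite -sqrtr_sqr /euclidean_norm ler_wsqrtr//.
by rewrite (bigD1 i)//= lerDl sumr_ge0// => j _; exact: sqr_ge0.
Qed.

End VariationAlgebra.

(** * Bumps centred at a given point *)

Section TranslatedKernel.
Context {R : realType} {N : nat} (b : nat -> R -> R) (r : R) (bb : bump_sequence b r).
Context (x0 : 'rV[R]_N).

Definition translated_kern al (x : 'rV[R]_N) : R := kern b al (x - x0).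

Lemma translated_kern_continuous al : continuous (translated_kern al).
Proof.
have cB : continuous (fun y : 'rV[R]_N => y - x0).
  move=> y; apply: (@continuousB _ _ _ id (fun=> x0)); last exact: cst_continuous.
  by move=> z; exact: cvg_id.
have ck : continuous (kern b al) by exact: (kern_continuous bb).
move=> x; have := @continuous_comp _ _ _ _ (kern b al) x (cB x) (ck _); exact.
Qed.

Lemma is_derive_translated_kern al i x :
  is_derive x (delta_mx 0 i) (translated_kern al) (translated_kern (incr i al) x).
Proof.
have [C C0 tC] := kern_taylor bb al i; apply: (is_derive_quadratic C0) => h.
rewrite /translated_kern (_ : x + h *: _ - x0 = x - x0 + h *: delta_mx 0 i); last by rewrite addrAC.
exact: tC.
Qed.

Lemma translated_kern_C1 al : C1 (translated_kern al).
Proof.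
move=> i; split; first by move=> x; have [] := is_derive_translated_kern al i x.
rewrite (_ : (fun x => _) = translated_kern (incr i al)); first exact: translated_kern_continuous.
by apply/funext => x; have [_ ->] := is_derive_translated_kern al i x.
Qed.

Lemma translated_kern_out al x : r <= `|x - x0| -> translated_kern al x = 0.
Proof. exact: kern_out. Qed.

End TranslatedKernel.

(** * Comparison of the two constants *)

Section CheegerComparison.
Context {R : realType} {N : nat}.
Local Notation T := (lebesgue_rV R N).
Context (Omega : set 'rV[R]_N) (oO : open Omega) (bO : bounded_set Omega).
Context (Opos : (0 < leb Omega)%E).
Implicit Types (u : 'rV[R]_N -> R) (A : set 'rV[R]_N).

Let mO : measurable (Omega : set T). Proof. exact: measurable_open. Qed.

Local Open Scope ereal_scope.

Lemma leb_sub_fin A : A `<=` Omega -> leb A \is a fin_num.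
Proof.
move=> AO; rewrite ge0_fin_numE; last exact: lebesgue_outer_ge0.
exact: le_lt_trans (le_lebesgue_outer AO) (leb_bounded bO).
Qed.

Lemma sgnb_false (s : R) : (sgnb false * s = s)%R.
Proof. by rewrite /sgnb expr0 mul1r. Qed.

Lemma sgnb_true (s : R) : (sgnb true * s = - s)%R.
Proof. by rewrite /sgnb expr1 mulN1r. Qed.

Lemma ediv2E (x : \bar R) : x / 2%:E = x * (2^-1)%:E.
Proof. by rewrite inver pnatr_eq0. Qed.

Lemma Lnorm_in1E u :
  Lnorm_in 1 Omega u = \int[leb]_(x in (Omega : set T)) `|(u x)%:E|.
Proof.
rewrite /Lnorm_in Lnorm1 [RHS]integral_mkcond; apply: eq_integral => x _.
by rewrite !patchE; case: ifPn => // _; rewrite abse0.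
Qed.

Lemma cheeger_perimeter_le A : measurable (A : set T) -> A `<=` Omega ->
  leb A <= leb Omega / 2%:E ->
  cheeger_neumann Omega * leb A <= perimeter A Omega.
Proof.
move=> mA AO A2; have := lebesgue_outer_ge0 A; rewrite le_eqVlt => /predU1P[A0|A0].
  rewrite [X in _ * X](_ : _ = 0); last exact/esym/A0.
  by rewrite mule0; exact: total_variation_in_ge0.
have Afin := leb_sub_fin AO.
rewrite -(fineK Afin) -lee_pdivlMr; last by rewrite fine_gt0// A0 -ge0_fin_numE.
apply: ereal_inf_lbound; exists A => //.
by rewrite -[in LHS](fineK Afin) inver gt_eqF// fine_gt0// A0 -ge0_fin_numE.
Qed.

Section Function.
Context (u : 'rV[R]_N -> R).
Hypothesis intu : leb.-integrable (Omega : set T) (EFin \o u).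

Lemma le_superlevel b s t : (s <= t)%R -> superlevel Omega u b t `<=` superlevel Omega u b s.
Proof. by move=> st x [Ox /= tx]; split => //=; exact: le_lt_trans tx. Qed.

Lemma superlevel_pos : Omega `&` [set x | (u x > 0)%R] = superlevel Omega u false 0%R.
Proof. by congr (_ `&` _); apply/seteqP; split => x /=; rewrite sgnb_false. Qed.

Lemma superlevel_neg : Omega `&` [set x | (u x < 0)%R] = superlevel Omega u true 0%R.
Proof. by congr (_ `&` _); apply/seteqP; split => x /=; rewrite sgnb_true oppr_gt0. Qed.

Lemma leb_sign_partition : leb Omega = leb (superlevel Omega u false 0%R) +
  leb (superlevel Omega u true 0%R) + leb (Omega `&` [set x | u x = 0%R]).
Proof.
have mA := measurable_superlevel oO intu false 0%R; have mB := measurable_superlevel oO intu true 0%R.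
set Z := Omega `&` [set x | u x = 0%R].
have ZE : (Z : set T) = (Omega : set T) `\` (superlevel Omega u false 0%R `|` superlevel Omega u true 0%R).
  rewrite -superlevel_pos -superlevel_neg; apply/seteqP; split => x [Ox] /=.
    by move=> ux; split => // -[] []; rewrite /= ux ltxx.
  move=> h; split => //=; apply/eqP; case: (ltgtP (u x) 0%R) => // ux; exfalso; apply: h.
    by right.
  by left.
rewrite -measureU//; last first.
  rewrite -superlevel_pos -superlevel_neg; apply/seteqP; split => x //= -[[_ /= h1] [_ /= h2]].
  by have := lt_trans h1 h2; rewrite ltxx.
rewrite -measureU//; last 3 first.
- exact: measurableU.
- by rewrite ZE; apply: measurableD => //; exact: measurableU.
- by rewrite ZE; apply/seteqP; split => x //= -[h [_ nh]]; exact: nh.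
by rewrite ZE setDUK// => x [] [].
Qed.

(** If a, a' and z measure the sets where u is positive, negative and zero, then |a - a'| <= z says
    that a and a' are both at most half of a + a' + z. *)
Lemma balanced_half : `|leb (Omega `&` [set x | (u x > 0)%R]) - leb (Omega `&` [set x | (u x < 0)%R])|
    <= leb (Omega `&` [set x | u x = 0%R]) <->
  forall b, leb (superlevel Omega u b 0%R) <= leb Omega / 2%:E.
Proof.
have fin A : A `<=` Omega -> exists r : R, leb A = r%:E.
  by move=> AO; exists (fine (leb A)); rewrite fineK// leb_sub_fin.
have [a aE] : exists r : R, leb (superlevel Omega u false 0%R) = r%:E by apply: fin => x [].
have [a' a'E] : exists r : R, leb (superlevel Omega u true 0%R) = r%:E by apply: fin => x [].
have [z zE] : exists r : R, leb (Omega `&` [set x | u x = 0%R]) = r%:E by apply: fin => x [].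
rewrite leb_sign_partition superlevel_pos superlevel_neg ediv2E aE a'E zE.
rewrite -EFinB abse_EFin lee_fin ler_norml -!EFinD -EFinM; split.
  by move=> /andP[h1 h2] [|]; rewrite ?aE ?a'E lee_fin; move: h1 h2; lra.
move=> h; have := h true; have := h false; rewrite aE a'E !lee_fin => h1 h2.
by apply/andP; split; move: h1 h2; lra.
Qed.

Lemma balanced_superlevel b : balanced Omega u ->
  leb (superlevel Omega u b 0%R) <= leb Omega / 2%:E.
Proof. by move=> [_ /balanced_half]; exact. Qed.

Let absU (x : T) : R := `|(u \_ Omega) x|%R.

Let measurable_absU : measurable_fun [set: T] absU.
Proof.
apply: (measurableT_comp (@normr_measurable R setT)).
apply/(measurable_restrictT _ _).1 => //.
exact/measurable_EFinP/(measurable_int leb).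
Qed.

Lemma leb_distribution t : (0 <= t)%R ->
  leb [set x : T | (0 <= t < absU x)%R] =
  leb (superlevel Omega u false t) + leb (superlevel Omega u true t).
Proof.
move=> t0; rewrite -measureU; [|exact: measurable_superlevel..|]; last first.
  apply/seteqP; split => x //= -[[_ /=]]; rewrite sgnb_false => h1 [_ /=]; rewrite sgnb_true => h2.
  by have := addr_gt0 (le_lt_trans t0 h1) (le_lt_trans t0 h2); rewrite subrr ltxx.
congr leb; apply/seteqP; split => x /=; rewrite t0/= /absU patchE.
  case: ifPn => [|_]; last by rewrite normr0 ltNge t0.
  rewrite inE => Ox; rewrite ltr_normr => /orP[] h; [left|right]; split => //=.
    by rewrite sgnb_false.
  by rewrite sgnb_true.
by case=> -[Ox /=]; rewrite ?sgnb_false ?sgnb_true => h; rewrite mem_set// ltr_normr h ?orbT.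
Qed.

Lemma integral_leb_distribution :
  \int[lebesgue_measure]_t leb [set x : T | (0 <= t < absU x)%R] = Lnorm_in 1 Omega u.
Proof.
rewrite Lnorm_in1E -(layer_cake leb measurable_absU) => [|x]; last exact: normr_ge0.
rewrite [RHS]integral_mkcond; apply: eq_integral => x _.
by rewrite /absU !patchE; case: ifPn => // _; rewrite normr0.
Qed.

Lemma cheeger_distribution_le t : balanced Omega u -> (0 <= t)%R ->
  cheeger_neumann Omega * leb [set x : T | (0 <= t < absU x)%R] <=
  perimeter (superlevel Omega u false t) Omega + perimeter (superlevel Omega u true t) Omega.
Proof.
move=> bal t0; rewrite leb_distribution// ge0_muleDr; try exact: lebesgue_outer_ge0.
by apply: leeD; apply: cheeger_perimeter_le => [|x []//|]; try exact: measurable_superlevel;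
  apply: le_trans (balanced_superlevel _ bal); apply: le_lebesgue_outer; exact: le_superlevel.
Qed.

Lemma cheeger_ge0 : 0 <= cheeger_neumann Omega.
Proof.
apply: le_ereal_inf_tmp => _ [A _ <-].
by rewrite mule_ge0 ?inve_ge0 ?lebesgue_outer_ge0//; exact: total_variation_in_ge0.
Qed.

(** For t < 0 the set is empty, so the lower bound on G extends to the whole line and can be
    integrated. *)
Lemma cheeger_coarea : balanced Omega u -> exists G : R -> \bar R,
  [/\ measurable_fun setT G,
      \int[lebesgue_measure]_t G t <= total_variation_in Omega u,
      forall t, cheeger_neumann Omega * leb [set x : T | (0 <= t < absU x)%R] <= G t &
      forall t, (0 <= t)%R -> perimeter (superlevel Omega u false t) Omega +
        perimeter (superlevel Omega u true t) Omega <= G t].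
Proof.
move=> bal; have [[_ tvu] _] := bal.
have [G [mG G0 GTV GP]] := coarea_inequality oO bO Opos intu tvu.
exists G; split => // t; have [t0|t0] := leP 0%R t.
  by apply: le_trans (GP t t0); have := cheeger_distribution_le bal t0; rewrite t0.
rewrite (_ : [set x : T | _] = set0); first by rewrite measure0 mule0.
by apply/seteqP; split.
Qed.

Lemma measurable_leb_distribution : measurable_fun setT
  (fun t : R => cheeger_neumann Omega * leb [set x : T | (0 <= t < absU x)%R]).
Proof. by apply: measurable_funeM; exact: measurable_distribution_function. Qed.

Lemma integral_cheeger_distribution :
  \int[lebesgue_measure]_t (cheeger_neumann Omega * leb [set x : T | (0 <= t < absU x)%R]) =
  cheeger_neumann Omega * Lnorm_in 1 Omega u.
Proof.
rewrite ge0_integralZl ?integral_leb_distribution//.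
- exact: measurable_distribution_function.
- exact: cheeger_ge0.
Qed.

Lemma cheeger_le_total_variation : balanced Omega u ->
  cheeger_neumann Omega * Lnorm_in 1 Omega u <= total_variation_in Omega u.
Proof.
move=> bal; have [G [mG GTV Gm _]] := cheeger_coarea bal.
apply: le_trans GTV; rewrite -integral_cheeger_distribution.
apply: ge0_le_integral => //.
- by move=> t _; rewrite mule_ge0 ?cheeger_ge0//; exact: lebesgue_outer_ge0.
- exact: measurable_leb_distribution.
Qed.

End Function.

End CheegerComparison.

Section Minimizers.
Context {R : realType} {N : nat}.
Local Notation T := (lebesgue_rV R N).
Context (Omega : set 'rV[R]_N) (oO : open Omega) (bO : bounded_set Omega).
Context (Opos : (0 < leb Omega)%E).
Implicit Types (u : 'rV[R]_N -> R) (A B : set 'rV[R]_N).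

Let mO : measurable (Omega : set T). Proof. exact: measurable_open. Qed.

Local Open Scope ereal_scope.

Lemma Lnorm_in1_eq0 u : measurable_fun (Omega : set T) u ->
  Lnorm_in 1 Omega u = 0 <-> {ae @leb R N, forall x, Omega x -> u x = 0%R}.
Proof.
move=> mu; rewrite Lnorm_in1E.
have mE : measurable_fun (Omega : set T) (EFin \o (u : T -> R)) by exact/measurable_EFinP.
have -> : {ae @leb R N, forall x, Omega x -> u x = 0%R} <->
    ae_eq leb Omega (EFin \o (u : T -> R)) (cst 0).
  split=> -[Z [mZ Z0 ZP]]; exists Z; split => // x /= h; apply: ZP => /= h'; apply: h => Ox.
    by rewrite /= h'.
  by have [] := h' Ox.
exact: ae_eq_integral_abs.
Qed.

Lemma Lnorm_in1_fin u : leb.-integrable (Omega : set T) (EFin \o u) ->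
  Lnorm_in 1 Omega u \is a fin_num.
Proof.
move=> /integrableP[_ h]; rewrite Lnorm_in1E ge0_fin_numE//.
by apply: integral_ge0 => x _; exact: abse_ge0.
Qed.

Lemma lambda11_admissible_Lnorm u : lambda11_admissible Omega u ->
  exists2 L : R, (0 < L)%R & Lnorm_in 1 Omega u = L%:E.
Proof.
move=> [[[iu _] _] un0]; have fL := Lnorm_in1_fin iu.
exists (fine (Lnorm_in 1 Omega u)); last by rewrite fineK.
have L0 : 0 <= Lnorm_in 1 Omega u.
  by rewrite Lnorm_in1E; apply: integral_ge0 => x _; exact: abse_ge0.
rewrite fine_gt0// -ge0_fin_numE// fL andbT lt_neqAle L0 andbT eq_sym; apply/eqP => h.
by apply: un0; apply/Lnorm_in1_eq0 => //; exact/measurable_EFinP/(measurable_int leb).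
Qed.

Lemma edivE (x : \bar R) (r : R) : (0 < r)%R -> x / r%:E = x * (r^-1)%:E.
Proof. by move=> r0; rewrite inver gt_eqF. Qed.

Lemma cheeger_le_lambda11 : cheeger_neumann Omega <= lambda11 Omega.
Proof.
apply: le_ereal_inf_tmp => _ [u uadm <-]; have [L L0 LE] := lambda11_admissible_Lnorm uadm.
rewrite LE edivE// lee_pdivlMr// -LE; have [bal _] := uadm.
by apply: (cheeger_le_total_variation oO bO Opos) => //; have [[]] := bal.
Qed.

Lemma indic_in A x : A x -> \1_A x = 1%R :> R.
Proof. by move=> Ax; rewrite indicE mem_set. Qed.

Lemma indic_out A x : ~ A x -> \1_A x = 0%R :> R.
Proof. by move=> Ax; rewrite indicE memNset. Qed.

(** * Combinations of two disjoint indicator functions *)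

Section TwoSets.
Context (A B : set 'rV[R]_N) (alpha beta : R).
Hypotheses (mA : measurable (A : set T)) (mB : measurable (B : set T)).
Hypotheses (AO : A `<=` Omega) (BO : B `<=` Omega) (AB : A `&` B = set0).
Hypotheses (A2 : leb A <= leb Omega / 2%:E)
  (B2 : leb B <= leb Omega / 2%:E).
Hypotheses (A0 : 0 < leb A) (ab0 : (0 < alpha * beta)%R).

(** Positive measure is required of A alone, so that B = [set0] yields the multiples of a single
    indicator. *)
Let u (x : 'rV[R]_N) : R := (alpha * \1_A x - beta * \1_B x)%R.

Lemma two_sets_integrable : leb.-integrable (Omega : set T) (EFin \o u).
Proof.
rewrite (_ : EFin \o u = (fun x : T => alpha%:E * (\1_A x)%:E) \- (fun x : T => beta%:E * (\1_B x)%:E)).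
  by apply: integrableB => //; apply: integrableZl => //; exact: indic_integrable.
by apply/funext => x; rewrite /u/= EFinB !EFinM.
Qed.

Lemma two_sets_total_variation : total_variation_in Omega u <=
  `|alpha|%:E * perimeter A Omega + `|beta|%:E * perimeter B Omega.
Proof.
have iZ C (c : R) : measurable (C : set T) ->
    leb.-integrable (Omega : set T) (EFin \o (fun x : T => c * \1_C x)%R).
  move=> mC; rewrite (_ : _ \o _ = (fun x : T => c%:E * (\1_C x)%:E)).
    by apply: integrableZl => //; exact: indic_integrable.
  by apply/funext => x; rewrite /= EFinM.
have -> : u = (fun x => alpha * \1_A x + (- beta) * \1_B x)%R.
  by apply/funext => x; rewrite /u mulNr.
apply: (le_trans (total_variation_inD oO bO (iZ _ _ mA) (iZ _ _ mB))).
apply: leeD; first exact: (total_variation_inZ oO bO _ (indic_integrable oO bO mA)).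
by rewrite -normrN; exact: (total_variation_inZ oO bO _ (indic_integrable oO bO mB)).
Qed.

Lemma two_sets_abs x : `|u x|%R = (`|alpha| * \1_A x + `|beta| * \1_B x)%R.
Proof.
rewrite /u; have [xA|xA] := pselect (A x).
  have nB : ~ B x by move=> xB; have : (A `&` B) x by []; rewrite AB.
  by rewrite (indic_in xA) (indic_out nB) !mulr0 !mulr1 subr0 addr0.
rewrite (indic_out xA) !mulr0 sub0r add0r normrN normrM.
by congr (_ * _)%R; rewrite indicE; case: (_ \in _); rewrite ?normr0 ?normr1.
Qed.

Lemma two_sets_Lnorm : Lnorm_in 1 Omega u =
  `|alpha|%:E * leb A + `|beta|%:E * leb B.
Proof.
rewrite Lnorm_in1E; under eq_integral do rewrite abse_EFin two_sets_abs EFinD !EFinM.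
have intI C (c : R) : measurable (C : set T) -> C `<=` Omega ->
    \int[leb]_(x in (Omega : set T)) (`|c|%:E * (\1_C x)%:E) = `|c|%:E * leb C.
  move=> mC CO; rewrite integralZl//; last exact: indic_integrable.
  by rewrite integral_indic// setIidl.
by rewrite integralD ?intI//; apply: integrableZl => //; exact: indic_integrable.
Qed.

(** Since alpha and beta have the same sign, one of the sets {u > 0} and {u < 0} lies in A and the
    other in B, both of measure at most half. *)
Lemma two_sets_balanced : total_variation_in Omega u < +oo -> balanced Omega u.
Proof.
move=> tvu; split; first by split => //; exact: two_sets_integrable.
apply/(balanced_half oO bO two_sets_integrable) => b.
have sA x : A x -> u x = alpha.
  move=> xA; have nB : ~ B x by move=> xB; have : (A `&` B) x by []; rewrite AB.
  by rewrite /u (indic_in xA) (indic_out nB) mulr0 mulr1 subr0.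
have sB x : B x -> u x = (- beta)%R.
  move=> xB; have nA : ~ A x by move=> xA; have : (A `&` B) x by []; rewrite AB.
  by rewrite /u (indic_out nA) (indic_in xB) mulr0 mulr1 sub0r.
have sZ x : ~ A x -> ~ B x -> u x = 0%R.
  by move=> nA nB; rewrite /u (indic_out nA) (indic_out nB) !mulr0 subr0.
have ss : (0 < (sgnb b * alpha) * (sgnb b * beta))%R.
  by rewrite mulrACA -expr2 sqrr_sign mul1r.
have [sa|sa] := ltP 0%R (sgnb b * alpha)%R.
  have sb : (0 < sgnb b * beta)%R by move: ss; rewrite pmulr_rgt0.
  apply: le_trans A2; apply: le_lebesgue_outer => x [_ /= ux]; apply: contrapT => nA.
  have [/sB xB|nB] := pselect (B x); move: ux; last by rewrite sZ// mulr0 ltxx.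
  by rewrite xB mulrN oppr_gt0 ltNge ltW.
apply: le_trans B2; apply: le_lebesgue_outer => x [_ /= ux]; apply: contrapT => nB.
have [/sA xA|nA] := pselect (A x); move: ux; last by rewrite sZ// mulr0 ltxx.
by rewrite xA ltNge sa.
Qed.

Lemma two_sets_admissible : perimeter A Omega < +oo -> perimeter B Omega < +oo ->
  lambda11_admissible Omega u.
Proof.
move=> PA PB; split.
  apply: two_sets_balanced; apply: le_lt_trans two_sets_total_variation _.
  have P0 C : 0 <= perimeter C Omega by exact: total_variation_in_ge0.
  by rewrite lte_add_pinfty// lte_mul_pinfty// lee_fin.
have mu : measurable_fun (Omega : set T) u.
  exact/measurable_EFinP/(measurable_int leb)/two_sets_integrable.
move=> /(Lnorm_in1_eq0 mu); rewrite two_sets_Lnorm; apply/eqP; rewrite gt_eqF//.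
apply: (@lt_le_trans _ _ (`|alpha|%:E * leb A)).
  rewrite mule_gt0// lte_fin normr_gt0; apply: contraTneq ab0 => ->.
  by rewrite mul0r ltxx.
by rewrite leeDl// mule_ge0 ?lee_fin//; exact: lebesgue_outer_ge0.
Qed.

End TwoSets.

End Minimizers.

Section Characterization.
Context {R : realType} {N : nat}.
Local Notation T := (lebesgue_rV R N).
Context (Omega : set 'rV[R]_N) (oO : open Omega) (bO : bounded_set Omega).
Context (Opos : (0 < leb Omega)%E).
Implicit Types (u : 'rV[R]_N -> R) (A B : set 'rV[R]_N).

Let mO : measurable (Omega : set T). Proof. exact: measurable_open. Qed.

Let half_ge0 : (0 <= leb Omega / 2%:E)%E.
Proof. by rewrite mule_ge0 ?inve_ge0 ?lebesgue_outer_ge0. Qed.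

Local Open Scope ereal_scope.

Lemma lambda11_le_cheeger : lambda11 Omega <= cheeger_neumann Omega.
Proof.
apply: le_ereal_inf_tmp => _ [A [mA AO A0 A2] <-].
have Afin := leb_sub_fin bO AO.
have a0 : (0 < fine (leb A))%R by rewrite fine_gt0// A0 -ge0_fin_numE// lebesgue_outer_ge0.
rewrite -(fineK Afin) edivE//.
(* A set of infinite perimeter has quotient +oo; otherwise its indicator is a competitor for
   [lambda11]. *)
have [PA|PA] := ltP (perimeter A Omega) +oo; last first.
  by move: PA; rewrite leye_eq => /eqP ->; rewrite gt0_mulye ?leey// lte_fin invr_gt0.
pose u x : R := (1 * \1_A x - 1 * \1_set0 x)%R.
have uadm : lambda11_admissible Omega u.
  apply: (two_sets_admissible oO bO mA measurable0) => //; try exact: sub0set;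
    by rewrite ?setI0 ?measure0 ?mul1r ?perimeter_set0 ?ltry.
apply: (@le_trans _ _ (total_variation_in Omega u / Lnorm_in 1 Omega u)).
  by apply: ereal_inf_lbound; exists u.
rewrite (two_sets_Lnorm oO bO 1 1 mA measurable0 AO (@sub0set _ Omega) (setI0 A)).
rewrite measure0 mule0 adde0 normr1 mul1e -(fineK Afin) edivE// lee_pmul2r ?lte_fin ?invr_gt0//.
apply: le_trans (two_sets_total_variation oO bO 1 1 mA measurable0) _.
by rewrite perimeter_set0 mule0 adde0 normr1 mul1e.
Qed.

Lemma lambda11E : lambda11 Omega = cheeger_neumann Omega.
Proof.
by apply/eqP; rewrite eq_le lambda11_le_cheeger (cheeger_le_lambda11 oO bO Opos).
Qed.

(** In dimension at least 1 a cube of side 2e <= 1 has volume (2e)^N <= 2e, which is at most half of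
    |Omega| once e <= |Omega|/4. *)
Lemma small_neighborhood x0 : (0 < N)%N -> Omega x0 -> exists2 e : R, (0 < e)%R &
  forall A, (forall x, A x -> `|x - x0| < e)%R ->
    A `<=` Omega /\ leb A <= leb Omega / 2%:E.
Proof.
move=> N0 Ox0; have Ofin := leb_sub_fin bO (@subset_refl _ Omega).
set o := fine (leb Omega).
have o0 : (0 < o)%R by rewrite fine_gt0// Opos -ge0_fin_numE// lebesgue_outer_ge0.
have /nbhs_ballP[d /= d0 dO] : nbhs x0 Omega by exact: open_nbhs_nbhs.
pose e := Num.min d (Num.min (2^-1) (o / 4))%R.
have [ed [e2 eo]] : (e <= d)%R /\ (e <= 2^-1)%R /\ (e <= o / 4)%R.
  by rewrite /e !ge_min !lexx !orbT.
have e0 : (0 < e)%R by rewrite /e !lt_min d0 invr_gt0 ltr0n divr_gt0.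
exists e => // A Ae; split=> [x /Ae xe|].
  by apply: dO; rewrite -ball_normE /= distrC; exact: lt_le_trans ed.
pose c (s : R) : 'rV[R]_N := (x0 + const_mx s)%R.
apply: (@le_trans _ _ (lebesgue_outer (box (c (- e)%R) (c e)))).
  apply: le_lebesgue_outer => x /Ae; rewrite mx_norm_lt// => /forallP xe i.
  have := xe i; rewrite !mxE ltr_norml => /andP[h1 h2].
  by apply/andP; split; move: h1 h2; lra.
apply: le_trans (lebesgue_outer_box _ _) _.
rewrite -(fineK Ofin) ediv2E -EFinM lee_fin -/o /box_volume.
rewrite (eq_bigr (fun=> 2 * e)%R) => [|i _]; last first.
  rewrite !mxE max_r; last by move: e0; lra.
  by lra.
rewrite prodr_const card_ord -(prednK N0) exprS.
have e1 : (0 <= 2 * e <= 1)%R by apply/andP; split; move: e0 e2; lra.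
apply: (@le_trans _ _ (2 * e)%R); last by move: eo; lra.
by case/andP: e1 => ? ?; rewrite ler_piMr// exprn_ile1.
Qed.

(** No perimeter of an explicit set is computed: for a bump near x0 the norm ||u||_1 is the positive
    mass of the kernel and TV(u) is finite, so h ||u||_1 <= TV(u) would fail for h = +oo. *)
Lemma cheeger_lty : (0 < N)%N -> Omega !=set0 -> cheeger_neumann Omega < +oo.
Proof.
move=> N0 [x0 Ox0]; have [e e0 eP] := small_neighborhood N0 Ox0.
have bb := scaled_bump_sequence e0.
pose u : 'rV[R]_N -> R := translated_kern (scaled_bump e) x0 (fun=> 0%N).
have cu : continuous u := translated_kern_continuous bb (al := fun=> 0%N).
have u0 x : (0 <= u x)%R by exact: rho_ge0.
have uout x : (e <= `|x - x0|)%R -> u x = 0%R by exact: translated_kern_out.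
have bu : bounded_support u.
  exists (e + `|x0|)%R => x xe; apply: uout.
  have := lerB_dist x x0; move: xe; move: (`|x|)%R (`|x0|)%R (`|x - x0|)%R => p q r; lra.
have intu : leb.-integrable [set: T] (EFin \o u) by exact: continuous_integrable.
have intuO : leb.-integrable (Omega : set T) (EFin \o u).
  by apply: integrableS intu => //; exact: measurableT.
have tvu : total_variation_in Omega u < +oo.
  by apply: C1_total_variation_fin => //; exact: (translated_kern_C1 bb).
have Aend x : (0 < u x)%R -> (`|x - x0| < e)%R.
  by move=> ux; rewrite ltNge; apply/negP => /uout h; rewrite h ltxx in ux.
have bal : balanced Omega u.
  split=> //; apply/(balanced_half oO bO intuO) => -[].
    rewrite -superlevel_neg [X in leb X](_ : _ = set0) ?measure0//.
    by apply/seteqP; split => x //= -[_]; rewrite ltNge u0.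
  have [] // := eP (superlevel Omega u false 0%R); rewrite -superlevel_pos => x [_].
  exact: Aend.
have LE : Lnorm_in 1 Omega u = (mass (N := N) e)%:E.
  rewrite Lnorm_in1E -(integral_rhoBr x0 e0) integral_mkcond; apply: eq_integral => x _.
  rewrite patchE; case: ifPn => [_|]; first by rewrite abse_EFin ger0_norm.
  rewrite notin_setE => xO; have xe : (e <= `|x - x0|)%R.
    rewrite leNgt; apply/negP => xe; apply: xO.
    by have [AO _] := eP [set x | (`|x - x0| < e)%R] (fun _ h => h); exact: AO.
  by rewrite -[rho e _]/(u x) uout.
have := cheeger_le_total_variation oO bO Opos intuO bal; rewrite LE => h.
have m0 : (0 < mass (N := N) e)%R by exact: mass_gt0 Opos e0.
rewrite ltey; apply/eqP => hy; move: h; rewrite hy gt0_mulye ?lte_fin// leye_eq => /eqP h.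
by rewrite h ltxx in tvu.
Qed.

(** The variation of a minimizer is finite and its L1 norm is positive and finite, so their
    quotient, which is h, is finite. *)
Lemma minimizer_total_variation u : lambda11_minimizer Omega u ->
  cheeger_neumann Omega \is a fin_num /\
  total_variation_in Omega u = cheeger_neumann Omega * Lnorm_in 1 Omega u.
Proof.
move=> [uadm]; have [L L0 ->] := lambda11_admissible_Lnorm oO uadm.
have [[[_ tvu] _] _] := uadm.
have tv : total_variation_in Omega u \is a fin_num.
  by rewrite ge0_fin_numE//; exact: total_variation_in_ge0.
rewrite lambda11E edivE// -(fineK tv) => <-; rewrite -!EFinM; split => //.
by rewrite -mulrA mulVf ?mulr1// gt_eqF.
Qed.

End Characterization.

(** * Minimizers *)

Section MinimizerLevels.
Context {R : realType} {N : nat}.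
Local Notation T := (lebesgue_rV R N).
Context (Omega : set 'rV[R]_N) (oO : open Omega) (bO : bounded_set Omega).
Context (Opos : (0 < leb Omega)%E).

Local Open Scope ereal_scope.

Lemma eq_of_adde_le (x y p q : \bar R) : x \is a fin_num -> y \is a fin_num ->
  x <= p -> y <= q -> p + q <= x + y -> p = x /\ q = y.
Proof.
case: x => [x| |]//; case: y => [y| |]//; case: p => [p| |]//; case: q => [q| |]// _ _.
rewrite -!EFinD !lee_fin => xp yq pq.
by split; congr (_%:E); apply/eqP; rewrite eq_le; apply/andP; split; move: xp yq pq; lra.
Qed.

Lemma minimizer_superlevels (u : 'rV[R]_N -> R) : lambda11_minimizer Omega u ->
  {ae @lebesgue_measure R, forall t : R, (0 <= t)%R -> forall b,
    0 < leb (superlevel Omega u b t) -> achieves_cheeger Omega (superlevel Omega u b t)}.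
Proof.
move=> umin; have [hfin tvE] := minimizer_total_variation oO bO Opos umin.
have [uadm _] := umin; have [bal _] := uadm; have [[intu _] _] := bal.
have [L L0 LE] := lambda11_admissible_Lnorm oO uadm.
pose m t := cheeger_neumann Omega * leb [set x : T | (0 <= t < `|(u \_ Omega) x|)%R].
have [G [mG GTV Gm GP]] := cheeger_coarea oO bO Opos intu bal.
have mm : measurable_fun setT m by exact: measurable_leb_distribution.
have intmE : \int[lebesgue_measure]_t m t = cheeger_neumann Omega * Lnorm_in 1 Omega u.
  exact: integral_cheeger_distribution.
have m0 t : 0 <= m t by rewrite mule_ge0 ?cheeger_ge0//; exact: lebesgue_outer_ge0.
have G0 t : 0 <= G t by exact: le_trans (m0 t) (Gm t).
have intm : lebesgue_measure.-integrable setT m.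
  apply/integrableP; split => //; under eq_integral do rewrite gee0_abs//.
  by rewrite intmE LE -(fineK hfin) -EFinM ltry.
have intG : lebesgue_measure.-integrable setT G.
  apply/integrableP; split => //; under eq_integral do rewrite gee0_abs//.
  by apply: le_lt_trans GTV _; rewrite tvE LE -(fineK hfin) -EFinM ltry.
have GE : \int[lebesgue_measure]_t G t = \int[lebesgue_measure]_t m t.
  apply/eqP; rewrite eq_le intmE -tvE GTV/= tvE -intmE.
  by apply: ge0_le_integral => // t _; exact: Gm.
(* Finiteness of m(t) makes the difference G(t) - m(t) meaningful. *)
have finm t : m t \is a fin_num.
  rewrite fin_numM//; apply: (leb_sub_fin bO) => x /= /andP[t0].
  apply: contraPP => xO; rewrite patchE memNset// normr0.
  by apply/negP; rewrite -leNgt.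
(* G - m is nonnegative with integral 0, hence it vanishes almost everywhere. *)
have intB : \int[lebesgue_measure]_t `|G t - m t| = 0.
  transitivity (\int[lebesgue_measure]_t (G t - m t)).
    apply: eq_integral => t _; rewrite gee0_abs// sube_ge0 ?finm//; exact: Gm.
  by rewrite integralB// GE subee// intmE LE fin_numM.
have mB : measurable_fun setT (fun t => G t - m t) by exact: emeasurable_funB.
move/(ae_eq_integral_abs lebesgue_measure measurableT mB): intB.
apply: filterS => t /(_ I) /= Gmt t0 b sb.
have Gt : G t = m t.
  by move: Gmt (finm t); case: (G t) => [x| |]; case: (m t) => [y| |]//=; rewrite -EFinB => -[/subr0_eq ->].
have adm c : measurable (superlevel Omega u c t : set T) /\
    leb (superlevel Omega u c t) <= leb Omega / 2%:E.
  split; first exact: measurable_superlevel.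
  apply: le_trans (balanced_superlevel oO bO intu c bal).
  by apply: le_lebesgue_outer; exact: le_superlevel.
have AO c : superlevel Omega u c t `<=` Omega by move=> x [].
have Ple c : cheeger_neumann Omega * leb (superlevel Omega u c t) <=
    perimeter (superlevel Omega u c t) Omega.
  by apply: cheeger_perimeter_le => //; have [] := adm c.
have Afin c : leb (superlevel Omega u c t) \is a fin_num by exact: (leb_sub_fin bO).
(* At such t the two inequalities h |E| <= P(E), for E = {u > t} and E = {u < -t}, add up to an
   equality between finite numbers, so each is an equality. *)
have PE : perimeter (superlevel Omega u b t) Omega =
    cheeger_neumann Omega * leb (superlevel Omega u b t).
  have := GP t t0; rewrite Gt /m leb_distribution//.
  rewrite ge0_muleDr; try exact: lebesgue_outer_ge0.
  have fin c : cheeger_neumann Omega * leb (superlevel Omega u c t) \is a fin_num.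
    by rewrite fin_numM.
  move=> /(eq_of_adde_le (fin false) (fin true) (Ple false) (Ple true)) [e1 e2].
  by case: b {sb}.
split; first by have [mb b2] := adm b; split.
have a0 : (0 < fine (leb (superlevel Omega u b t)))%R.
  by rewrite fine_gt0// sb ltey_eq Afin.
by rewrite PE -(fineK (Afin b)) edivE// -muleA -EFinM mulfV ?mule1// gt_eqF.
Qed.

Section TwoSets.
Context (A B : set 'rV[R]_N) (alpha beta : R).
Hypotheses (hfin : cheeger_neumann Omega < +oo) (AB : A `&` B = set0).
Hypotheses (achA : achieves_cheeger Omega A) (ab0 : (0 < alpha * beta)%R).
(** For B the equality is stated in product form, which the empty set satisfies as well; one and two
    sets are thus treated together. *)
Hypotheses (mB : measurable (B : set T)) (BO : B `<=` Omega)
  (B2 : leb B <= leb Omega / 2%:E)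
  (PB : perimeter B Omega = cheeger_neumann Omega * leb B).

Lemma achieves_cheeger_perimeter C : achieves_cheeger Omega C ->
  perimeter C Omega = cheeger_neumann Omega * leb C.
Proof.
move=> [[mC CO C0 C2] <-]; have Cfin := leb_sub_fin bO CO.
have c0 : (0 < fine (leb C))%R by rewrite fine_gt0// C0 -ge0_fin_numE// lebesgue_outer_ge0.
by rewrite -(fineK Cfin) edivE// -muleA -EFinM mulVf ?mule1// gt_eqF.
Qed.

Lemma two_sets_minimizer :
  lambda11_minimizer Omega (fun x => alpha * \1_A x - beta * \1_B x)%R.
Proof.
have [[mA AO A0 A2] _] := achA; have PA := achieves_cheeger_perimeter achA.
have hf : cheeger_neumann Omega \is a fin_num by rewrite ge0_fin_numE// cheeger_ge0.
have Afin := leb_sub_fin bO AO; have Bfin := leb_sub_fin bO BO.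
have Pfin C : C `<=` Omega -> cheeger_neumann Omega * leb C < +oo.
  by move=> CO; rewrite -(fineK hf) -(fineK (leb_sub_fin bO CO)) -EFinM ltry.
have uadm := two_sets_admissible oO bO mA mB AO BO AB A2 B2 A0 ab0.
rewrite PA PB in uadm; have {}uadm := uadm (Pfin _ AO) (Pfin _ BO).
split=> //; rewrite lambda11E//; have [L L0 LE] := lambda11_admissible_Lnorm oO uadm.
have [bal _] := uadm; have [[intu _] _] := bal.
have tvE : total_variation_in Omega (fun x => alpha * \1_A x - beta * \1_B x)%R =
    cheeger_neumann Omega * L%:E.
  (* One inequality is the comparison valid for all balanced functions, the other the subadditivity
     of the variation. *)
  apply/eqP; rewrite eq_le -LE cheeger_le_total_variation// andbT.
  apply: (le_trans (two_sets_total_variation oO bO alpha beta mA mB)).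
  rewrite (two_sets_Lnorm oO bO alpha beta mA mB AO BO AB) PA PB.
  move: hf Afin Bfin; move: (cheeger_neumann Omega) (leb A) (leb B).
  move=> [h| |]// [a| |]// [b| |]// _ _ _; rewrite -!EFinM -!EFinD lee_fin.
  by rewrite mulrDr !(mulrCA h).
by rewrite tvE LE edivE// -muleA -EFinM mulfV ?mule1// gt_eqF.
Qed.

End TwoSets.

End MinimizerLevels.

(** * Positive and negative parts *)

Section Truncations.
Context {R : realType} {N : nat}.
Local Notation T := (lebesgue_rV R N).
Context (Omega : set 'rV[R]_N) (u : 'rV[R]_N -> R) (b : bool).

(** u^+ for b = [false] and u^- for b = [true], in a single formula. *)
Let trunc (x : 'rV[R]_N) : R := Num.max (sgnb b * u x) 0.

Lemma superlevel_truncation t : 0 <= t ->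
  Omega `&` [set x | t < trunc x] = superlevel Omega u b t.
Proof.
move=> t0; congr (_ `&` _); apply/seteqP; split => x /=; rewrite /trunc lt_max.
  by case/orP => //; rewrite ltNge t0.
by move=> ->.
Qed.

(** If the superlevel set were null, the truncation would be at most t almost everywhere, and so
    would its essential supremum. *)
Lemma Lnorm_oo_superlevel t : measurable (superlevel Omega u b t : set T) -> 0 <= t ->
  (t%:E < Lnorm_in +oo Omega trunc)%E -> (0 < leb (superlevel Omega u b t))%E.
Proof.
move=> mt t0; apply: contraTT; rewrite -leNgt => s0; rewrite -leNgt /Lnorm_in unlock.
(* On a space of measure 0 the norm has the default value 0, which is at most t. *)
case: ifPn => [_|_]; last by rewrite lee_fin.
apply/ess_supP; exists (superlevel Omega u b t); split => //.
  by apply/eqP; rewrite eq_le s0 lebesgue_outer_ge0.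
move=> x /= /negP; rewrite -ltNge patchE; case: ifPn => [|_].
  rewrite inE => Ox; rewrite lte_fin ger0_norm; last by rewrite /trunc le_max lexx orbT.
  by move=> tx; rewrite -superlevel_truncation.
by rewrite abse0 lte_fin ltNge t0.
Qed.

End Truncations.

(** * Domains of measure zero *)

Section NullDomain.
Context {R : realType} {N : nat}.
Local Notation T := (lebesgue_rV R N).
Context (Omega : set 'rV[R]_N) (mO : measurable (Omega : set T)) (O0 : leb Omega = 0%E).

Lemma null_cheeger_admissible A : ~ cheeger_admissible Omega A.
Proof.
move=> [_ _ A0]; rewrite O0 mul0e => A0'.
by have := lt_le_trans A0 A0'; rewrite ltxx.
Qed.

Lemma null_lambda11_admissible u : ~ lambda11_admissible Omega u.
Proof.
move=> [_]; apply; exists Omega; split => // x /= h.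
by apply: contrapT => Ox; apply: h => /Ox.
Qed.

End NullDomain.

Theorem theorem1p4 (R : realType) (N : nat) (hN : (2 <= N)%N)
    (Omega : set 'rV[R]_N) (hOmega : bounded_lipschitz_domain Omega) :
  [/\ lambda11 Omega = cheeger_neumann Omega,
      (forall u : 'rV[R]_N -> R, lambda11_minimizer Omega u ->
        (Lnorm_in +oo%E Omega u^\+ <> 0%E ->
          {ae @lebesgue_measure R, forall t : R,
            0 < t -> (t%:E < Lnorm_in +oo Omega (u^\+)%R)%E ->
            achieves_cheeger Omega (Omega `&` [set x | u^\+ x > t])}) /\
        (Lnorm_in +oo%E Omega u^\- <> 0%E ->
          {ae @lebesgue_measure R, forall t : R,
            0 < t -> (t%:E < Lnorm_in +oo Omega (u^\-)%R)%E ->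
            achieves_cheeger Omega (Omega `&` [set x | u^\- x > t])})) &
      (forall A : set 'rV[R]_N, achieves_cheeger Omega A ->
        lambda11_minimizer Omega \1_A /\
        (forall B : set 'rV[R]_N, achieves_cheeger Omega B ->
          A `&` B = set0 ->
          forall alpha beta : R, alpha <> 0 -> beta <> 0 -> 0 <= alpha * beta ->
          lambda11_minimizer Omega
            (fun x => alpha * \1_A x - beta * \1_B x)))].
Proof.
have [oO _ O0 bO _] := hOmega.
have mO : measurable (Omega : set (lebesgue_rV R N)) by exact: measurable_open.
(* If Omega is null, both infima are over empty sets and nothing is a minimizer, so all the claims
   hold; otherwise the measure of Omega is positive, which makes the mass of the mollifiers
   positive. *)
have := lebesgue_outer_ge0 Omega; rewrite le_eqVlt => /predU1P[/esym null|Opos].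
  have noA A : ~ achieves_cheeger Omega A by move=> [/(null_cheeger_admissible null)].
  have nou u : ~ lambda11_minimizer Omega u.
    by move=> [/(null_lambda11_admissible mO null)].
  split=> [|u /nou//|A /noA//].
  congr ereal_inf; apply/seteqP; split=> _ [v vadm <-]; exfalso.
    exact: null_lambda11_admissible vadm.
  exact: null_cheeger_admissible vadm.
split; first exact: lambda11E.
- move=> u umin; have [[[[intu _] _] _] _] := umin.
  have [Z [mZ Z0 ZP]] := minimizer_superlevels oO bO Opos umin.
  have posE : u^\+ = fun x => Num.max (sgnb false * u x) 0.
    by apply/funext => x; rewrite sgnb_false.
  have negE : u^\- = fun x => Num.max (sgnb true * u x) 0.
    by apply/funext => x; rewrite sgnb_true.
  (* The exceptional null set is the one found for the superlevel sets; for t below the essential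
     supremum the superlevel set has positive measure. *)
  split=> _; exists Z; split=> // t /= h; apply: ZP => /= Pt; apply: h => t0;
    rewrite ?posE ?negE superlevel_truncation ?(ltW t0)// => tL; apply: (Pt (ltW t0));
    by apply: (Lnorm_oo_superlevel _ (ltW t0) tL); exact: measurable_superlevel.
- move=> A achA; have hfin := cheeger_lty oO bO Opos (ltnW hN) O0; split.
    (* A single indicator is the combination with B empty and both coefficients equal to 1. *)
    have -> : (\1_A : 'rV[R]_N -> R) = (fun x => 1 * \1_A x - 1 * \1_set0 x).
      by apply/funext => x; rewrite !mul1r (@indic_out _ _ set0)// subr0.
    apply: two_sets_minimizer => //; first exact: setI0.
    + by rewrite measure0 mule_ge0 ?inve_ge0 ?lebesgue_outer_ge0.
    + by rewrite perimeter_set0 measure0 mule0.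
  move=> B achB AB alpha beta /eqP a0 /eqP b0 ab; have [[mB BO _ B2] _] := achB.
  apply: two_sets_minimizer => //; last exact: achieves_cheeger_perimeter.
  by rewrite lt_neqAle eq_sym mulf_neq0.
Qed.
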